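(* Let $0<\nu\le1$ and $\lambda>0$, and let $T_1,T_2,\ldots$ be the inter-birth times of the fractional Yule process with parameters $\nu,\lambda$. For each $n\ge2$ let $\widehat{\nu}_{ls},\widehat{\lambda}_{ls}$ be the least-squares-based estimators of $\nu,\lambda$ computed from $T_1,\ldots,T_n$. Put $\overline{\ln i}=\frac1n\sum_{j=1}^n\ln j$, $s=\sum_{j=1}^n(\ln j-\overline{\ln i})^2$, $\sigma_\varepsilon^2=\pi^2\left(\frac{1}{3\nu^2}-\frac16\right)$ and $$\mathbf{C}=\begin{pmatrix}C_1&C_{12}\\ C_{21}&C_2\end{pmatrix},\qquad C_1=\nu^4s^{-1},\qquad C_{12}=C_{21}=\lambda\nu^3\,\frac{\overline{\ln i}+\ln\lambda}{s},$$ $$C_2=(\nu\lambda)^2\left(\frac1n+\frac{\overline{\ln i}^{\,2}+2\ln(\lambda)\,\overline{\ln i}+(\ln\lambda)^2}{s}\right).$$ Then, as $n\to\infty$, the vector $\sqrt n\,(\widehat{\nu}_{ls}-\nu,\ \widehat{\lambda}_{ls}-\lambda)^{\mathrm T}$ is asymptotically $N[\mathbf 0,\,n\sigma_\varepsilon^2\mathbf C]$, in the sense that $$\big(n\sigma_\varepsilon^2\mathbf C\big)^{-1/2}\sqrt n\begin{pmatrix}\widehat{\nu}_{ls}-\nu\\ \widehat{\lambda}_{ls}-\lambda\end{pmatrix}\ \stackrel{d}{\longrightarrow}\ N[\mathbf 0,\mathbf I_2],$$ where $\stackrel{d}{\longrightarrow}$ denotes convergence in distribution and $\mathbf I_2$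 is the $2\times2$ identity matrix.
   Context: The Mittag--Leffler function is $E_{\delta,\beta}(x)=\sum_{j=0}^\infty \frac{x^j}{\Gamma(\delta j+\beta)}$. The inter-birth times $T_1,T_2,\ldots$ of the fractional Yule (fractional linear birth) process with one progenitor and parameters $\nu,\lambda$ are independent, with $T_i$ having density $f_i(t)=\lambda i\,t^{\nu-1}E_{\nu,\nu}(-\lambda i\,t^\nu)$, $t>0$, $i\ge1$. Let $T_i'=\ln T_i$ and let $\gamma\approx0.5772156649$ be the Euler--Mascheroni constant. One has $\mathbb{E}T_i'=a_0+a_1\ln i$ with $a_0=-\frac{\ln\lambda}{\nu}-\gamma$, $a_1=-\frac1\nu$, and $\operatorname{Var}T_i'=\sigma_\varepsilon^2=\pi^2\left(\frac1{3\nu^2}-\frac16\right)$, which leads to the simple linear regression model $T_i'=a_0+a_1\ln i+\varepsilon_i$, $i=1,\ldots,n$, with i.i.d. errors of mean $0$ and variance $\sigma_\varepsilon^2$. The least squares estimators are $$\widehat a_1=\frac{\sum_{j=1}^nT_j'(\ln j-\overline{\ln i})}{\sum_{j=1}^n(\ln j-\overline{\ln i})^2},\qquad \widehat a_0=\frac1n\sum_{j=1}^nT_j'-\widehat a_1\,\overline{\ln i},$$ and the least-squares-based estimators are $$\widehat\nu_{ls}=-\frac1{\widehat a_1},\qquad \widehat\lambda_{ls}=\exp\left(\frac{\widehat a_0+\gamma}{\widehat a_1}\right).$$ The matrix power $-1/2$ is the inverse of the symmetric positive definite square root. The quantities $\overline{\ln i}$, $s$, $\mathbf C$ and the estimators depend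 on $n$. *)

(* Defs.v *)
From HB Require Import structures.
From mathcomp Require Import all_boot all_order all_algebra.
From mathcomp Require Import all_classical all_reals all_analysis.
Set Implicit Arguments.
Unset Strict Implicit.
Unset Printing Implicit Defensive.
Import Order.TTheory GRing.Theory Num.Theory.
Import numFieldNormedType.Exports.
Local Open Scope classical_set_scope.
Local Open Scope ring_scope.

Section SpecialFunctions.
Context {R : realType}.
Implicit Types (x t delta beta nu lambda : R) (n i : nat).

(* Euler's integral; it converges for [0 < x], the only case used below. *)
Definition Gamma x : R :=
  (\int[lebesgue_measure]_(t in `]0%R, +oo[) (t `^ (x - 1) * expR (- t)))%R.

Definition mittag_leffler delta beta x : R :=
  limn (fun n => \sum_(0 <= j < n) x ^+ j / Gamma (delta * j%:R + beta)).

Definition euler_gamma : R :=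
  limn (fun n => (\sum_(1 <= k < n.+1) k%:R^-1) - ln n%:R : R).

(* Density on the open half-line [0 < t]. *)
Definition interbirth_density nu lambda i t : R :=
  lambda * i%:R * t `^ (nu - 1) *
  mittag_leffler nu nu (- (lambda * i%:R * t `^ nu)).

End SpecialFunctions.

Section Probability.
Context {d : measure_display} {T : measurableType d} {R : realType}.
Variable P : probability T R.

(* Mutual independence of the subfamily of [X] indexed by [D]. *)
Definition mutually_independent (D : set nat) (X : nat -> {RV P >-> R}) : Prop :=
  forall (J : seq nat) (B : nat -> set R),
    uniq J -> (forall i, i \in J -> D i) -> (forall i, measurable (B i)) ->
    P (\bigcap_(i in [set` J]) (X i @^-1` B i)) =
    (\prod_(i <- J) P (X i @^-1` B i))%E.

(* The times are indexed from 1; [X 0] is unconstrained and never used. *)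
Definition fractional_yule_interbirth (nu lambda : R)
    (X : nat -> {RV P >-> R}) : Prop :=
  mutually_independent [set i | (0 < i)%N] X /\
  forall i, (0 < i)%N -> forall B : set R, measurable B ->
    distribution P (X i) B =
    (\int[lebesgue_measure]_(t in B `&` `]0%R, +oo[)
       (interbirth_density nu lambda i t)%:E)%E.

(* Convergence in distribution of random vectors of R^2 to the law [mu],
   tested against bounded continuous functions. *)
Definition cvg_in_distribution2 (Z : nat -> T -> 'cV[R]_2)
    (mu : {measure set (measurableTypeR R * measurableTypeR R) -> \bar R}) : Prop :=
  forall h : R * R -> R, continuous h -> (exists M : R, forall z, `|h z| <= M) ->
    ('E_P[fun w => h ((Z n w 0 0)%R, (Z n w 1 0)%R)] @[n --> \oo] -->
     \int[mu]_z (h z)%:E)%E.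

End Probability.

(* N(0, I_2): the law of two independent standard normal variables. *)
Definition std_normal2 (R : realType) : {measure set (measurableTypeR R * measurableTypeR R) -> \bar R} :=
  (normal_prob (0 : R) 1 \x normal_prob (0 : R) 1)%E.

Section Matrices.
Context {R : realType}.

Definition sym_posdef k (A : 'M[R]_k) : Prop :=
  A^T = A /\ forall v : 'cV[R]_k, v != 0 -> 0 < (v^T *m A *m v) 0 0.

(* Such a square root is unique; the value is 0 when there is none. *)
Definition sqrtmx k (A : 'M[R]_k) : 'M[R]_k :=
  xget 0 [set S | sym_posdef S /\ S *m S = A].

Definition invsqrtmx k (A : 'M[R]_k) : 'M[R]_k := invmx (sqrtmx A).

Definition col2 (a b : R) : 'cV[R]_2 := \col_i (if i == 0 then a else b).

Definition mx22 (a b c d : R) : 'M[R]_2 :=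
  \matrix_(i, j) (if i == 0 then (if j == 0 then a else b)
                  else (if j == 0 then c else d)).

End Matrices.

Section LeastSquares.
Context {R : realType}.
Implicit Types (nu lambda : R) (n : nat) (y : nat -> R).

Definition mean_ln n : R := n%:R^-1 * \sum_(1 <= j < n.+1) ln j%:R.

Definition ss_ln n : R := \sum_(1 <= j < n.+1) (ln j%:R - mean_ln n) ^+ 2.

(* In the estimators, [y j] stands for the observation [ln (T_j)]. *)
Definition hat_a1 n y : R :=
  (\sum_(1 <= j < n.+1) y j * (ln j%:R - mean_ln n)) /
  ss_ln n.

Definition hat_a0 n y : R :=
  n%:R^-1 * (\sum_(1 <= j < n.+1) y j) - hat_a1 n y * mean_ln n.

Definition hat_nu n y : R := - (1 / hat_a1 n y).

Definition hat_lambda n y : R :=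
  expR ((hat_a0 n y + euler_gamma) / hat_a1 n y).

Definition sigma2_eps nu : R := pi ^+ 2 * (1 / (3 * nu ^+ 2) - 1 / 6).

Definition covC nu lambda n : 'M[R]_2 :=
  let m := mean_ln n in
  let s := ss_ln n in
  let C1 := nu ^+ 4 * s^-1 in
  let C12 := lambda * nu ^+ 3 * ((m + ln lambda) / s) in
  let C2 := (nu * lambda) ^+ 2 *
    (n%:R^-1 + (m ^+ 2 + 2 * ln lambda * m + ln lambda ^+ 2) / s) in
  mx22 C1 C12 C12 C2.

End LeastSquares.

(* Main.v *)
(** Put L = lambda i.  The Mittag-Leffler density f of T_i satisfies the
    Volterra equation f + L I^nu f = L t^(nu-1) / Gamma(nu), hence
    E exp(- z T_i) = L / (L + z^nu).  If X is a unit exponential variable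
    independent of T_i, then P(nu (ln X - ln T_i) - ln L > u) =
    E exp(- (L e^u)^(1/nu) T_i) = 1 / (1 + e^u), which is also the value of
    P(ln X - ln X' > u) for a copy X' of X.  So nu (ln X - ln T_i) - ln L and
    ln X - ln X' have the same law, and the moments of ln T_i follow from
    E ln X = - gamma and Var ln X = pi^2 / 6.

    The estimators depend on the residuals e_j through
    N1 = sum_j (ln j - m) e_j / (sigma sqrt s) and N2 = sum_j e_j / (sigma sqrt n),
    which are jointly asymptotically standard normal: E cos(a N1 + b N2 + th) is
    computed by telescoping over the independent e_j with an error
    O(sum_j |c_j|^3) that is uniform in (a, b) on bounded sets.  On the event
    |N1|, |N2| <= B, the errors (hat nu - nu, hat lambda - lambda) are, up to o(1)
    after normalisation, a lower triangular linear image of (N1, N2), and the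
    triangular factor and the symmetric square root of the same matrix differ by
    a rotation Q_n.  As N(0, I_2) is rotation invariant, the uniformity in (a, b)
    makes any knowledge of the rotations Q_n unnecessary.  Levy's continuity
    theorem in R^2 is obtained by smoothing a test function with a Gaussian
    kernel, which is itself a Gaussian average of cosines. *)
Require Import Defs.
From HB Require Import structures.
From mathcomp Require Import all_boot all_order all_algebra.
From mathcomp Require Import all_classical all_reals all_analysis.
From mathcomp Require Import measurable_realfun ring lra zify.
Set Implicit Arguments.
Unset Strict Implicit.
Unset Printing Implicit Defensive.
Import Order.TTheory GRing.Theory Num.Theory.
Import numFieldNormedType.Exports.
Local Open Scope classical_set_scope.
Local Open Scope ring_scope.

(** * Integration with respect to a density *)

(** Two obstacles shape the argument. The sign of the Mittag-Leffler density is unknown. Instead of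
    proving complete monotonicity, the hypothesis that this density integrates to a probability over
    every Borel set is used to show that its negative part is null, and Tonelli's theorem then
    applies to the positive part. Moreover the normalising matrix has no limit: the mean of [ln j]
    grows like [ln n], the two estimators become asymptotically collinear, and the delta method with
    a fixed covariance does not apply. The linearisation is therefore made in coordinates adapted to
    each [n], where on [|N1|, |N2| <= B] the errors are at most a constant times
    [(1 + ln n)^2 / sqrt n]. Integrals are kept as far as possible to nonnegative or bounded
    functions: a first moment comes from comparing two shifted squares, and characteristic functions
    are replaced by means of [cos (x + th)], where the phase [th] does the work of the imaginary
    part. Euler's constant and the series of inverse squares both arise by letting the shape of a
    Gamma law tend to infinity. *)

Section density.
Context d (T : measurableType d) (R : realType).
Variables (m nu : {measure set T -> \bar R}) (f : T -> R).
Hypotheses (f0 : forall x, 0 <= f x) (mf : measurable_fun setT f).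
Hypothesis nuE : forall A, measurable A -> nu A = (\int[m]_(x in A) (f x)%:E)%E.

Import HBNNSimple.

Let density_nnsfun (h : {nnsfun T >-> R}) :
  (\int[nu]_x (h x)%:E = \int[m]_x ((h x)%:E * (f x)%:E))%E.
Proof.
under [LHS]eq_integral do rewrite fimfunE -fsumEFin//.
rewrite [LHS]ge0_integral_fsum//; last 2 first.
  - by move=> r; exact/measurable_EFinP/measurableT_comp.
  - by move=> n x _; rewrite EFinM nnfun_muleindic_ge0.
under [RHS]eq_integral.
  move=> x xD; rewrite fimfunE -fsumEFin// ge0_mule_fsuml; last first.
    by move=> r; rewrite EFinM nnfun_muleindic_ge0.
  over.
rewrite [RHS]ge0_integral_fsum//; last 2 first.
  - move=> r; apply: emeasurable_funM; last exact/measurable_EFinP.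
    by apply/measurable_EFinP; do 2 apply/measurableT_comp => //.
  - move=> n x _; rewrite EFinM mule_ge0//; last by rewrite lee_fin.
    by rewrite nnfun_muleindic_ge0.
apply: eq_fsbigr => r _.
rewrite integralZl_indic_nnsfun// integral_indic// setIT nuE//.
have mi : measurable_fun setT (fun x => ((\1_(h @^-1` [set r]) x)%:E * (f x)%:E)%E).
  apply: emeasurable_funM; last exact/measurable_EFinP.
  exact/measurable_EFinP.
have -> : (\int[m]_(x in h @^-1` [set r]) (f x)%:E =
    \int[m]_x ((\1_(h @^-1` [set r]) x)%:E * (f x)%:E))%E.
  rewrite integral_mkcond; apply: eq_integral => x _.
  by rewrite patchE indicE; case: ifPn => _; rewrite ?mul1e ?mul0e.
have [r0|r0] := leP 0 r.
  rewrite -ge0_integralZl//.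
    by under eq_integral do rewrite muleA -EFinM.
  by move=> x _; rewrite mule_ge0// lee_fin.
(* A nonnegative simple function never takes the value [r < 0], so both sides vanish. *)
rewrite preimage_nnfun0//.
rewrite integral0_eq ?mule0; last by move=> x _; rewrite indic0 mul0e.
by rewrite integral0_eq// => x _; rewrite indic0 mulr0 mul0e.
Qed.

(** Simple functions, then monotone convergence on both sides. Asking only for [nuE] on sets lets
    the same rule serve the exponential and normal laws, the law of an inter-birth time, and the
    zero measure. *)
Lemma ge0_integral_density (g : T -> \bar R) :
  measurable_fun setT g -> (forall x, 0 <= g x)%E ->
  (\int[nu]_x g x = \int[m]_x (g x * (f x)%:E))%E.
Proof.
move=> mg g0; pose h := nnsfun_approx measurableT mg.
transitivity (limn (fun n => \int[nu]_x (h n x)%:E)%E).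
  rewrite -monotone_convergence//=.
  - apply: eq_integral => ? /[!inE] xD; apply/esym/cvg_lim => //=.
    exact: cvg_nnsfun_approx.
  - by move=> n; exact/measurable_EFinP/measurable_funTS.
  - by move=> n ? _; rewrite lee_fin.
  - by move=> ? _ ? ? mn; rewrite lee_fin; exact/lefP/nd_nnsfun_approx.
under eq_fun do rewrite density_nnsfun.
rewrite -monotone_convergence//=.
- apply: eq_integral => x /[!inE] xD; apply/cvg_lim => //=.
  by apply: cvgeZr => //; exact: cvg_nnsfun_approx.
- move=> n; apply: emeasurable_funM; last exact/measurable_EFinP.
  exact/measurable_EFinP/measurable_funTS.
- by move=> n ? _; rewrite mule_ge0// lee_fin.
- by move=> ? _ ? ? mn; rewrite lee_wpmul2r ?lee_fin//; exact/lefP/nd_nnsfun_approx.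
Qed.

End density.

Section affine_change.
Context {R : realType}.
Notation leb := (@lebesgue_measure R).

(** The image of Lebesgue measure under [x |-> a x + b], multiplied by [a], gives every half-open
    interval its length, hence is Lebesgue measure. *)
Lemma ge0_integral_affine (a b : R) (g : R -> \bar R) : 0 < a ->
  measurable_fun setT g -> (forall x, 0 <= g x)%E ->
  (\int[leb]_x g x = a%:E * \int[leb]_x g (a * x + b)%R)%E.
Proof.
move=> a0 mg g0.
pose phi (x : measurableTypeR R) : measurableTypeR R := a * x + b.
have mphi : measurable_fun setT phi.
  by apply: measurable_funD => //; exact: measurable_funM.
pose nn : {nonneg R} := NngNum (ltW a0).
pose m2 : {measure set (measurableTypeR R) -> \bar R} :=
  mscale nn
    (measure_function_pushforward__canonical__measure_function_Measure leb mphi).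
rewrite (eq_measure_integral m2); last first.
  move=> A mA _; apply: lebesgue_measure_unique => // X [[u v]] _ <- /=.
  rewrite /m2 /mscale /= /pushforward.
  have -> : phi @^-1` `]u, v] = `](u - b) / a, (v - b) / a]%classic.
    apply/seteqP; split => x /=; rewrite !in_itv/= /phi.
      by move=> /andP[h1 h2]; rewrite ltr_pdivrMr// ler_pdivlMr//; lra.
    by rewrite ltr_pdivrMr// ler_pdivlMr// => /andP[h1 h2]; lra.
  rewrite lebesgue_measure_itv lebesgue_measure_itv/= !lte_fin.
  rewrite ltr_pM2r ?invr_gt0// ltrD2r; case: ifPn => _; last by rewrite mule0.
  by rewrite -!EFinB -EFinM; congr (_%:E); field; rewrite gt_eqF.
rewrite ge0_integral_mscale//; congr (_ * _)%E.
by rewrite ge0_integral_pushforward.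
Qed.

End affine_change.

Section bounded_functions.
Context d (T : measurableType d) (R : realType).

Lemma bounded_integrable (P : probability T R) (f : T -> R) (M : R) :
  measurable_fun setT f -> (forall x, `|f x| <= M) ->
  P.-integrable setT (EFin \o f).
Proof.
move=> mf fM; apply: measurable_bounded_integrable => //.
  by rewrite -ge0_fin_numE// fin_num_measure.
exists M; split; first by rewrite num_real.
by move=> x Mx y _; apply: (le_trans (fM y)); exact: ltW.
Qed.

Lemma Rintegral_prob_cst (P : probability T R) (r : R) : \int[P]_x r = r.
Proof.
rewrite Rintegral_cst// [X in fine X](_ : _ = 1%E) ?mulr1//.
exact: probability_setT.
Qed.

Lemma norm_Rintegral_bounded (P : probability T R) (f : T -> R) (M : R) :
  measurable_fun setT f -> (forall x, `|f x| <= M) ->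
  `|\int[P]_x f x| <= M.
Proof.
move=> mf fM.
apply: le_trans (le_normr_Rintegral _ _) _ => //; first exact: bounded_integrable fM.
have -> : M = \int[P]_(_ in setT) M.
  by rewrite Rintegral_prob_cst.
apply: le_Rintegral => //.
  apply: (@bounded_integrable P _ M) => //; first exact: measurableT_comp.
  by move=> x; rewrite normr_id.
apply: (@bounded_integrable P _ `|M|) => //.
Qed.

End bounded_functions.

(** * The Gamma function and fractional integrals *)

Section improper_FTC.
Context {R : realType}.
Notation leb := (@lebesgue_measure R).
Variables (F f : R -> R) (l0 l : R).
Hypothesis dF : forall x : R, 0 < x -> is_derive x 1 F (f x).
Hypothesis cf : forall x : R, 0 < x -> {for x, continuous f}.
Hypothesis Fy : F x @[x --> +oo%R] --> l.
Hypothesis F0 : F x @[x --> 0^'+] --> l0.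

(** Compact intervals exhausting the open half-line; the shift by 2 keeps them nondegenerate from
    [n = 0] on. *)
Let A (n : nat) : set R := `[n.+2%:R^-1, n.+2%:R]%classic.

Let natV_gt0 n : 0 < n.+2%:R^-1 :> R.
Proof. by rewrite invr_gt0. Qed.

Let natV_lt n : n.+2%:R^-1 < n.+2%:R :> R.
Proof. by rewrite (@lt_trans _ _ 1)// ?ltr1n// invf_lt1// ltr1n. Qed.

Let subA n : A n `<=` `]0, +oo[%classic.
Proof.
move=> x; rewrite /A /= !in_itv/= => /andP[h _]; rewrite andbT.
exact: lt_le_trans h.
Qed.

Let mf : measurable_fun (`]0, +oo[%classic : set R) f.
Proof.
apply: open_continuous_measurable_fun; first exact: interval_open.
by move=> x; rewrite inE/= in_itv/= andbT => /cf.
Qed.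

Let FTC_A n : (\int[leb]_(x in A n) (f x)%:E = (F n.+2%:R - F n.+2%:R^-1)%:E)%E.
Proof.
have A0 x : n.+2%:R^-1 <= x -> 0 < x by exact: lt_le_trans.
rewrite (@continuous_FTC2 _ f F)//.
- apply: continuous_in_subspaceT => x.
  by rewrite inE/= in_itv/= => /andP[/A0 + _]; exact: cf.
- split.
  + by move=> x; rewrite in_itv/= => /andP[/ltW /A0 /dF []].
  + apply: cvg_at_right_filter; apply: differentiable_continuous.
    by apply/derivable1_diffP; have [] := dF (natV_gt0 n).
  + apply: cvg_at_left_filter; apply: differentiable_continuous.
    by apply/derivable1_diffP; have [] := dF (lt_trans (natV_gt0 n) (natV_lt n)).
- move=> x; rewrite in_itv/= => /andP[/ltW /A0 x0 _].
  by rewrite derive1E; have [] := dF x0.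
Qed.

Let in_A x : 0 < x -> \forall n \near \oo, x \in A n.
Proof.
move=> x0; near=> n; rewrite inE /A /= in_itv/=; apply/andP; split.
- rewrite -[leRHS]invrK lef_pV2 ?posrE ?invr_gt0//.
  rewrite (@le_trans _ _ n%:R) ?ler_nat//; last by rewrite -addn2 leq_addr.
  by near: n; exact: nbhs_infty_ger.
- rewrite (@le_trans _ _ n%:R) ?ler_nat//; last by rewrite -addn2 leq_addr.
  by near: n; exact: nbhs_infty_ger.
Unshelve. all: by end_near. Qed.

Let cvgA : (F n.+2%:R - F n.+2%:R^-1) @[n --> \oo] --> l - l0.
Proof.
apply: cvgB.
- apply: (cvg_comp _ _ _ Fy).
  apply/cvgryPge => r; near=> n.
  rewrite (@le_trans _ _ n%:R) ?ler_nat//; last by rewrite -addn2 leq_addr.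
  by near: n; exact: nbhs_infty_ger.
- have /cvg_at_rightP := F0; apply; split => //.
  by have := @cvg_harmonic R; rewrite -cvg_shiftS.
Unshelve. all: by end_near. Qed.

Let restrictA n : (\int[leb]_(x in `]0%R, +oo[) ((f \_ (A n)) x)%:E =
  (F n.+2%:R - F n.+2%:R^-1)%:E)%E.
Proof.
rewrite -FTC_A; transitivity
  (\int[leb]_(x in `]0%R, +oo[ `&` A n) (f x)%:E)%E; last first.
  by rewrite (setIidr (@subA n)).
rewrite integral_mkcondr; apply: eq_integral => x _.
by rewrite !patchE; case: ifPn.
Qed.

Let mfA n : measurable_fun (`]0, +oo[%classic : set R) (f \_ (A n)).
Proof.
have mA : measurable (A n) by exact: measurable_itv.
by apply/measurable_restrict => //; apply: measurable_funS mf => //; exact: subIsetl.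
Qed.

Let cvg_restrictA x : 0 < x -> (f \_ (A n)) x @[n --> \oo] --> f x.
Proof.
move=> x0; apply: cvg_near_cst; near=> n.
by rewrite patchE ifT//; near: n; exact: in_A.
Unshelve. all: by end_near. Qed.

(** The integral over each [A n] is a difference of two values of [F], hence at most [2 M]; monotone
    convergence passes to the half-line. *)
Lemma ge0_bounded_primitive_lty (M : R) : (forall x, 0 < x -> 0 <= f x) ->
  (forall x, 0 < x -> `|F x| <= M) ->
  (\int[leb]_(x in `]0%R, +oo[) (f x)%:E < +oo)%E.
Proof.
move=> f0 FM.
have fA0 n x : 0 < x -> 0 <= (f \_ (A n)) x.
  by move=> x0; rewrite patchE; case: ifPn => // _; exact: f0.
have nd x (n p : nat) : 0 < x -> (n <= p)%N ->
    (((f \_ (A n)) x)%:E <= ((f \_ (A p)) x)%:E)%E.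
  move=> x0 np; rewrite lee_fin !patchE.
  case: ifPn => [|_]; last by case: ifPn => // _; exact: f0.
  rewrite inE /A/= in_itv/= => /andP[xn nx]; rewrite ifT// inE/= in_itv/=.
  rewrite (le_trans _ xn) ?(le_trans nx) ?ler_nat//.
  by rewrite lef_pV2 ?posrE ?ltr0n// ler_nat.
have -> : (\int[leb]_(x in `]0%R, +oo[) (f x)%:E =
    limn (fun n => \int[leb]_(x in `]0%R, +oo[) ((f \_ (A n)) x)%:E))%E.
  rewrite -monotone_convergence//=.
  - apply: eq_integral => x; rewrite inE/= in_itv/= andbT => x0.
    apply/esym/cvg_lim => //; apply/cvg_EFin; first exact: nearW.
    exact: cvg_restrictA.
  - by move=> n; apply/measurable_EFinP; exact: mfA.
  - by move=> n x /=; rewrite in_itv/= andbT lee_fin; exact: fA0.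
  - by move=> x /=; rewrite in_itv/= andbT => x0 n p np; exact: nd.
apply: (@le_lt_trans _ _ (M + M)%:E); last exact: ltry.
apply: lime_le.
  apply: ereal_nondecreasing_is_cvgn => n p np; apply: ge0_le_integral => //=.
  - by move=> x /=; rewrite in_itv/= andbT lee_fin; exact: fA0.
  - by apply/measurable_EFinP; exact: mfA.
  - by apply/measurable_EFinP; exact: mfA.
  - by move=> x; rewrite in_itv/= andbT => x0; exact: nd.
apply: nearW => n; rewrite restrictA lee_fin.
rewrite (le_trans (ler_norm _))// (le_trans (ler_normB _ _))// lerD ?FM//.
Qed.

(** Here [f] may change sign, as in integrations by parts, so the exhaustion is handled by dominated
    convergence with [|f|] as the bound. *)
Lemma integrable_FTC0y : leb.-integrable `]0, +oo[ (EFin \o f) ->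
  (\int[leb]_(x in `]0%R, +oo[) (f x)%:E = (l - l0)%:E)%E.
Proof.
move=> intf.
have fle (n : nat) (x : R) : (`]0%R, +oo[%classic : set R) x ->
    (`|((f \_ (A n)) x)%:E| <= `|(f x)%:E|)%E.
  by move=> _; rewrite !abse_EFin lee_fin patchE; case: ifPn => // _; rewrite normr0.
have := @dominated_cvg _ _ _ leb `]0, +oo[%classic (measurable_itv _)
  (fun n x => ((f \_ (A n)) x)%:E) (EFin \o f) (fun x => `|(f x)%:E|)%E.
move=> /(_ _ _ _ _ fle).
have -> : (fun n => \int[leb]_(x in `]0%R, +oo[) ((f \_ (A n)) x)%:E)%E =
  (fun n => (F n.+2%:R - F n.+2%:R^-1)%:E) by apply/funext => n; exact: restrictA.
move=> h.
have c : (F n.+2%:R - F n.+2%:R^-1)%:E @[n --> \oo] --> (l - l0)%:E.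
  by apply: cvg_EFin; [exact: nearW|exact: cvgA].
rewrite -(cvg_lim _ c)//; apply/esym/cvg_lim => //; apply: h.
- by move=> n; apply/measurable_EFinP; exact: mfA.
- by move=> x /=; rewrite in_itv/= andbT => x0; apply/cvg_EFin;
    [exact: nearW|exact: cvg_restrictA].
- by move=> x _.
- exact: integrable_abse.
Qed.

End improper_FTC.

Section Gamma_facts.
Context {R : realType}.
Notation leb := (@lebesgue_measure R).
Implicit Types a b x t z : R.

Definition gamma_fun a t : R := t `^ (a - 1) * expR (- t).

Lemma gamma_fun_ge0 a t : 0 <= gamma_fun a t.
Proof. by rewrite mulr_ge0 ?powR_ge0 ?expR_ge0. Qed.

Lemma measurable_gamma_fun a D : measurable_fun D (gamma_fun a).
Proof.
apply: measurable_funTS; apply: measurable_funM; first exact: measurable_powR.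
by apply: measurableT_comp => //; exact: measurableT_comp.
Qed.

Lemma continuous_powR a x : 0 < x -> {for x, continuous (fun y => y `^ a)}.
Proof.
move=> x0; apply: differentiable_continuous.
by apply/derivable1_diffP; have [] := is_derive1_powR a x0.
Qed.

(** With [N = k.+1]: [1 + t <= N (1 + t / N) <= N exp (t / N)], raised to the power [N]. *)
Lemma onem_pow_le_expR (k : nat) t : 0 <= t ->
  (1 + t) ^+ k.+1 <= k.+1%:R ^+ k.+1 * expR t.
Proof.
move=> t0; have k0 : 0 < k.+1%:R :> R by [].
have -> : expR t = expR (t / k.+1%:R) ^+ k.+1.
  by rewrite -expRM_natr divfK// gt_eqF.
rewrite -exprMn lerXn2r ?nnegrE ?addr_ge0 ?mulr_ge0 ?expR_ge0//.
apply: (@le_trans _ _ (k.+1%:R * (1 + t / k.+1%:R))).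
  by rewrite mulrDr mulr1 mulrC mulrVK ?unitfE ?gt_eqF// lerD2r ler1n.
by rewrite ler_wpM2l// expR_ge1Dx.
Qed.

(** The integrand has the explicit primitive [(t / (1 + t))^a / a], bounded by [1 / a]. It serves as
    a majorant of Euler's integrand that is integrable at both ends at once. *)
Lemma integral_beta_prime_lty a : 0 < a ->
  (\int[leb]_(t in `]0%R, +oo[) (t `^ (a - 1) * (1 + t) `^ (- (a + 1)))%:E
   < +oo)%E.
Proof.
move=> a0.
have d1x x : 0 < x -> 1 + x != 0 by move=> x0; rewrite gt_eqF// addr_gt0.
apply: (@ge0_bounded_primitive_lty _ (fun t => a^-1 * (t / (1 + t)) `^ a) _ _ _ a^-1).
- move=> x x0.
  have du : is_derive x 1 (fun t => t / (1 + t)) ((1 + x) ^- 2).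
    have di : is_derive x 1 (fun t => (1 + t)^-1) (- (1 + x) ^- 2).
      apply: is_derive_eq; first by apply: is_deriveV; exact: d1x.
      by rewrite add0r scaler1.
    apply: is_derive_eq.
    by rewrite /GRing.scale /=; field; exact: d1x.
  have u0 : 0 < x / (1 + x) by rewrite divr_gt0// addr_gt0.
  have dp := @is_derive1_comp _ _ _ x _ _ (is_derive1_powR a u0) du.
  have dq := @is_deriveZ _ _ _ _ (a^-1) x 1 _ dp.
  apply: is_derive_eq dq _; rewrite /GRing.scale /= !mulrA mulVf ?gt_eqF// mul1r.
  rewrite powRM ?invr_ge0 ?addr_ge0 ?ltW// -mulrA; congr (_ * _).
  have y0 : 0 < 1 + x by rewrite addr_gt0.
  rewrite -powR_inv1 ?ltW// -powRrM -powR_invn ?ltW// -powRD; last first.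
    by rewrite (gt_eqF y0) implybT.
  by congr (_ `^ _); ring.
- move=> x x0; apply: continuousM; first exact: continuous_powR.
  apply: (@continuous_comp _ _ _ (fun t => 1 + t) (fun t => t `^ _)).
    by apply: continuousD; [exact: cst_continuous|exact: id].
  by apply: continuous_powR; rewrite addr_gt0.
- by move=> x x0; rewrite mulr_ge0 ?powR_ge0.
- move=> x x0; rewrite ger0_norm; last by rewrite mulr_ge0 ?powR_ge0// invr_ge0 ltW.
  rewrite ler_pdivrMl// mulfV ?gt_eqF//.
  have y0 : 0 < 1 + x by rewrite addr_gt0.
  have e1 : 1 `^ a = 1 :> R by rewrite powR1.
  rewrite -[leRHS]e1 ge0_ler_powR ?nnegrE ?(ltW a0)//; first by rewrite divr_ge0// ltW.
  by rewrite ler_pdivrMr// mul1r lerDr.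
Qed.

(** [exp (- t)] is at most a constant times [(1 + t)^(- (a + 1))], by [onem_pow_le_expR] with any
    integer [k + 1 >= a + 1]. *)
Lemma integral_gamma_fun_lty a : 0 < a ->
  (\int[leb]_(t in `]0%R, +oo[) (gamma_fun a t)%:E < +oo)%E.
Proof.
move=> a0; have [k ak] : exists k : nat, a + 1 <= k.+1%:R.
  exists (Num.truncn (a + 1)); apply: ltW; exact: truncnS_gt.
pose C : R := k.+1%:R ^+ k.+1.
have C0 : 0 < C by rewrite exprn_gt0.
apply: (@le_lt_trans _ _ (C%:E *
  \int[leb]_(t in `]0%R, +oo[) (t `^ (a - 1) * (1 + t) `^ (- (a + 1)))%:E)%E).
  rewrite -ge0_integralZl//.
  - apply: ge0_le_integral => //.
    + by move=> x _; rewrite lee_fin gamma_fun_ge0.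
    + by apply/measurable_EFinP; exact: measurable_gamma_fun.
    + apply/measurable_EFinP/measurable_funTS; apply: measurable_funM => //.
      apply: measurable_funM; first exact: measurable_powR.
      apply: (measurableT_comp (measurable_powR _)).
      by apply: measurable_funD.
    + move=> x /=; rewrite in_itv/= andbT => x0.
      rewrite -EFinM lee_fin /gamma_fun mulrCA ler_wpM2l ?powR_ge0//.
      have y0 : 0 < 1 + x by rewrite addr_gt0.
      rewrite powRN expRN ler_pdivlMr ?powR_gt0//.
      rewrite mulrC ler_pdivrMr ?expR_gt0//.
      apply: le_trans (onem_pow_le_expR k (ltW x0)).
      rewrite -powR_mulrn; last exact: ltW.
      by rewrite ler_powR// lerDl ltW.
  - apply/measurable_EFinP/measurable_funTS; apply: measurable_funM.
      exact: measurable_powR.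
    apply: (measurableT_comp (measurable_powR _)).
    by apply: measurable_funD.
  - by move=> x _; rewrite lee_fin mulr_ge0 ?powR_ge0.
  - by rewrite lee_fin ltW.
by rewrite lte_mul_pinfty// ?lee_fin ?ltW// integral_beta_prime_lty.
Qed.

Lemma integrable_gamma_fun a : 0 < a -> leb.-integrable `]0, +oo[ (EFin \o gamma_fun a).
Proof.
move=> a0; apply/integrableP; split.
  by apply/measurable_EFinP; exact: measurable_gamma_fun.
under eq_integral do rewrite abse_EFin ger0_norm ?gamma_fun_ge0//.
exact: integral_gamma_fun_lty.
Qed.

Lemma EFin_Gamma a : 0 < a ->
  (Gamma a)%:E = (\int[leb]_(t in `]0%R, +oo[) (gamma_fun a t)%:E)%E.
Proof.
move=> a0; rewrite /Gamma fineK// ge0_fin_numE ?integral_gamma_fun_lty//.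
by apply: integral_ge0 => x _; rewrite lee_fin gamma_fun_ge0.
Qed.

Let Gamma_lower a (c M : R) : 0 < a -> 0 < M -> 0 <= c ->
  (forall t, M <= t <= M + 1 -> c <= gamma_fun a t) -> c <= Gamma a.
Proof.
move=> a0 M0 c0 h; rewrite -lee_fin EFin_Gamma//.
have sub : `[M, M + 1] `<=` (`]0, +oo[%classic : set R).
  by move=> t /=; rewrite !in_itv/= andbT => /andP[+ _]; exact: lt_le_trans.
apply: (@le_trans _ _ (\int[leb]_(t in `[M, (M + 1)%R]) (gamma_fun a t)%:E)%E).
  have -> : c%:E = (\int[leb]_(t in `[M, (M + 1)%R]) c%:E)%E.
    rewrite integral_cst//= lebesgue_measure_itv/= lte_fin ltrDl ltr01.
    by rewrite -EFinB addrAC subrr add0r mule1.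
  apply: ge0_le_integral => //.
    by apply/measurable_EFinP; exact: measurable_gamma_fun.
apply: ge0_subset_integral => //.
  by apply/measurable_EFinP; exact: measurable_gamma_fun.
by move=> x _; rewrite lee_fin gamma_fun_ge0.
Qed.

(** Only the part of the integral over [[M, M + 1]] is kept. As [M] is free, this makes [Gamma] grow
    faster than any geometric sequence, which takes the place of Stirling's formula for the
    Mittag-Leffler series. *)
Lemma Gamma_ge a (M : R) : 0 < a -> 1 <= M ->
  M `^ (a - 1) / 2 * expR (- (M + 1)) <= Gamma a.
Proof.
move=> a0 M1; have M0 : 0 < M := lt_le_trans ltr01 M1.
apply: (@Gamma_lower _ _ M) => //.
  by rewrite mulr_ge0 ?divr_ge0 ?powR_ge0 ?expR_ge0.
move=> t /andP[Mt tM]; rewrite ler_pM ?divr_ge0 ?powR_ge0 ?expR_ge0//; last first.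
  by rewrite ler_expR lerN2.
(* For [a < 1] the power is decreasing, and [t <= M + 1 <= 2 M] costs at most a factor 2: this is
   the [1 / 2] of the bound. *)
have t0 := lt_le_trans M0 Mt; have [a1|a1] := leP 1 a.
  apply: (@le_trans _ _ (M `^ (a - 1))).
    by rewrite ler_pdivrMr// ler_peMr ?powR_ge0// ler1n.
  by rewrite ge0_ler_powR ?subr_ge0// nnegrE ltW.
have a1' : 0 <= 1 - a by rewrite subr_ge0 ltW.
rewrite -[leLHS]invrK -[leRHS]invrK lef_pV2 ?posrE ?invr_gt0 ?divr_gt0 ?powR_gt0//.
rewrite invf_div -!powRN opprB.
apply: (@le_trans _ _ ((2 * M) `^ (1 - a))).
  by rewrite ge0_ler_powR ?nnegrE ?mulr_ge0 ?(ltW t0) ?(ltW M0)//; lra.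
rewrite powRM ?(ltW M0)//.
rewrite ler_wpM2r ?powR_ge0// -[leRHS]powRr1// ler_powR ?ler1n//; lra.
Qed.

Lemma Gamma_gt0 a : 0 < a -> 0 < Gamma a.
Proof.
move=> a0; apply: lt_le_trans (Gamma_ge a0 (lexx 1)).
by rewrite !mulr_gt0 ?expR_gt0 ?powR_gt0 ?invr_gt0.
Qed.

End Gamma_facts.

(** * Laplace transforms and convolution of powers *)

Section Laplace.
Context {R : realType}.
Notation leb := (@lebesgue_measure R).
Implicit Types (a b t z : R) (g h : R -> \bar R).

Lemma ge0_lebesgueZl (c : \bar R) g : measurable_fun setT g -> (forall t, 0 <= g t)%E ->
  (0 <= c)%E -> (\int[leb]_t (c * g t) = c * \int[leb]_t g t)%E.
Proof. by move=> mg g0 c0; rewrite ge0_integralZl. Qed.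

(** The integral runs over the whole line because the functions concerned vanish left of the origin;
    extended values let Tonelli's theorem apply before finiteness is known. *)
Definition laplace z g : \bar R := (\int[leb]_t ((expR (- (z * t)))%:E * g t))%E.

Definition convol g h t : \bar R := (\int[leb]_s (g (t - s)%R * h s))%E.

Lemma measurable_expRN z : measurable_fun setT (fun t : R => (expR (- (z * t)))%:E).
Proof.
apply/measurable_EFinP; apply: measurableT_comp => //.
by apply: measurableT_comp => //; apply: measurable_funM.
Qed.

(** Tonelli's theorem, then the translation [t = u + s], under which [exp (- z t)] factors. *)
Lemma laplace_convol z g h : (forall t, 0 <= g t)%E -> (forall t, 0 <= h t)%E ->
  measurable_fun setT g -> measurable_fun setT h ->
  laplace z (convol g h) = (laplace z g * laplace z h)%E.
Proof.
move=> g0 h0 mg mh.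
pose f (p : measurableTypeR R * measurableTypeR R) : \bar R :=
  ((expR (- (z * p.1)))%:E * (g (p.1 - p.2)%R * h p.2))%E.
have mgd : measurable_fun setT
    (fun p : measurableTypeR R * measurableTypeR R => g (p.1 - p.2)%R).
  by apply: measurableT_comp => //; apply: measurable_funB.
have mf : measurable_fun setT f.
  apply: emeasurable_funM.
    exact: (measurableT_comp (measurable_expRN z) measurable_fst).
  apply: emeasurable_funM => //.
  exact: (measurableT_comp mh measurable_snd).
have f0 p : (0 <= f p)%E by rewrite mule_ge0 ?lee_fin ?expR_ge0// mule_ge0.
have shift_meas t : measurable_fun setT (fun s : R => g (t - s)%R).
  by apply: measurableT_comp => //; apply: measurable_funB.
transitivity (\int[leb]_t \int[leb]_s f (t, s))%E.
  apply: eq_integral => t _; rewrite /f/= -ge0_integralZl//.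
    by apply: emeasurable_funM; [exact: shift_meas|exact: mh].
  by move=> s _; rewrite mule_ge0.
rewrite (fubini_tonelli f mf f0).
transitivity (\int[leb]_s (laplace z g * ((expR (- (z * s)))%:E * h s)))%E.
  apply: eq_integral => s _.
  have mG : measurable_fun setT (fun u : R => (expR (- (z * (u + s)%R)))%:E * g u)%E.
    apply: emeasurable_funM => //.
    apply: (measurableT_comp (measurable_expRN z)).
    exact: measurable_funD.
  have G0 u : (0 <= (expR (- (z * (u + s)%R)))%:E * g u)%E.
    by rewrite mule_ge0 ?lee_fin ?expR_ge0.
  have := @ge0_integral_affine _ 1 (- s) _ ltr01 mG G0.
  rewrite mul1e => e1.
  rewrite /f /=; clear f mgd mf f0.
  have mT : measurable_fun setT (fun t : R => (expR (- (z * (1 * t - s + s)%R)))%:E *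
      g (1 * t - s)%R)%E.
    apply: (measurableT_comp mG).
    by apply: measurable_funB => //; exact: measurable_funM.
  transitivity (\int[leb]_t (h s * ((expR (- (z * (1 * t - s + s)%R)))%:E *
      g (1 * t - s)%R)))%E.
    by apply: eq_integral => t _; rewrite /= mul1r subrK muleA muleC.
  rewrite (ge0_lebesgueZl mT (fun t => G0 _) (h0 s)) -e1; clear mT e1.
  transitivity (h s * \int[leb]_u ((expR (- (z * s)))%:E *
      ((expR (- (z * u)))%:E * g u)))%E.
    congr (_ * _)%E; apply: eq_integral => u _; rewrite muleA -EFinM -expRD.
    by congr (_%:E * _)%E; congr expR; ring.
  have mg' : measurable_fun setT (fun u : R => (expR (- (z * u)))%:E * g u)%E.
    by apply: emeasurable_funM; [exact: measurable_expRN|exact: mg].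
  have g0' u : (0 <= (expR (- (z * u)))%:E * g u)%E.
    by rewrite mule_ge0 ?lee_fin ?expR_ge0.
  have e0 : (0 <= (expR (- (z * s)))%:E)%E by rewrite lee_fin expR_ge0.
  by rewrite (ge0_lebesgueZl mg' g0' e0) /laplace muleC [in RHS]muleA
    (muleC _ (expR (- (z * s)))%:E).
have mh' : measurable_fun setT (fun u : R => (expR (- (z * u)))%:E * h u)%E.
  by apply: emeasurable_funM; [exact: measurable_expRN|exact: mh].
have h0' u : (0 <= (expR (- (z * u)))%:E * h u)%E.
  by rewrite mule_ge0 ?lee_fin ?expR_ge0.
have L0 : (0 <= laplace z g)%E.
  by apply: integral_ge0 => u _; rewrite mule_ge0 ?lee_fin ?expR_ge0.
by rewrite (ge0_lebesgueZl mh' h0' L0).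
Qed.

(** Up to the factor [1 / Gamma a], the kernel of the Riemann-Liouville fractional integral of order
    [a]. *)
Definition pospow a t : R := \1_(`]0, +oo[%classic : set R) t * t `^ (a - 1).

Lemma pospowE a t : 0 < t -> pospow a t = t `^ (a - 1).
Proof. by move=> t0; rewrite /pospow indicE mem_set ?mul1r//= in_itv/= t0. Qed.

Lemma le0_pospow a t : t <= 0 -> pospow a t = 0.
Proof.
move=> t0; rewrite /pospow indicE memNset ?mul0r//= in_itv/= andbT.
by apply/negP; rewrite -leNgt.
Qed.

Lemma pospow_ge0 a t : 0 <= pospow a t.
Proof. by rewrite mulr_ge0 ?powR_ge0. Qed.

Lemma measurable_pospow a : measurable_fun setT (pospow a).
Proof.
by apply: measurable_funM; [exact: measurable_indic|exact: measurable_powR].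
Qed.
Let measurable_EFin_pospow a : measurable_fun setT (EFin \o pospow a).
Proof. by apply/measurable_EFinP; exact: measurable_pospow. Qed.

Lemma pospowM a c t : 0 < c -> pospow a (c * t) = c `^ (a - 1) * pospow a t.
Proof.
move=> c0; have [t0|t0] := ltP 0 t.
  by rewrite !pospowE ?mulr_gt0// powRM ?ltW.
by rewrite !le0_pospow ?mulr0// pmulr_rle0.
Qed.

Lemma laplace_pospow a z : 0 < a -> 0 < z ->
  laplace z (EFin \o pospow a) = (Gamma a * z `^ (- a))%:E.
Proof.
move=> a0 z0.
have l1 : laplace 1 (EFin \o pospow a) = (Gamma a)%:E.
  rewrite EFin_Gamma// [RHS]integral_mkcond; apply: eq_integral => t _.
  rewrite patchE /= mul1r -EFinM; case: ifPn.
    by rewrite inE/= in_itv/= andbT => t0; rewrite pospowE// mulrC.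
  rewrite notin_setE/= in_itv/= andbT => /negP; rewrite -leNgt => t0.
  by rewrite le0_pospow// mulr0.
have m1 : measurable_fun setT
    (fun t : R => (expR (- (1 * t)))%:E * (pospow a t)%:E)%E.
  by apply: emeasurable_funM; [exact: measurable_expRN|exact: measurable_EFin_pospow].
have g1 t : (0 <= (expR (- (1 * t)))%:E * (pospow a t)%:E)%E.
  by rewrite mule_ge0 ?lee_fin ?expR_ge0 ?pospow_ge0.
have := @ge0_integral_affine _ z 0 _ z0 m1 g1.
rewrite -/(laplace 1 (EFin \o pospow a)) l1.
under eq_integral do rewrite addr0 mul1r pospowM// EFinM muleCA.
rewrite ge0_integralZl//; last 3 first.
- by apply: emeasurable_funM; [exact: measurable_expRN|exact: measurable_EFin_pospow].
- by move=> t _; rewrite mule_ge0 ?lee_fin ?expR_ge0 ?pospow_ge0.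
- by rewrite lee_fin powR_ge0.
rewrite -/(laplace z (EFin \o pospow a)) muleA -EFinM mulr_powRB1 ?ltW// => e.
by rewrite mulrC EFinM e muleA -EFinM powRN mulVf ?mul1e// gt_eqF// powR_gt0.
Qed.

(** The Beta integral without a two-dimensional change of variables: by homogeneity the convolution
    is [c t^(a + b - 1)], and comparing Laplace transforms at 1 yields
    [c Gamma (a + b) = Gamma a Gamma b]. *)
Lemma convol_pospow a b t : 0 < a -> 0 < b ->
  convol (EFin \o pospow a) (EFin \o pospow b) t =
  (Gamma a * Gamma b / Gamma (a + b) * pospow (a + b) t)%:E.
Proof.
move=> a0 b0; have ab0 : 0 < a + b by rewrite addr_gt0.
pose c := convol (EFin \o pospow a) (EFin \o pospow b) 1.
have pp0 (x y : R) : (0 <= (pospow a x)%:E * (pospow b y)%:E)%E.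
  by rewrite mule_ge0 ?lee_fin ?pospow_ge0.
have mc x : measurable_fun setT
    (fun s : R => (pospow a (x - s))%:E * (pospow b s)%:E)%E.
  apply/measurable_EFinP; apply: measurable_funM; last exact: measurable_pospow.
  apply: (measurableT_comp (measurable_pospow a)).
  exact: measurable_funB.
have scale x : convol (EFin \o pospow a) (EFin \o pospow b) x =
    (c * (pospow (a + b) x)%:E)%E.
  have [x0|x0] := ltP 0 x; last first.
    rewrite le0_pospow// mule0; apply: integral0_eq => s _ /=.
    have [s0|s0] := ltP 0 s; last by rewrite (le0_pospow b s0) mule0.
    by rewrite le0_pospow ?mul0e// subr_le0 (le_trans x0)// ltW.
  rewrite /convol (@ge0_integral_affine _ x 0 _ x0 (mc x) (fun s => pp0 _ _)).
  under eq_integral.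
    move=> s _; rewrite addr0 /= -{1}(mulr1 x) -mulrBr !pospowM// -EFinM.
    rewrite mulrACA EFinM EFinM.
    over.
  rewrite ge0_integralZl//; last 3 first.
  - exact: mc.
  - by move=> s _; exact: pp0.
  - by rewrite lee_fin mulr_ge0 ?powR_ge0.
  rewrite muleA -EFinM -/c muleC pospowE//; congr (_ * _%:E)%E.
  rewrite mulrA mulr_powRB1//; last exact: ltW.
  by rewrite -addrA [RHS]powRD// (gt_eqF x0) implybT.
have := @laplace_convol 1 (EFin \o pospow a) (EFin \o pospow b).
rewrite (laplace_pospow a0 ltr01) (laplace_pospow b0 ltr01) !powR1 !mulr1 => L.
have {L} : (c * (Gamma (a + b))%:E = (Gamma a * Gamma b)%:E)%E.
  rewrite EFinM -L//; last 2 first.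
  - by move=> s; rewrite lee_fin pospow_ge0.
  - by move=> s; rewrite lee_fin pospow_ge0.
  have := laplace_pospow ab0 ltr01; rewrite powR1 mulr1 => <-.
  have m' : measurable_fun setT (fun u : R => (expR (- (1 * u)))%:E * (pospow (a + b) u)%:E)%E.
    by apply: emeasurable_funM; [exact: measurable_expRN|exact: measurable_EFin_pospow].
  have p0' u : (0 <= (expR (- (1 * u)))%:E * (pospow (a + b) u)%:E)%E.
    by rewrite mule_ge0 ?lee_fin ?expR_ge0 ?pospow_ge0.
  have c0 : (0 <= c)%E by apply: integral_ge0 => s _; exact: pp0.
  rewrite /laplace -(ge0_lebesgueZl m' p0' c0).
  by apply: eq_integral => s _; rewrite scale muleCA.
have G0 := Gamma_gt0 ab0.
move=> cE; rewrite scale.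
suff -> : c = (Gamma a * Gamma b / Gamma (a + b))%:E by rewrite EFinM.
(* Finiteness of the Beta integral comes for free: an infinite [c] would contradict [cE], whose
   right side is finite. *)
have : c \is a fin_num.
  rewrite ge0_fin_numE; last by apply: integral_ge0 => s _; exact: pp0.
  rewrite ltNge leye_eq; apply/eqP => ce; move: cE.
  by rewrite ce gt0_mulye// lte_fin.
move=> /fineK cf; move: cE; rewrite -cf -EFinM => -[] <-.
by rewrite mulfK// gt_eqF.
Qed.

End Laplace.

(** * The Laplace transform of the Mittag-Leffler law *)

Section mittag_leffler_density.
Context {R : realType}.
Notation leb := (@lebesgue_measure R).
Variables (nu L : R).
Hypotheses (nu0 : 0 < nu) (L0 : 0 < L).
Implicit Types (t x X : R) (j n : nat).

Let idx j : R := nu * j%:R + nu.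
Let idx_gt0 j : 0 < idx j.
Proof. by rewrite ltr_wpDl// mulr_ge0// ltW. Qed.
Let Gamma_idx_gt0 j : 0 < Gamma (idx j).
Proof. exact: Gamma_gt0. Qed.

Let ml_coef_bound X : 0 <= X ->
  exists2 K : R, 0 <= K & forall j, X ^+ j / Gamma (idx j) <= K * 2^-1 ^+ j.
Proof.
(* [M] is chosen with [M^nu = 2 X + 1]: the bound of [Gamma_ge] at [nu j + nu] is then a constant
   times [(2 X + 1)^j], which beats [X^j] by the factor [2^j]. *)
move=> X0; pose M := (2 * X + 1) `^ nu^-1.
have M1 : 1 <= M.
  rewrite /M -[leLHS](powRr0 (2 * X + 1)) ler_powR ?invr_ge0 ?(ltW nu0)//.
  by rewrite lerDr mulr_ge0.
have M0 := lt_le_trans ltr01 M1.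
have MnuE : M `^ nu = 2 * X + 1.
  by rewrite -powRrM mulVf ?gt_eqF// powRr1// addr_ge0 ?mulr_ge0.
pose K := (M `^ (nu - 1) / 2 * expR (- (M + 1)))^-1.
have K0 : 0 < K.
  rewrite invr_gt0; apply: mulr_gt0; last exact: expR_gt0.
  by apply: divr_gt0 => //; exact: powR_gt0.
exists K; first exact: ltW.
move=> j; rewrite ler_pdivrMr//.
have /(ler_wpM2l (ltW K0)) := Gamma_ge (idx_gt0 j) M1.
have -> : idx j - 1 = nu * j%:R + (nu - 1) by rewrite /idx addrA.
rewrite powRD ?(gt_eqF M0) ?implybT// powRrM MnuE powR_mulrn ?addr_ge0 ?mulr_ge0//.
have -> : K * ((2 * X + 1) ^+ j * M `^ (nu - 1) / 2 * expR (- (M + 1))) = (2 * X + 1) ^+ j.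
  rewrite /K; field.
  by rewrite !gt_eqF//; [exact: powR_gt0|exact: expR_gt0].
move=> h; apply: (@le_trans _ _ (2^-1 ^+ j * (2 * X + 1) ^+ j)).
  by rewrite -exprMn lerXn2r ?nnegrE ?mulr_ge0 ?invr_ge0 ?addr_ge0 ?mulr_ge0//; lra.
by rewrite mulrAC [leRHS]mulrC ler_wpM2l ?exprn_ge0 ?invr_ge0// mulrC.
Qed.

Let mlp n x := \sum_(0 <= j < n) x ^+ j / Gamma (idx j).

Let geo_half n : \sum_(0 <= j < n) (2^-1 : R) ^+ j <= 2.
Proof.
elim: n => [|n IH]; first by rewrite big_nil.
rewrite big_nat_recl//= expr0.
have -> : \sum_(0 <= i < n) (2^-1 : R) ^+ i.+1 = 2^-1 * \sum_(0 <= i < n) 2^-1 ^+ i.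
  by rewrite big_distrr/=; apply: eq_bigr => i _; rewrite exprS.
by lra.
Qed.

Let mlp_bound X : 0 <= X ->
  exists2 K : R, 0 <= K & forall n x, `|x| <= X -> `|mlp n x| <= K.
Proof.
move=> X0; have [K K0 hK] := ml_coef_bound X0; exists (K * 2); first by rewrite mulr_ge0.
move=> n x xX; apply: le_trans (ler_norm_sum _ _ _) _.
apply: le_trans (ler_wpM2l K0 (geo_half n)).
rewrite big_distrr/=; apply: ler_sum => j _.
rewrite normrM normfV normrX (gtr0_norm (Gamma_idx_gt0 j)).
apply: le_trans (hK j); rewrite ler_wpM2r ?invr_ge0 ?(ltW (Gamma_idx_gt0 j))//.
by rewrite lerXn2r ?nnegrE.
Qed.

Let cvg_mlp x : mlp n x @[n --> \oo] --> mittag_leffler nu nu x.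
Proof.
suff : cvgn (mlp ^~ x) by [].
have [K K0 hK] := ml_coef_bound (normr_ge0 x).
suff : cvgn (series (fun j => x ^+ j / Gamma (idx j))) by [].
apply: normed_cvg.
apply: (@series_le_cvg _ _ (fun j => K * 2^-1 ^+ j)) => //.
- by move=> j /=.
- by move=> j /=; rewrite mulr_ge0 ?exprn_ge0 ?invr_ge0.
- by move=> j /=; rewrite normrM normfV normrX (gtr0_norm (Gamma_idx_gt0 j)).
- have := @is_cvg_geometric_series R K 2^-1; apply.
  by rewrite gtr0_norm ?invr_gt0// invf_lt1// ltr1n.
Qed.

(** The inter-birth density of rate [L], extended by 0 to the whole line through [pospow] so that it
    can be convolved. *)
Definition ml_density t : R :=
  L * pospow nu t * mittag_leffler nu nu (- (L * t `^ nu)).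

Let mld n t := L * pospow nu t * mlp n (- (L * t `^ nu)).

Let cvg_mld t : mld n t @[n --> \oo] --> ml_density t.
Proof. by apply: cvgM; [exact: cvg_cst|exact: cvg_mlp]. Qed.

Let measurable_mld n : measurable_fun setT (mld n).
Proof.
apply: measurable_funM.
  by apply: measurable_funM => //; exact: measurable_pospow.
apply: measurable_sum => j; apply: measurable_funM => //.
apply: measurable_funX; apply: measurableT_comp => //.
by apply: measurable_funM => //; exact: measurable_powR.
Qed.

Lemma measurable_ml_density : measurable_fun setT ml_density.
Proof.
apply: (measurable_fun_cvg measurable_mld) => t _; exact: cvg_mld.
Qed.

Let coef j : R := L * (- L) ^+ j / Gamma (idx j).

Let mldE n t : mld n t = \sum_(0 <= j < n) coef j * pospow (idx j) t.
Proof.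
rewrite /mld /mlp big_distrr/=; apply: eq_bigr => j _.
have [t0|t0] := ltP 0 t; last by rewrite !le0_pospow ?mulr0 ?mul0r.
rewrite !pospowE// /coef -mulNr exprMn.
have -> : idx j - 1 = nu * j%:R + (nu - 1) by rewrite /idx addrA.
rewrite [t `^ (nu * j%:R + _)]powRD ?(gt_eqF t0) ?implybT// powRrM powR_mulrn ?powR_ge0//.
by rewrite !mulrA; ring.
Qed.

Let integrable_pp a b t : 0 < a -> 0 < b ->
  leb.-integrable setT (fun s => (pospow a (t - s) * pospow b s)%:E).
Proof.
move=> a0 b0; apply/integrableP; split.
  apply/measurable_EFinP; apply: measurable_funM; last exact: measurable_pospow.
  apply: (measurableT_comp (measurable_pospow a)); exact: measurable_funB.
have -> : (\int[leb]_s `|(pospow a (t - s) * pospow b s)%:E| =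
    convol (EFin \o pospow a) (EFin \o pospow b) t)%E.
  apply: eq_integral => s _; rewrite abse_EFin ger0_norm// mulr_ge0//; exact: pospow_ge0.
by rewrite convol_pospow// ltry.
Qed.

Let idxS j : nu + idx j = idx j.+1.
Proof. by rewrite /idx -natr1; ring. Qed.

(** Fractional integration raises the exponent [idx j] to [idx j.+1], and the alternating
    coefficients turn this shift into a change of sign: the partial sum of length [n] becomes the
    first term minus the partial sum of length [n.+1]. *)
Let integral_mld n t :
  (\int[leb]_s (pospow nu (t - s) * mld n s)%:E =
   (Gamma nu / L * (L * pospow nu t / Gamma nu - mld n.+1 t))%:E)%E.
Proof.
transitivity (\int[leb]_s (\sum_(0 <= j < n)
    ((coef j)%:E * (pospow nu (t - s) * pospow (idx j) s)%:E)))%E.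
  apply: eq_integral => s _; rewrite mldE big_distrr /= -sumEFin.
  by apply: eq_bigr => j _; rewrite -EFinM mulrCA.
rewrite integral_sum//; last first.
  by move=> j; apply: integrableZl => //; exact: integrable_pp.
transitivity (\sum_(0 <= j < n) (coef j * (Gamma nu * Gamma (idx j) / Gamma (idx j.+1)
    * pospow (idx j.+1) t))%:E)%E.
  apply: eq_bigr => j _; rewrite integralZl//; last exact: integrable_pp.
  by rewrite [RHS]EFinM -idxS -(convol_pospow t nu0 (idx_gt0 j)).
rewrite sumEFin mldE; congr (_%:E).
rewrite [in RHS]big_nat_recl// /coef expr0 mulr1.
have -> : idx 0%N = nu by rewrite /idx mulr0 add0r.
have G0 := Gamma_gt0 nu0.
rewrite [L * pospow nu t / _]mulrAC opprD addrA subrr add0r mulrN -mulNr big_distrr/=.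
apply: eq_bigr => j _; rewrite exprS.
move: (Gamma_idx_gt0 j) (Gamma_idx_gt0 j.+1) G0 L0.
move: (Gamma (idx j)) (Gamma (idx j.+1)) (Gamma nu) (pospow _ _) => a b c p.
move: ((- L) ^+ j) => q a0 b0 c0 l0; field.
by rewrite !gt_eqF.
Qed.

Lemma ml_density_volterra t :
  (\int[leb]_s (pospow nu (t - s) * ml_density s)%:E =
   (pospow nu t - Gamma nu / L * ml_density t)%:E)%E /\
  leb.-integrable setT (fun s => (pospow nu (t - s) * ml_density s)%:E).
Proof.
(* Only [0 < s < t] contributes, so the partial sums are evaluated at arguments of size at most
   [L |t|^nu], and one bound [K] dominates them all. *)
have [K K0 hK] := @mlp_bound (L * `|t| `^ nu) (mulr_ge0 (ltW L0) (powR_ge0 _ _)).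
have bnd n s : `|pospow nu (t - s) * mld n s| <=
    L * K * (pospow nu (t - s) * pospow nu s).
  have [s0|s0] := ltP 0 s; last first.
    by rewrite /mld (le0_pospow _ s0) !(mulr0, mul0r) normr0.
  have [ts|ts] := ltP 0 (t - s); last first.
    by rewrite (le0_pospow _ ts) !(mulr0, mul0r) normr0.
  rewrite /mld normrM (ger0_norm (pospow_ge0 _ _)).
  rewrite normrM (ger0_norm (mulr_ge0 (ltW L0) (pospow_ge0 _ _))).
  rewrite [leRHS](_ : _ = pospow nu (t - s) * (L * pospow nu s * K)); last by ring.
  have Lp : 0 <= L * pospow nu s := mulr_ge0 (ltW L0) (pospow_ge0 _ _).
  apply: (ler_wpM2l (pospow_ge0 _ _)); apply: (ler_wpM2l Lp).
  apply: (hK n); rewrite normrN ger0_norm ?mulr_ge0 ?powR_ge0 ?(ltW L0)//.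
  rewrite ler_wpM2l ?(ltW L0)// ge0_ler_powR ?nnegrE ?(ltW nu0) ?(ltW s0)//.
  by rewrite (le_trans _ (ler_norm _))// -subr_ge0 ltW.
have mshift : measurable_fun setT (fun s : R => pospow nu (t - s)).
  by apply: (measurableT_comp (measurable_pospow nu)); exact: measurable_funB.
have ig : leb.-integrable setT
    (fun s => (L * K * (pospow nu (t - s) * pospow nu s))%:E).
  by under eq_fun do rewrite EFinM; apply: integrableZl => //; exact: integrable_pp.
have mf n : measurable_fun setT (fun s : R => (pospow nu (t - s) * mld n s)%:E).
  by apply/measurable_EFinP; apply: measurable_funM => //; exact: measurable_mld.
have mF : measurable_fun setT (fun s : R => (pospow nu (t - s) * ml_density s)%:E).
  apply/measurable_EFinP; apply: measurable_funM => //; exact: measurable_ml_density.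
have cv s : (pospow nu (t - s) * mld n s)%:E @[n --> \oo] -->
    (pospow nu (t - s) * ml_density s)%:E.
  apply: cvg_EFin; first exact: nearW.
  by apply: cvgM; [exact: cvg_cst|exact: cvg_mld].
have [||iF _ ] := @dominated_convergence _ (measurableTypeR R) R leb setT
  measurableT _ _ _ mf mF _ ig _.
- by apply: aeW => s _; exact: cv.
- by apply: aeW => s n _; rewrite lee_fin; exact: bnd.
rewrite (_ : [sequence _]_n = fun n =>
  (Gamma nu / L * (L * pospow nu t / Gamma nu - mld n.+1 t))%:E); last first.
  by apply/funext => n /=; rewrite integral_mld.
move=> cI; split => //.
rewrite -(cvg_lim _ cI)//; apply/cvg_lim => //; apply: cvg_EFin; first exact: nearW.
have -> : pospow nu t - Gamma nu / L * ml_density t =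
    Gamma nu / L * (L * pospow nu t / Gamma nu - ml_density t).
  by field; rewrite !gt_eqF// Gamma_gt0.
apply: cvgM; first exact: cvg_cst.
apply: cvgB; first exact: cvg_cst.
by have := @cvg_mld t; rewrite -cvg_shiftS.
Qed.

End mittag_leffler_density.

Section mittag_leffler_law.
Context {R : realType}.
Notation leb := (@lebesgue_measure R).
Context d (T : measurableType d) (P : probability T R).
Variables (nu L : R) (X : {RV P >-> R}).
Hypotheses (nu0 : 0 < nu) (L0 : 0 < L).
Hypothesis lawX : forall B : set R, measurable B ->
  distribution P X B = (\int[leb]_(t in B) (ml_density nu L t)%:E)%E.

Let f := ml_density nu L.
Let fp t : R := Num.max 0 (f t).
Let fn t : R := Num.max 0 (- f t).

Let f_fpn t : f t = fp t - fn t.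
Proof. by rewrite /fp /fn; case: (ltP 0 (f t)); case: (ltP 0 (- f t)); lra. Qed.

Let fp0 t : 0 <= fp t. Proof. by rewrite le_max lexx. Qed.
Let fn0 t : 0 <= fn t. Proof. by rewrite le_max lexx. Qed.

Let mf : measurable_fun setT f. Proof. exact: measurable_ml_density. Qed.
Let mfp : measurable_fun setT fp.
Proof. by apply: measurable_maxr. Qed.
Let mfn : measurable_fun setT fn.
Proof. by apply: measurable_maxr => //; exact: measurableT_comp. Qed.

(** The event [f (X) < 0] has a probability equal to minus the integral of [fn]; being nonnegative,
    it forces this integral to be 0. *)
Let int_fn : (\int[leb]_t (fn t)%:E = 0)%E.
Proof.
pose B := f @^-1` `]-oo, 0[.
have mB : measurable B by rewrite -[B]setTI; apply: mf.
have eB : (\int[leb]_(t in B) (fn t)%:E = \int[leb]_t (fn t)%:E)%E.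
  rewrite [LHS]integral_mkcond; apply: eq_integral => t _.
  rewrite patchE; case: ifPn => //; rewrite notin_setE /B/= in_itv/= => /negP.
  by rewrite -leNgt => ft; rewrite /fn max_l// oppr_le0.
have h : distribution P X B = (- \int[leb]_t (fn t)%:E)%E.
  rewrite lawX// -eB -integral_ge0N; last by move=> t _; rewrite lee_fin.
  apply: eq_integral => t; rewrite inE/= /B/= in_itv/= => ft.
  by rewrite /fn max_r ?opprK// oppr_ge0 ltW.
have I0 : (0 <= \int[leb]_t (fn t)%:E)%E by apply: integral_ge0 => t _; rewrite lee_fin.
apply/eqP; rewrite eq_le I0 andbT -oppe_ge0 -h.
exact: measure_ge0.
Qed.

Let int_fn_sub (A : set R) : measurable A -> (\int[leb]_(t in A) (fn t)%:E = 0)%E.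
Proof.
move=> mA; apply/eqP; rewrite eq_le; apply/andP; split; last first.
  by apply: integral_ge0 => t _; rewrite lee_fin.
rewrite -int_fn; apply: ge0_subset_integral => //.
  exact/measurable_EFinP.
by move=> t _; rewrite lee_fin.
Qed.

(** [fn] is a density of the zero measure. *)
Let int_fn_mul (g : R -> \bar R) : measurable_fun setT g -> (forall t, 0 <= g t)%E ->
  (\int[leb]_t (g t * (fn t)%:E) = 0)%E.
Proof.
move=> mg g0; rewrite -(@ge0_integral_density _ _ _ leb mzero)//.
  exact: integral_measure_zero.
by move=> A mA; rewrite int_fn_sub.
Qed.

Let lawX_fp (B : set R) : measurable B ->
  distribution P X B = (\int[leb]_(t in B) (fp t)%:E)%E.
Proof.
move=> mB; rewrite lawX// integralE.
have -> : (\int[leb]_(t in B) (fun t => (ml_density nu L t)%:E)^\- t =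
    \int[leb]_(t in B) (fn t)%:E)%E.
  by apply: eq_integral => t _; rewrite funenegE -EFin_max maxC.
rewrite int_fn_sub// sube0; apply: eq_integral => t _.
by rewrite funeposE -EFin_max maxC.
Qed.

Lemma integral_ml_law (g : R -> \bar R) : measurable_fun setT g ->
  (forall t, 0 <= g t)%E ->
  (\int[P]_w g (X w) = \int[leb]_t (g t * (fp t)%:E))%E.
Proof.
move=> mg g0.
have mX0 : measurable_fun setT (X : T -> R) by exact: measurable_funPT.
have mX : measurable_fun setT (X : T -> measurableTypeR R).
  by move=> _ B mB; exact: mX0.
pose m2 := measure_function_pushforward__canonical__measure_function_Measure P mX.
rewrite -(@ge0_integral_density _ _ R leb m2 fp fp0 mfp lawX_fp g mg g0).
by rewrite ge0_integral_pushforward.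
Qed.

(** With [c = Gamma nu / L], the Volterra equation says that the convolution of [pospow nu] with
    [fp] is [pospow nu - c f]. Its Laplace transform is a linear equation for the transform of
    [fp]. *)
Lemma laplace_ml_law z : 0 < z ->
  (\int[P]_w (expR (- (z * X w)))%:E = (L / (L + z `^ nu))%:E)%E.
Proof.
move=> z0.
rewrite (integral_ml_law (g := fun t => (expR (- (z * t)))%:E)); last 2 first.
- exact: measurable_expRN.
- by move=> t; rewrite lee_fin expR_ge0.
rewrite -/(laplace z (EFin \o fp)).
have mEfp : measurable_fun setT (EFin \o fp) by exact/measurable_EFinP.
have mEfn : measurable_fun setT (EFin \o fn) by exact/measurable_EFinP.
have mpp : measurable_fun setT (EFin \o pospow nu : R -> \bar R).
  by apply/measurable_EFinP; exact: measurable_pospow.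
have G0 := Gamma_gt0 nu0.
pose c := Gamma nu / L.
have c0 : 0 < c by rewrite divr_gt0.
have mshift t : measurable_fun setT (fun s : R => pospow nu (t - s)).
  by apply: (measurableT_comp (measurable_pospow nu)); exact: measurable_funB.
have conv_fp t : convol (EFin \o pospow nu) (EFin \o fp) t =
    (pospow nu t - c * f t)%:E.
  have [e _] := ml_density_volterra nu0 L0 t; rewrite -e integralE.
  have ppM s (r : R) : Num.max (pospow nu (t - s) * r) 0 = pospow nu (t - s) * Num.max 0 r.
    by rewrite (maxr_pMr _ _ (pospow_ge0 _ _)) mulr0 maxC.
  rewrite [X in (_ - X)%E](_ : _ = 0%E) ?sube0.
    apply: eq_integral => s _; rewrite funeposE -EFin_max ppM.
    by rewrite -EFinM.
  rewrite -[RHS](@int_fn_mul (fun s => (pospow nu (t - s))%:E)).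
  - apply: eq_integral => s _; rewrite funenegE -EFinN -EFin_max -mulrN ppM.
    by rewrite -EFinM.
  - exact/measurable_EFinP.
  - by move=> s; rewrite lee_fin pospow_ge0.
have mconv : measurable_fun setT (fun t : R => (pospow nu t - c * f t)%:E).
  apply/measurable_EFinP; apply: measurable_funB; first exact: measurable_pospow.
  exact: measurable_funM.
have conv0 t : 0 <= pospow nu t - c * f t.
  rewrite -lee_fin -conv_fp; apply: integral_ge0 => s _.
  by rewrite -EFinM lee_fin mulr_ge0// pospow_ge0.
have lap0 (h : R -> R) : (forall t, 0 <= h t) -> forall t,
    (0 <= (expR (- (z * t)))%:E * (h t)%:E)%E.
  by move=> h0 t; rewrite -EFinM lee_fin mulr_ge0// expR_ge0.
have mlap (h : R -> R) : measurable_fun setT h ->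
    measurable_fun setT (fun t : R => (expR (- (z * t)))%:E * (h t)%:E)%E.
  move=> mh; apply: emeasurable_funM; first exact: measurable_expRN.
  exact/measurable_EFinP.
have lapD (h k : R -> R) : (forall t, 0 <= h t) -> (forall t, 0 <= k t) ->
    measurable_fun setT h -> measurable_fun setT k ->
    (laplace z (fun t => (h t + c * k t)%:E) =
     laplace z (EFin \o h) + c%:E * laplace z (EFin \o k))%E.
  move=> h0 k0 mh mk.
  have Zl := ge0_lebesgueZl (mlap _ mk) (lap0 _ k0) (ltW (_ : 0%:E < c%:E)%E).
  rewrite /laplace -Zl ?lte_fin// -ge0_integralD//.
  - by apply: eq_integral => t _ /=; rewrite -!EFinM -EFinD; congr _%:E; ring.
  - by move=> t _; exact: lap0.
  - by apply: mlap.
  - by move=> t _; rewrite mule_ge0 ?lee_fin ?(ltW c0)//; exact: lap0.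
  - by apply: measurable_funeM; exact: mlap.
(* The term in [fp] is moved to the left, so that only transforms of nonnegative functions occur;
   [c fn] remains on the right and contributes 0. *)
have l2 : (laplace z (convol (EFin \o pospow nu) (EFin \o fp)) +
    c%:E * laplace z (EFin \o fp) = laplace z (EFin \o pospow nu))%E.
  transitivity (laplace z (EFin \o (fun t => (pospow nu t - c * f t)%R)) +
      c%:E * laplace z (EFin \o fp))%E.
    by congr (laplace z _ + _)%E; apply/funext => t; rewrite conv_fp.
  rewrite -lapD//; last exact/measurable_EFinP.
  transitivity (laplace z (fun t => (pospow nu t + c * fn t)%:E)).
    apply: eq_integral => t _; congr (_ * _%:E)%E.
    by rewrite f_fpn; ring.
  rewrite lapD//.
  - rewrite [X in (_ + _ * X)%E](_ : _ = 0%E) ?mule0 ?adde0//.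
    apply: int_fn_mul; first exact: measurable_expRN.
    by move=> t; rewrite lee_fin expR_ge0.
  - exact: pospow_ge0.
  - exact: measurable_pospow.
move: l2; rewrite laplace_convol//; last first.
  by move=> t; rewrite lee_fin pospow_ge0.
rewrite laplace_pospow//.
have l0 : (0 <= laplace z (EFin \o fp))%E by apply: integral_ge0 => t _; exact: lap0.
have w0 : 0 < Gamma nu * z `^ (- nu) by rewrite mulr_gt0// powR_gt0.
(* An infinite transform would make the left side infinite while the right side is finite. *)
move: l0; case: (laplace z (EFin \o fp)) => [r _|_|//]; last first.
  by rewrite !gt0_muley ?lte_fin.
rewrite -!EFinM -EFinD => -[]; rewrite powRN /c => e; congr _%:E.
have zn0 : 0 < z `^ nu by rewrite powR_gt0.
have : (L + z `^ nu) * r = L.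
  have : Gamma nu / (L * z `^ nu) * ((L + z `^ nu) * r - L) = 0.
    rewrite [LHS](_ : _ = Gamma nu * (z `^ nu)^-1 * r + Gamma nu / L * r -
      Gamma nu * (z `^ nu)^-1); first by rewrite e subrr.
    by field; rewrite !gt_eqF.
  by move/eqP; rewrite mulf_eq0 gt_eqF ?divr_gt0 ?mulr_gt0//= subr_eq0 => /eqP.
move=> h; have n0 : L + z `^ nu != 0 by rewrite gt_eqF// addr_gt0.
by apply: (mulfI n0); rewrite h mulrCA mulfV ?mulr1.
Qed.

End mittag_leffler_law.

(** * Trigonometric inequalities and the Basel sum *)

Section trigonometric_inequalities.
Context {R : realType}.
Implicit Types (F f : R -> R) (x y : R).

(** The Taylor bounds below follow from repeated use of this, starting from [cos <= 1] or
    [sin <= 1], each bound being the sign of the derivative needed for the next. *)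
Lemma ge0_derive_le F f x : (forall y, is_derive y 1 F (f y)) ->
  (forall y, 0 <= y <= x -> 0 <= f y) -> 0 <= x -> F 0 <= F x.
Proof.
move=> dF f0 x0.
have [] := @MVT_segment _ F f _ _ x0 (fun y _ => dF y).
  apply: continuous_subspaceT => y; apply: differentiable_continuous.
  by apply/derivable1_diffP; have [] := dF y.
move=> c; rewrite in_itv/= => /f0 fc0 e.
by rewrite -subr_ge0 e subr0 mulr_ge0.
Qed.

Lemma sin_le x : 0 <= x -> sin x <= x.
Proof.
move=> x0; rewrite -subr_ge0.
have := @ge0_derive_le (fun y => y - sin y) (fun y => 1 - cos y) x _ _ x0.
rewrite sin0 subr0; apply.
by move=> y _; rewrite subr_ge0 cos_le1.
Qed.

Lemma onem_cos_le x : 0 <= x -> 1 - cos x <= x ^+ 2 / 2.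
Proof.
move=> x0; rewrite -subr_ge0.
have := @ge0_derive_le (fun y => 2^-1 * y ^+ 2 - (1 - cos y)) (fun y => y - sin y) x _ _ x0.
rewrite cos0 subrr expr0n mulr0 subrr mulrC; apply => [y|y /andP[y0 _]].
  by apply: is_derive_eq; rewrite /GRing.scale/=; field.
by rewrite subr_ge0 sin_le.
Qed.

Lemma subr_sin_le x : 0 <= x -> x - sin x <= x ^+ 3 / 6.
Proof.
move=> x0; rewrite -subr_ge0.
have := @ge0_derive_le (fun y => 6^-1 * y ^+ 3 - (y - sin y))
  (fun y => y ^+ 2 / 2 - (1 - cos y)) x _ _ x0.
rewrite sin0 subrr expr0n mulr0 subrr mulrC; apply => [y|y /andP[y0 _]].
  by apply: is_derive_eq; rewrite /GRing.scale/=; field.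
by rewrite subr_ge0 onem_cos_le.
Qed.

Lemma onem_cos_le_id x : 0 <= x -> 1 - cos x <= x.
Proof.
move=> x0; rewrite -subr_ge0.
have := @ge0_derive_le (fun y => y - (1 - cos y)) (fun y => 1 - sin y) x _ _ x0.
rewrite cos0 subrr subrr; apply.
  by move=> y; apply: is_derive_eq; rewrite /GRing.scale/=; ring.
by move=> y _; rewrite subr_ge0 sin_le1.
Qed.

Lemma subr_sin_le2 x : 0 <= x -> x - sin x <= x ^+ 2 / 2.
Proof.
move=> x0; rewrite -subr_ge0.
have := @ge0_derive_le (fun y => 2^-1 * y ^+ 2 - (y - sin y))
  (fun y => y - (1 - cos y)) x _ _ x0.
rewrite sin0 subrr expr0n mulr0 subrr mulrC; apply => [y|y /andP[y0 _]].
  by apply: is_derive_eq; rewrite /GRing.scale/=; field.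
by rewrite subr_ge0 onem_cos_le_id.
Qed.

Lemma cos_taylor_le x : 0 <= x -> x ^+ 2 / 2 - (1 - cos x) <= x ^+ 3 / 6.
Proof.
move=> x0; rewrite -subr_ge0.
have := @ge0_derive_le (fun y => 6^-1 * y ^+ 3 - (2^-1 * y ^+ 2 - (1 - cos y)))
  (fun y => y ^+ 2 / 2 - (y - sin y)) x _ _ x0.
rewrite cos0 !expr0n !mulr0 !subrr mulrC [2^-1 * _]mulrC; apply => [y|y /andP[y0 _]].
  by apply: is_derive_eq; rewrite /GRing.scale/=; field.
by rewrite subr_ge0 subr_sin_le2.
Qed.

Lemma norm_sin_taylor x : `|sin x - x| <= `|x| ^+ 3 / 6.
Proof.
wlog x0 : x / 0 <= x => [hw|].
  have [/hw//|x0] := leP 0 x.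
  have := hw (- x); rewrite oppr_ge0 (ltW x0) sinN opprK normrN => /(_ isT).
  by rewrite addrC distrC.
by rewrite distrC !ger0_norm ?subr_ge0 ?sin_le ?subr_sin_le.
Qed.

Lemma norm_cos_taylor x : `|cos x - (1 - x ^+ 2 / 2)| <= `|x| ^+ 3 / 6.
Proof.
wlog x0 : x / 0 <= x => [hw|].
  have [/hw//|x0] := leP 0 x.
  by have := hw (- x); rewrite oppr_ge0 (ltW x0) cosN sqrrN normrN; exact.
have := onem_cos_le x0; have := cos_taylor_le x0.
move=> h1 h2; rewrite (ger0_norm x0) ger0_norm; lra.
Qed.

Lemma mul_cos_le_sin x : 0 <= x <= pi / 2 -> x * cos x <= sin x.
Proof.
move=> /andP[x0 xpi]; rewrite -subr_ge0.
have := @ge0_derive_le (fun y => sin y - y * cos y) (fun y => y * sin y) x _ _ x0.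
rewrite sin0 mul0r subrr; apply.
  by move=> y; apply: is_derive_eq; rewrite /GRing.scale/=; ring.
move=> y /andP[y0 yx]; rewrite mulr_ge0// sin_ge0_pi// y0 (le_trans yx)// (le_trans xpi)//.
by rewrite ler_pdivrMr// ler_peMr ?pi_ge0// ler1n.
Qed.

(** These are [sin x <= x] and [x cos x <= sin x]; the latter says [cot^2 x <= x^-2], and
    [sin^-2 = 1 + cot^2]. *)
Lemma inv_sqr_sin_bounds x : 0 < x < pi / 2 ->
  x ^- 2 <= (sin x) ^- 2 <= x ^- 2 + 1.
Proof.
move=> /andP[x0 xpi].
have s0 : 0 < sin x by apply: sin_gt0_pihalf; rewrite x0.
apply/andP; split.
  by rewrite lef_pV2 ?posrE ?exprn_gt0// lerXn2r ?nnegrE ?sin_le ?ltW.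
have h : (x * cos x) ^+ 2 <= sin x ^+ 2.
  rewrite lerXn2r ?nnegrE ?(ltW s0)//; last by apply: mul_cos_le_sin; rewrite !ltW.
  rewrite mulr_ge0 ?(ltW x0)// ltW// cos_gt0_pihalf// xpi andbT.
  by rewrite (lt_trans _ x0)// oppr_lt0 divr_gt0// pi_gt0.
have -> : x ^- 2 + 1 = (1 + x ^+ 2) / x ^+ 2 by field; rewrite gt_eqF.
rewrite ler_pdivlMr ?exprn_gt0// mulrC ler_pdivrMr ?exprn_gt0//.
have e : x ^+ 2 = (x * cos x) ^+ 2 + x ^+ 2 * sin x ^+ 2.
  by rewrite exprMn -mulrDr cos2Dsin2 mulr1.
by rewrite [leLHS]e mulrDl mul1r lerD2r.
Qed.

(* Induction on [n] through [1 / sin(2 t)^2 = (1 / sin(t)^2 + 1 / cos(t)^2) / 4]. *)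
Lemma sum_inv_sqr_sin n :
  \sum_(0 <= k < 2 ^ n) (sin ((2 * k + 1)%:R * (pi / (2 ^ n.+2)%:R))) ^- 2 =
  2 * 4 ^+ n :> R.
Proof.
elim: n => [|n IH].
  rewrite expn0 big_nat1 muln0 add0n mul1r expr0 mulr1.
  have : cos (pi / 4 *+ 2) = 0 :> R.
    by rewrite (_ : _ *+ 2 = pi / 2) ?cos_pihalf// -mulr_natr; field.
  rewrite cos_mulr2n => /eqP; rewrite subr_eq0 => /eqP h.
  have -> : sin (pi / 4) ^+ 2 = 2^-1 :> R.
    have := cos2Dsin2 (pi / 4 : R); rewrite -mulr_natr in h *; lra.
  by rewrite invrK.
have P0 : (2 ^ n.+3)%:R != 0 :> R by rewrite pnatr_eq0 expn_eq0.
rewrite expnS mul2n -addnn (big_cat_nat (n := 2 ^ n))//= ?leq_addr//.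
(* Reversing the upper half of the range replaces the angle [t] by [pi / 2 - t], hence sine by
   cosine. *)
have -> : \sum_(2 ^ n <= k < 2 ^ n + 2 ^ n)
    (sin ((2 * k + 1)%:R * (pi / (2 ^ n.+3)%:R))) ^- 2 =
    \sum_(0 <= k < 2 ^ n) (cos ((2 * k + 1)%:R * (pi / (2 ^ n.+3)%:R))) ^- 2 :> R.
  rewrite big_nat_rev/= -{1}[(2 ^ n)%N]add0n big_addn addnK big_nat [RHS]big_nat.
  apply: eq_bigr => k /andP[_ kn]; congr (_ ^- 2).
  rewrite -cosBpihalf -cosN opprB; congr cos.
  have e : (2 * (2 ^ n + (2 ^ n + 2 ^ n) - (k + 2 ^ n).+1) + 1 + (2 * k + 1) = 2 ^ n.+2)%N.
    by rewrite !expnS; lia.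
  have -> : pi / 2 = (2 ^ n.+2)%:R * (pi / (2 ^ n.+3)%:R) :> R.
    rewrite (expnS 2 n.+2) natrM; field.
    by rewrite pnatr_eq0 expn_eq0.
  by rewrite -e natrD mulrDl addrAC subrr add0r.
rewrite -big_split/= exprS mulrCA -IH mulr_sumr; apply: eq_big_nat => k /andP[_ kn].
set t := (2 * k + 1)%:R * (pi / (2 ^ n.+3)%:R).
have -> : (2 * k + 1)%:R * (pi / (2 ^ n.+2)%:R) = t *+ 2 :> R.
  rewrite /t -mulr_natr [in RHS]expnS natrM; field.
  by rewrite pnatr_eq0 expn_eq0.
have t0 : 0 < t < pi / 2.
  rewrite /t mulrA mulr_gt0 ?pi_gt0 ?divr_gt0 ?ltr0n ?expn_gt0//=; last first.
    by rewrite mulr_gt0 ?pi_gt0// ltr0n addn1.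
  rewrite ltr_pdivrMr ?ltr0n ?expn_gt0// mulrC -mulrA ltr_pM2l ?pi_gt0//.
  rewrite ltr_pdivlMl// -natrM ltr_nat !expnS; lia.
have s0 : sin t != 0 by rewrite gt_eqF// sin_gt0_pihalf.
have c0 : cos t != 0.
  rewrite gt_eqF// cos_gt0_pihalf//; case/andP: t0 => t0 ->.
  by rewrite andbT (lt_trans _ t0)// oppr_lt0 divr_gt0// pi_gt0.
rewrite sin_mulr2n -mulr_natr -[LHS]mul1r -(cos2Dsin2 t); field.
by rewrite s0 c0.
Qed.

(** Replacing [sin^-2 t] by [t^-2] costs at most 1 per term, so [2^n] in total, against a sum of
    size [2 * 4^n]; after rescaling the error is of order [2^-n]. *)
Lemma sum_inv_odd_sqr_bounds n :
  (pi : R) ^+ 2 / 8 - (pi : R) ^+ 2 / 16 * 2 ^- n <=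
    \sum_(0 <= k < 2 ^ n) ((2 * k + 1)%:R ^- 2) <= (pi : R) ^+ 2 / 8.
Proof.
pose t k : R := (2 * k + 1)%:R * (pi / (2 ^ n.+2)%:R).
have P0 : 0 < (2 ^ n.+2)%:R :> R by rewrite ltr0n expn_gt0.
have t0 k : (k < 2 ^ n)%N -> 0 < t k < pi / 2.
  move=> kn; rewrite /t mulr_gt0 ?divr_gt0 ?pi_gt0 ?ltr0n ?addn1 ?expn_gt0//=.
  rewrite mulrA ltr_pdivrMr// mulrC -mulrA ltr_pM2l ?pi_gt0//.
  rewrite ltr_pdivlMl// -natrM ltr_nat !expnS; lia.
have e : \sum_(0 <= k < 2 ^ n) (t k) ^- 2 =
    16 * 4 ^+ n / pi ^+ 2 * \sum_(0 <= k < 2 ^ n) ((2 * k + 1)%:R ^- 2).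
  rewrite mulr_sumr; apply: eq_bigr => k _; rewrite /t.
  have <- : (2 ^ n.+2)%:R ^+ 2 = 16 * 4 ^+ n :> R.
    have -> : (4 : R) ^+ n = 2 ^+ n * 2 ^+ n by rewrite -exprMn -natrM.
    by rewrite natrX !exprS; ring.
  have k0 : (2 * k + 1)%:R != 0 :> R by rewrite pnatr_eq0 addn1.
  have pi0 : pi != 0 :> R by rewrite gt_eqF// pi_gt0.
  move: k0 pi0 (lt0r_neq0 P0); move: ((2 * k + 1)%:R) (pi : R) ((2 ^ n.+2)%:R) => a b c.
  by move=> a0 b0 c0; field; rewrite a0 b0 c0.
have S := sum_inv_sqr_sin n.
have P4 : 0 < (4 : R) ^+ n by rewrite exprn_gt0.
have pp : 0 < pi ^+ 2 :> R by rewrite exprn_gt0// pi_gt0.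
have up : \sum_(0 <= k < 2 ^ n) (t k) ^- 2 <= 2 * 4 ^+ n.
  rewrite -S big_nat [leRHS]big_nat; apply: ler_sum => k /andP[_ /t0 /inv_sqr_sin_bounds].
  by case/andP.
have lo : 2 * 4 ^+ n <= \sum_(0 <= k < 2 ^ n) (t k) ^- 2 + 2 ^+ n.
  have -> : 2 ^+ n = \sum_(0 <= k < 2 ^ n) (1 : R).
    by rewrite big_const_nat iter_addr_0 subn0 natrX.
  rewrite -S -big_split/= big_nat [leRHS]big_nat.
  by apply: ler_sum => k /andP[_ /t0 /inv_sqr_sin_bounds /andP[]].
rewrite e in up lo; move: up lo; set O := \sum_(_ <= _ < _) _ => up lo.
have E : 16 * 4 ^+ n / pi ^+ 2 * O = 4 ^+ n * (16 / pi ^+ 2 * O) by ring.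
rewrite E in up lo.
have up' : 16 / pi ^+ 2 * O <= 2 by rewrite -(ler_pM2l P4) (mulrC (4 ^+ n) 2).
have lo' : 2 - 2 ^- n <= 16 / pi ^+ 2 * O.
  rewrite -(ler_pM2l P4) mulrBr lerBlDr (mulrC (4 ^+ n) 2).
  have -> // : 4 ^+ n / 2 ^+ n = 2 ^+ n :> R.
  have -> : (4 : R) = 2 * 2 by rewrite -natrM.
  by rewrite exprMn mulfK// gt_eqF.
have Oe : O = pi ^+ 2 / 16 * (16 / pi ^+ 2 * O).
  have gen (a b : R) : a != 0 -> b = a ^+ 2 / 16 * (16 / a ^+ 2 * b).
    by move=> a0; field.
  by apply: gen; rewrite lt0r_neq0// pi_gt0.
have p16 : 0 <= pi ^+ 2 / 16 :> R by rewrite divr_ge0 ?ltW.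
apply/andP; split; rewrite Oe.
  apply: le_trans (ler_wpM2l p16 lo'); rewrite mulrBr; lra.
by apply: le_trans (ler_wpM2l p16 up') _; lra.
Qed.

End trigonometric_inequalities.

(** * Logarithmic moments of the exponential law *)

Section log_moments.
Context {R : realType}.
Notation leb := (@lebesgue_measure R).
Notation itv0y := (`]0, +oo[%classic : set R).
Implicit Types (g : R -> R) (x : R) (n : nat).

Let dom x : R := x `^ (1 / 2) + x `^ (- (1 / 2)).

Let dom_ge1 x : 0 < x -> 1 <= dom x.
Proof.
move=> x0; have [x1|x1] := leP 1 x.
  by rewrite ler_wpDr ?powR_ge0// -[leLHS](powRr0 x) ler_powR.
by rewrite ler_wpDl ?powR_ge0// -[leLHS](powRr0 x) ger_powR ?x0 ?ltW// oppr_le0.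
Qed.

(** A growth class stable under the operations below that contains all powers of [ln]. The exponents
    [1 / 2] and [- 1 / 2] keep [g x exp (- x)] integrable at both ends and make boundary terms
    vanish. *)
Definition tame g := (forall x, 0 < x -> {for x, continuous g}) /\
  exists C : R, forall x, 0 < x -> `|g x| <= C * (x `^ (1 / 2) + x `^ (- (1 / 2))).

Lemma norm_ln_le a x : 0 < a -> 0 < x ->
  `|ln x| <= a^-1 * Num.max (x `^ a) (x `^ (- a)).
Proof.
move=> a0 x0; have h b : b * ln x <= x `^ b.
  rewrite -ln_powR; apply: ltW; apply: ln_sublinear; exact: powR_gt0.
rewrite ler_pdivlMl// le_max -(gtr0_norm a0) -normrM (gtr0_norm a0).
have [l0|l0] := leP 0 (a * ln x); first by rewrite ger0_norm// h.
by rewrite orbC ltr0_norm// -mulNr h.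
Qed.

Lemma tame_lnX k : tame (fun x => ln x ^+ k).
Proof.
split.
  move=> x x0; apply: (@continuous_comp _ _ _ (@ln R) (fun y => y ^+ k)).
    exact: continuous_ln.
  exact: exprn_continuous.
case: k => [|k].
  by exists 1 => x x0; rewrite expr0 normr1 mul1r; exact: dom_ge1.
(* With this exponent the power [k.+1] of [x^a] is [x^(1 / 2)]. *)
pose a : R := (2 * k.+1%:R)^-1; have a0 : 0 < a by rewrite invr_gt0.
exists (a^-1 ^+ k.+1) => x x0; rewrite normrX.
apply: (@le_trans _ _ ((a^-1 * Num.max (x `^ a) (x `^ (- a))) ^+ k.+1)).
  by rewrite lerXn2r ?nnegrE ?norm_ln_le// mulr_ge0 ?invr_ge0 ?(ltW a0)// le_max powR_ge0.
rewrite exprMn ler_wpM2l ?exprn_ge0 ?invr_ge0 ?(ltW a0)//.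
have aE : a * k.+1%:R = 1 / 2 by rewrite /a; field; rewrite nat1r pnatr_eq0.
have [h|h] := leP (x `^ a) (x `^ (- a)).
  by rewrite -powR_mulrn ?powR_ge0// -powRrM mulNr aE ler_wpDl ?powR_ge0.
by rewrite -powR_mulrn ?powR_ge0// -powRrM aE ler_wpDr ?powR_ge0.
Qed.

Lemma tame_cst c : tame (fun=> c : R).
Proof.
split=> [x x0|]; first exact: cst_continuous.
by exists `|c| => x x0; rewrite ler_peMr// dom_ge1.
Qed.

Lemma tameD g h : tame g -> tame h -> tame (fun x => g x + h x).
Proof.
move=> [cg [C gC]] [ch [D hD]]; split=> [x x0|].
  by apply: continuousD; [exact: cg|exact: ch].
exists (C + D) => x x0; rewrite mulrDl (le_trans (ler_normD _ _))//.
by rewrite lerD ?gC ?hD.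
Qed.

Lemma tameZ c g : tame g -> tame (fun x => c * g x).
Proof.
move=> [cg [C gC]]; split=> [x x0|].
  by apply: continuousM; [exact: cst_continuous|exact: cg].
exists (`|c| * C) => x x0; rewrite normrM -mulrA ler_wpM2l ?gC//.
Qed.

(** The unnormalised density of the Gamma law of shape [n.+1], of total mass [n!]. *)
Definition erlang n x : R := x ^+ n * expR (- x).

Let dom_erlang n x : 0 < x -> dom x * erlang n x =
  gamma_fun (n%:R + 3 / 2) x + gamma_fun (n%:R + 1 / 2) x.
Proof.
move=> x0; rewrite /dom /erlang /gamma_fun mulrDl.
have -> : n%:R + 3 / 2 - 1 = 1 / 2 + n%:R :> R by field.
have -> : n%:R + 1 / 2 - 1 = - (1 / 2) + n%:R :> R by field.
by rewrite !powRD ?(gt_eqF x0) ?implybT// powR_mulrn ?ltW// !mulrA.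
Qed.

Lemma continuous_erlang n x : {for x, continuous (erlang n)}.
Proof.
apply: continuousM; first exact: exprn_continuous.
apply: (@continuous_comp _ _ _ (-%R) expR).
  exact: (@continuousN _ R^o _ id).
exact: continuous_expR.
Qed.

Lemma integrable_tame n g : tame g ->
  leb.-integrable itv0y (fun x => (g x * erlang n x)%:E).
Proof.
move=> [cg [C gC]].
have i2 : leb.-integrable itv0y (fun x => (C%:E *
    ((gamma_fun (n%:R + 3 / 2) x)%:E + (gamma_fun (n%:R + 1 / 2) x)%:E))%E).
  apply: integrableZl => //; apply: integrableD => //;
  by apply: integrable_gamma_fun; rewrite ltr_wpDl.
apply: le_integrable i2 => //.
- apply/measurable_EFinP; apply: open_continuous_measurable_fun.
    exact: interval_open.
  move=> x; rewrite inE/= in_itv/= andbT => x0.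
  by apply: continuousM; [exact: cg|exact: continuous_erlang].
- move=> x /=; rewrite in_itv/= andbT => x0.
  rewrite lee_fin -dom_erlang//.
  have e0 : 0 <= erlang n x by rewrite mulr_ge0 ?expR_ge0 ?exprn_ge0 ?ltW.
  rewrite normrM (ger0_norm e0); apply: le_trans (ler_norm _).
  by rewrite [leRHS]mulrA; apply: ler_wpM2r => //; exact: gC.
Qed.

Definition erlang_int n g : R := \int[leb]_(x in itv0y) (g x * erlang n x).

Lemma erlang_intD n g h : tame g -> tame h ->
  erlang_int n (fun x => g x + h x) = erlang_int n g + erlang_int n h.
Proof.
move=> tg th; rewrite /erlang_int -RintegralD//; try exact: integrable_tame.
by apply: eq_Rintegral => x _; rewrite mulrDl.
Qed.

Lemma erlang_intZ n c g : tame g ->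
  erlang_int n (fun x => c * g x) = c * erlang_int n g.
Proof.
move=> tg; rewrite /erlang_int -RintegralZl//; last exact: integrable_tame.
by apply: eq_Rintegral => x _; rewrite mulrA.
Qed.

Lemma erlang_int_ge0 n g : (forall x, 0 <= g x) -> 0 <= erlang_int n g.
Proof.
move=> g0; apply: Rintegral_ge0 => x /=; rewrite in_itv/= andbT => x0.
by rewrite !mulr_ge0 ?expR_ge0// exprn_ge0// ltW.
Qed.

Let erlang_bound n : exists2 K : R, 0 <= K &
  forall x, 1 <= x -> x * erlang n x <= K.
Proof.
exists (n.+1%:R ^+ n.+1); first by rewrite exprn_ge0.
move=> x x1; have x0 : 0 < x := lt_le_trans ltr01 x1.
rewrite /erlang mulrA -exprS expRN ler_pdivrMr ?expR_gt0//.
apply: le_trans (onem_pow_le_expR n (ltW x0)).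
by rewrite lerXn2r ?nnegrE ?addr_ge0 ?ltW// ltrDr.
Qed.

(** Boundary terms of the integration by parts; the extra factor [x] in [erlang n.+1] absorbs
    [x^(- 1 / 2)] at the origin. *)
Let prim_cvg n g : tame g ->
  (g x * erlang n.+1 x) @[x --> +oo%R] --> 0 /\
  (g x * erlang n.+1 x) @[x --> 0^'+] --> 0.
Proof.
move=> [_ [C gC]]; have C0 : 0 <= C.
  have := gC 1 ltr01; rewrite !powR1 => h.
  have := le_trans (normr_ge0 _) h; lra.
have en0 x : 0 < x -> 0 <= erlang n.+1 x.
  by move=> x0; rewrite mulr_ge0 ?expR_ge0 ?exprn_ge0// ltW.
split.
- have [K K0 hK] := erlang_bound n.+2.
  apply: norm_cvg0.
  apply: (@squeeze_cvgr _ _ _ _ (fun=> 0) (fun x => 2 * C * K * x^-1)).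
  + near=> x.
    have x1 : 1 <= x by near: x; exact: nbhs_pinfty_ge.
    have x0 : 0 < x := lt_le_trans ltr01 x1.
    rewrite normr_ge0/= normrM (ger0_norm (en0 _ x0)) ler_pdivlMr//.
    apply: (@le_trans _ _ (2 * C * x * erlang n.+1 x * x)).
      rewrite ler_wpM2r ?(ltW x0)// ler_wpM2r ?en0//.
      apply: le_trans (gC _ x0) _; rewrite -mulrA mulrCA ler_wpM2l//.
      have : x `^ (1 / 2) <= x by rewrite -[leRHS]powRr1 ?(ltW x0)// ler_powR//; lra.
      have : x `^ (- (1 / 2)) <= x by rewrite -[leRHS]powRr1 ?(ltW x0)// ler_powR//; lra.
      lra.
    have -> : 2 * C * x * erlang n.+1 x * x = 2 * C * (x * erlang n.+2 x).
      by rewrite /erlang !exprS; ring.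
    by rewrite ler_wpM2l ?mulr_ge0// hK.
  + exact: cvg_cst.
  + rewrite -(mulr0 (2 * C * K)); apply: cvgM; first exact: cvg_cst.
    apply/gtr0_cvgV0; last exact: cvg_id.
    by near=> x; near: x; exact: nbhs_pinfty_gt.
- apply: norm_cvg0.
  apply: (@squeeze_cvgr _ _ _ _ (fun=> 0) (fun x => 2 * C * x `^ (1 / 2))).
  + near=> x.
    have x0 : 0 < x by near: x; exact: nbhs_right_gt.
    have x1 : x <= 1 by near: x; apply: nbhs_right_le.
    rewrite normr_ge0/= normrM (ger0_norm (en0 _ x0)).
    have xs : x `^ (- (1 / 2)) * x = x `^ (1 / 2).
      rewrite -[X in _ * X]powRr1 ?(ltW x0)// -powRD ?(gt_eqF x0) ?implybT//.
      by congr (_ `^ _); field.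
    have ex : erlang n.+1 x <= x.
      rewrite /erlang exprS -mulrA ler_piMr ?(ltW x0)// mulr_ile1 ?exprn_ge0 ?expR_ge0 ?(ltW x0)//.
        by rewrite exprn_ile1 ?(ltW x0).
      by rewrite -expR0 ler_expR lerNl oppr0 ltW.
    apply: (@le_trans _ _ (C * (x `^ (1 / 2) + x `^ (- (1 / 2))) * x)).
      apply: le_trans (ler_wpM2r (en0 _ x0) (gC _ x0)) _.
      by rewrite ler_wpM2l// mulr_ge0// addr_ge0 ?powR_ge0.
    rewrite (mulrC 2 C) -mulrA -[leRHS]mulrA ler_wpM2l// mulrDl xs.
    have : x `^ (1 / 2) * x <= x `^ (1 / 2) by rewrite ler_piMr ?powR_ge0.
    lra.
  + exact: cvg_cst.
  + rewrite -[X in _ --> X](mulr0 (2 * C)); apply: cvgM; first exact: cvg_cst.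
    by apply: powR_cvg0; lra.
Unshelve. all: by end_near. Qed.

(* Integration by parts; [g1 x] is [x * g'(x)]. *)
Lemma erlang_int_rec n g g1 : tame g -> tame g1 ->
  (forall x, 0 < x -> is_derive x 1 g (g1 x / x)) ->
  erlang_int n.+1 g = n.+1%:R * erlang_int n g + erlang_int n g1.
Proof.
move=> tg tg1 dg; have [Fy F0] := prim_cvg n tg.
pose f x := g1 x * erlang n x + n.+1%:R * (g x * erlang n x) - g x * erlang n.+1 x.
have i1 := integrable_tame n tg1; have i2 := integrable_tame n tg.
have i3 := integrable_tame n.+1 tg.
have i2' : leb.-integrable itv0y (fun x => (n.+1%:R * (g x * erlang n x))%:E).
  rewrite (_ : (fun _ => _) = fun x => (n.+1%:R%:E * (g x * erlang n x)%:E)%E).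
    exact: integrableZl.
  by apply/funext => x.
have i12 : leb.-integrable itv0y
    (fun x => (g1 x * erlang n x + n.+1%:R * (g x * erlang n x))%:E).
  rewrite (_ : (fun _ => _) = fun x =>
      ((g1 x * erlang n x)%:E + (n.+1%:R * (g x * erlang n x))%:E)%E).
    exact: integrableD.
  by apply/funext => x.
have intf : leb.-integrable itv0y (EFin \o f).
  rewrite (_ : EFin \o f = fun x => ((g1 x * erlang n x + n.+1%:R * (g x * erlang n x))%:E
    - (g x * erlang n.+1 x)%:E)%E); last by apply/funext => x.
  exact: integrableB.
have cge k h x : tame h -> 0 < x -> {for x, continuous (fun y => h y * erlang k y)}.
  by move=> [ch _] x0; apply: continuousM; [exact: ch|exact: continuous_erlang].
have e : (\int[leb]_(x in itv0y) (f x)%:E = 0)%E.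
  rewrite (_ : 0%E = (0 - 0 : R)%:E); last by rewrite subrr.
  apply: (@integrable_FTC0y _ (fun x => g x * erlang n.+1 x)) => //.
  - move=> x x0; have dgx := dg x x0.
    have de : is_derive x 1 (erlang n.+1) (n.+1%:R * erlang n x - erlang n.+1 x).
      have d1 : is_derive x 1 (fun y : R => y ^+ n.+1) (n.+1%:R * x ^+ n).
        rewrite (_ : (fun _ => _) = id ^+ n.+1); last by apply/funext => y; rewrite fctE.
        by apply: is_derive_eq; rewrite /GRing.scale/=; ring.
      have d2 : is_derive x 1 (fun y : R => expR (- y)) (- expR (- x)).
        by apply: is_derive_eq; rewrite /GRing.scale/=; ring.
      apply: (@is_derive_eq _ _ _ _ _ _ _ _ (is_deriveM d1 d2)).
      by rewrite /GRing.scale/= /erlang; ring.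
    apply: (@is_derive_eq _ _ _ _ _ _ _ _ (is_deriveM dgx de)); rewrite /GRing.scale/= /f.
    rewrite (_ : erlang n.+1 x * (g1 x / x) = g1 x * erlang n x); first by ring.
    by rewrite /erlang exprS; field; rewrite gt_eqF.
  - move=> x x0; apply: continuousB; last exact: cge.
    apply: continuousD; first exact: cge.
    by apply: continuousM; [exact: cst_continuous|exact: cge].
have : \int[leb]_(x in itv0y) f x = 0 by rewrite /Rintegral e.
rewrite RintegralB// RintegralD// RintegralZl// => /eqP; rewrite subr_eq0 => /eqP.
by rewrite -!/(erlang_int _ _) addrC => ->.
Qed.

Lemma erlang_int0_cst1 : erlang_int 0 (fun=> 1) = 1.
Proof.
have i1 := integrable_tame 0 (tame_cst 1).
have e : (\int[leb]_(x in itv0y) (1 * erlang 0 x)%:E = 1)%E.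
  rewrite (_ : 1%E = (0 - - expR (- 0) : R)%:E); last first.
    by rewrite oppr0 expR0 opprK add0r.
  have dexp (x : R) : is_derive x 1 (fun x : R => - expR (- x)) (expR (- x)).
    by apply: is_derive_eq; rewrite /GRing.scale/=; ring.
  apply: (@integrable_FTC0y _ (fun x : R => - expR (- x))) => //.
  - by move=> x x0; rewrite mul1r /erlang expr0 mul1r.
  - move=> x x0; apply: continuousM; first exact: cst_continuous.
    exact: continuous_erlang.
  - rewrite -oppr0; apply: cvgN; exact: cvgr_expR.
  - have c0 : {for 0, continuous (fun x : R => - expR (- x))}.
      apply: differentiable_continuous.
      by apply/derivable1_diffP; have [] := dexp 0.
    exact: cvg_at_right_filter.
by rewrite /erlang_int /Rintegral e.
Qed.

Definition erlang_mean n g : R := erlang_int n g / (n`!)%:R.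

Let fact0 n : (n`!)%:R != 0 :> R. Proof. by rewrite pnatr_eq0 -lt0n fact_gt0. Qed.

Lemma erlang_meanS n g g1 : tame g -> tame g1 ->
  (forall x, 0 < x -> is_derive x 1 g (g1 x / x)) ->
  erlang_mean n.+1 g = erlang_mean n g + erlang_mean n g1 / n.+1%:R.
Proof.
move=> tg tg1 dg; rewrite /erlang_mean (erlang_int_rec n tg tg1 dg) factS natrM.
by field; rewrite nat1r pnatr_eq0 fact0.
Qed.

Lemma erlang_mean1 n : erlang_mean n (fun=> 1) = 1.
Proof.
elim: n => [|n IH]; first by rewrite /erlang_mean erlang_int0_cst1 divr1.
have d0 (x : R) : 0 < x -> is_derive x 1 (fun=> 1 : R) (0 / x).
  by move=> x0; rewrite mul0r; exact: is_derive_cst.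
have := erlang_meanS n (tame_cst 1) (tame_cst 0) d0; rewrite IH => ->.
rewrite (_ : erlang_mean n (fun=> 0) = 0) ?mul0r ?addr0//.
rewrite /erlang_mean /erlang_int (_ : Rintegral _ _ _ = 0) ?mul0r//.
rewrite [LHS](_ : _ = \int[leb]_(x in itv0y) (0 * (1 * erlang n x))); last first.
  by apply: eq_Rintegral => x _; rewrite !mul0r.
by rewrite RintegralZl ?mul0r//; exact: (integrable_tame _ (tame_cst 1)).
Qed.

Lemma erlang_meanD n g h : tame g -> tame h ->
  erlang_mean n (fun x => g x + h x) = erlang_mean n g + erlang_mean n h.
Proof. by move=> tg th; rewrite /erlang_mean erlang_intD// mulrDl. Qed.

Lemma erlang_meanZ n c g : tame g ->
  erlang_mean n (fun x => c * g x) = c * erlang_mean n g.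
Proof. by move=> tg; rewrite /erlang_mean erlang_intZ// mulrA. Qed.

Let tln : tame (@ln R) := tame_lnX 1.
Let tln2 : tame (fun x => ln x ^+ 2) := tame_lnX 2.

(* Mean and second moment of the logarithm of a Gamma variable of shape [n.+1].
   Their recursions express the values at [0] as series, since [p n - ln n] and
   the variance [q n - p n ^+ 2] tend to [0]. *)
Let p n := erlang_mean n (@ln R).
Let q n := erlang_mean n (fun x => ln x ^+ 2).

Let pS n : p n.+1 = p n + n.+1%:R^-1.
Proof.
have d1 (x : R) : 0 < x -> is_derive x 1 (@ln R) (1 / x).
  by move=> x0; rewrite mul1r; exact: is_derive1_ln.
by have := erlang_meanS n tln (tame_cst 1) d1; rewrite erlang_mean1 mul1r.
Qed.

Let qS n : q n.+1 = q n + 2 * p n / n.+1%:R.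
Proof.
have d2 (x : R) : 0 < x -> is_derive x 1 (fun x => @ln R x ^+ 2) (2 * ln x / x).
  move=> x0; have dl := is_derive1_ln x0.
  rewrite (_ : (fun _ => _) = @ln R * @ln R); last by apply/funext => y; rewrite expr2.
  by apply: is_derive_eq; rewrite /GRing.scale/=; ring.
by have := erlang_meanS n tln2 (tameZ 2 tln) d2; rewrite erlang_meanZ.
Qed.

Let quad n c : erlang_mean n (fun x => (ln x - c) ^+ 2) = q n - 2 * c * p n + c ^+ 2.
Proof.
have -> : (fun x => (ln x - c) ^+ 2) =
    (fun x => (ln x ^+ 2 + - (2 * c) * ln x) + c ^+ 2 * 1).
  by apply/funext => x; ring.
rewrite erlang_meanD ?erlang_meanD ?erlang_meanZ ?erlang_mean1 ?mulr1 ?mulNr//.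
- exact: tame_cst.
- exact: tameZ.
- by apply: tameD => //; exact: tameZ.
- exact: tame_cst.
Qed.

Let quad_ge0 n c : 0 <= q n - 2 * c * p n + c ^+ 2.
Proof.
rewrite -quad /erlang_mean divr_ge0//; apply: erlang_int_ge0 => x.
exact: sqr_ge0.
Qed.

(** With [u = sqrt y], from [ln u <= u - 1] and [- ln u <= (1 - u) / u]. The majorant
    [4 (y - 2 + 1 / y)] has an explicit mean under a Gamma law. *)
Lemma sqr_ln_le (y : R) : 0 < y -> ln y ^+ 2 <= 4 * ((y - 1) ^+ 2 / y).
Proof.
move=> y0; pose u := Num.sqrt y; have u0 : 0 < u by rewrite sqrtr_gt0.
have yE : y = u ^+ 2 by rewrite sqr_sqrtr// ltW.
have lnE : ln (u ^+ 2) = 2 * ln u by rewrite lnXn// mulr_natl.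
rewrite yE lnE exprMn; have -> : (2 : R) ^+ 2 = 4 by rewrite -natrX.
rewrite ler_wpM2l// ler_pdivlMr ?exprn_gt0// -exprMn.
have -> : (u ^+ 2 - 1) ^+ 2 = ((u - 1) * (u + 1)) ^+ 2 by ring.
have lup : ln u <= u - 1 by have := @le_ln1Dx _ (u - 1); rewrite (addrC 1) subrK; apply; lra.
have lum : - ln u <= (1 - u) / u.
  rewrite -lnV ?posrE//; have := @le_ln1Dx _ (u^-1 - 1); rewrite (addrC 1) subrK.
  have ui0 : 0 < u^-1 by rewrite invr_gt0.
  by move=> h; apply: le_trans (h _) _; [lra|rewrite mulrBl mul1r mulfV ?gt_eqF].
rewrite ler_pdivlMr// in lum.
have [u1|u1] := leP 1 u.
  have l0 := ln_ge0 u1.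
  have h1 : 0 <= ln u * u by rewrite mulr_ge0// ltW.
  have h2 : ln u * u <= (u - 1) * (u + 1) by nra.
  by rewrite lerXn2r ?nnegrE// (le_trans h1).
have l0 : ln u <= 0 by apply: ln_le0; exact: ltW.
rewrite -[leLHS]sqrrN -[leRHS]sqrrN.
have h1 : 0 <= - (ln u * u) by rewrite -mulNr mulr_ge0 ?oppr_ge0// ltW.
have h2 : - (ln u * u) <= - ((u - 1) * (u + 1)) by nra.
by rewrite lerXn2r ?nnegrE// (le_trans h1).
Qed.

(** For [X] of Gamma law of shape [n + 2] and [Y = X / (n + 1)], [E Y = (n + 2) / (n + 1)] and
    [E (1 / Y) = 1], so the majorant of [sqr_ln_le] has mean exactly [4 / (n + 1)]. This bounds the
    variance and the squared bias of [ln X] about [ln (n + 1)] together. *)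
Let quad_le n : q n.+1 - 2 * ln n.+1%:R * p n.+1 + ln n.+1%:R ^+ 2 <= 4 / n.+1%:R.
Proof.
have N0 : 0 < n.+1%:R :> R by [].
rewrite -quad /erlang_mean ler_pdivrMr ?ltr0n ?fact_gt0//.
pose g2 x := 4 / n.+1%:R * ((1 * erlang n.+2 x + - (2 * n.+1%:R) * (1 * erlang n.+1 x))
    + n.+1%:R ^+ 2 * (1 * erlang n x)).
have i1 k := integrable_tame k (tame_cst 1).
have iZ c k : leb.-integrable itv0y (fun x => (c * (1 * erlang k x))%:E).
  rewrite (_ : (fun _ => _) = fun x => (c%:E * (1 * erlang k x)%:E)%E).
    by apply: integrableZl => //; exact: i1.
  by apply/funext => x.
have iD (h1 h2 : R -> R) : leb.-integrable itv0y (EFin \o h1) ->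
    leb.-integrable itv0y (EFin \o h2) ->
    leb.-integrable itv0y (fun x => (h1 x + h2 x)%:E).
  move=> I1 I2; rewrite (_ : (fun _ => _) = (EFin \o h1) \+ (EFin \o h2)).
    exact: integrableD.
  by apply/funext => x.
have I12 := iD _ _ (i1 n.+2) (iZ (- (2 * n.+1%:R)) n.+1).
have I123 := iD _ _ I12 (iZ (n.+1%:R ^+ 2) n).
have ig2 : leb.-integrable itv0y (EFin \o g2).
  rewrite (_ : EFin \o g2 = fun x => ((4 / n.+1%:R)%:E *
    ((1 * erlang n.+2 x + - (2 * n.+1%:R) * (1 * erlang n.+1 x))
    + n.+1%:R ^+ 2 * (1 * erlang n x))%:E)%E).
    exact: integrableZl.
  by apply/funext => x.
apply: (@le_trans _ _ (\int[leb]_(x in itv0y) g2 x)).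
  apply: le_Rintegral => //.
    have tq : tame (fun x => (ln x - ln n.+1%:R) ^+ 2).
      have -> : (fun x => (ln x - ln n.+1%:R) ^+ 2) =
        (fun x : R => (ln x ^+ 2 + - (2 * ln n.+1%:R) * ln x) + ln n.+1%:R ^+ 2).
        by apply/funext => x; ring.
      by apply: tameD; [apply: tameD => //; exact: tameZ|exact: tame_cst].
    exact: integrable_tame.
  move=> x /=; rewrite in_itv/= andbT => x0.
  have y0 : 0 < x / n.+1%:R by rewrite divr_gt0.
  have := sqr_ln_le y0; rewrite ln_div ?posrE// => h.
  have e0 : 0 <= erlang n.+1 x by rewrite mulr_ge0 ?expR_ge0 ?exprn_ge0 ?ltW.
  apply: le_trans (ler_wpM2r e0 h) _; rewrite /g2 /erlang.
  rewrite [x ^+ n.+2]exprS [x ^+ n.+1]exprS le_eqVlt; apply/orP; left.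
  by apply/eqP; field; rewrite nat1r pnatr_eq0 (lt0r_neq0 x0).
have mI : @measurable _ (measurableTypeR R) itv0y by exact: measurable_itv.
rewrite /g2 (RintegralZl _ mI I123) (RintegralD mI I12 (iZ _ _)).
rewrite (RintegralD mI (i1 _) (iZ _ _)) !(RintegralZl _ mI (i1 _)).
have E k : \int[leb]_(x in itv0y) (1 * erlang k x) = k`!%:R.
  have h := erlang_mean1 k; rewrite /erlang_mean /erlang_int in h.
  by rewrite -[LHS](divfK (fact0 k)) h mul1r.
rewrite !E !factS !natrM le_eqVlt; apply/orP; left; apply/eqP.
rewrite -(natr1 n.+1); field; by rewrite nat1r pnatr_eq0.
Qed.

Let pE n : p n = p 0 + \sum_(1 <= k < n.+1) k%:R^-1.
Proof.
elim: n => [|n IH]; first by rewrite big_geq// addr0.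
by rewrite pS IH [in RHS]big_nat_recr//= addrA.
Qed.

Let v n := q n - p n ^+ 2.

Let vS n : v n = v n.+1 + n.+1%:R ^- 2.
Proof.
have hp := pS n; have hq := qS n; rewrite /v hp hq.
move: (p n) (q n) => a b; field.
by rewrite nat1r pnatr_eq0.
Qed.

Let vE n : v 0 = v n + \sum_(1 <= k < n.+1) k%:R ^- 2.
Proof.
elim: n => [|n IH]; first by rewrite big_geq// addr0.
by rewrite IH [in RHS]big_nat_recr//= (vS n) addrA [in RHS]addrAC.
Qed.

Let cvg_inv_nat (c : R) : c / n.+1%:R @[n --> \oo] --> 0.
Proof.
rewrite -[X in _ --> X](mulr0 c); apply: cvgM; first exact: cvg_cst.
exact: cvg_harmonic.
Qed.

Let v_cvg0 : v n.+1 @[n --> \oo] --> 0.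
Proof.
apply: (@squeeze_cvgr _ _ _ _ (fun=> 0) (fun n => 4 / n.+1%:R)).
- apply: nearW => n; rewrite /v.
  have := quad_ge0 n.+1 (p n.+1); have := quad_le n.
  have := sqr_ge0 (p n.+1 - ln n.+1%:R).
  move: (p n.+1) (q n.+1) (ln _) (4 / _) => a b c e h1 h2 h3.
  by apply/andP; split; nra.
- exact: cvg_cst.
- exact: cvg_inv_nat.
Qed.

Let p_ln_cvg0 : p n.+1 - ln n.+1%:R @[n --> \oo] --> 0.
Proof.
have h : (p n.+1 - ln n.+1%:R) ^+ 2 @[n --> \oo] --> 0.
  apply: (@squeeze_cvgr _ _ _ _ (fun=> 0) (fun n => 4 / n.+1%:R)).
  - apply: nearW => n; rewrite sqr_ge0/=.
    have := quad_ge0 n.+1 (p n.+1); have := quad_le n.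
    by move: (p n.+1) (q n.+1) (ln _) (4 / _) => a b c e h1 h2; nra.
  - exact: cvg_cst.
  - exact: cvg_inv_nat.
apply: norm_cvg0; rewrite -(sqrtr0 R).
under eq_fun do rewrite -sqrtr_sqr.
by apply: continuous_cvg => //; exact: sqrt_continuous.
Qed.

(** [p n] is [p 0] plus the harmonic sum, and [p n] is asymptotic to [ln n] with vanishing
    difference. The convergence of the sequence defining [euler_gamma] is obtained at the same
    time. *)
Lemma erlang_mean_ln : erlang_mean 0 (@ln R) = - euler_gamma.
Proof.
have : (\sum_(1 <= k < n.+1) k%:R^-1) - ln n%:R @[n --> \oo] --> - p 0.
  rewrite -cvg_shiftS -(add0r (- p 0)).
  have -> : (fun n => (\sum_(1 <= k < n.+2) k%:R^-1) - ln n.+1%:R) =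
      (fun n => p n.+1 - ln n.+1%:R + - p 0).
    by apply/funext => n; rewrite (pE n.+1); ring.
  by apply: cvgD; [exact: p_ln_cvg0|exact: cvg_cst].
by move/cvg_lim => h; rewrite /euler_gamma h// opprK.
Qed.

Let S n : R := \sum_(1 <= k < n.+1) k%:R ^- 2.

Let S_cvg : S n @[n --> \oo] --> v 0.
Proof.
rewrite -cvg_shiftS.
have -> : (fun n => S n.+1) = (fun n => v 0 - v n.+1).
  by apply/funext => n; rewrite (vE n.+1) addrC addKr.
have h : (v 0 - v n.+1) @[n --> \oo] --> v 0 - 0.
  by apply: cvgB; [exact: cvg_cst|exact: v_cvg0].
by rewrite subr0 in h.
Qed.

Let S_double N : S N.*2 = \sum_(0 <= k < N) ((2 * k + 1)%:R ^- 2) + S N / 4.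
Proof.
rewrite /S; elim: N => [|N IH]; first by rewrite !big_geq// mul0r addr0.
rewrite doubleS (@big_nat_recr _ _ _ N.*2.+2)//= (@big_nat_recr _ _ _ N.*2.+1)//= IH.
rewrite (@big_nat_recr _ _ _ N 0)//= (@big_nat_recr _ _ _ N.+1 1)//=.
have -> : (2 * N + 1 = N.*2.+1)%N by lia.
have -> : (N.*2.+2 = 2 * N.+1)%N by lia.
rewrite natrM; field.
by rewrite !nat1r !pnatr_eq0.
Qed.

(** Removing the even terms, [S (2 N) - S N / 4] is the sum over odd integers, which tends to
    [pi^2 / 8] along powers of 2; so three quarters of the limit equal [pi^2 / 8]. *)
Lemma v0E : v 0 = (pi : R) ^+ 2 / 6.
Proof.
have c2 : ((2 ^ n)%N @[n --> \oo]) --> \oo.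
  apply/cvgnyPge => A; near=> n; apply: (@leq_trans n); last exact/ltnW/ltn_expl.
  by near: n; exact: nbhs_infty_ge.
have c1 : S (2 ^ n) @[n --> \oo] --> v 0 by exact: (cvg_comp _ _ c2 S_cvg).
have c3 : S (2 ^ n.+1) @[n --> \oo] --> v 0.
  by have := c1; rewrite -cvg_shiftS.
have c4 : (S (2 ^ n.+1) - S (2 ^ n) / 4) @[n --> \oo] --> v 0 - v 0 / 4.
  by apply: cvgB => //; apply: cvgM => //; exact: cvg_cst.
have c5 : (S (2 ^ n.+1) - S (2 ^ n) / 4) @[n --> \oo] --> (pi : R) ^+ 2 / 8.
  apply: (@squeeze_cvgr _ _ _ _
    (fun n => (pi : R) ^+ 2 / 8 - (pi : R) ^+ 2 / 16 * 2 ^- n) (fun=> (pi : R) ^+ 2 / 8)).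
  - apply: nearW => n; rewrite expnS mul2n S_double addrK.
    exact: sum_inv_odd_sqr_bounds.
  - rewrite -[X in _ --> X](subr0 ((pi : R) ^+ 2 / 8)); apply: cvgB; first exact: cvg_cst.
    rewrite -[X in _ --> X](mulr0 ((pi : R) ^+ 2 / 16)); apply: cvgM; first exact: cvg_cst.
    under eq_fun do rewrite -exprVn.
    apply: cvg_expr; rewrite ger0_norm ?invr_ge0// invf_lt1// ltr1n//.
  - exact: cvg_cst.
have := cvg_unique (@norm_hausdorff _ _) c4 c5 => /(_ _); lra.
Unshelve. all: by end_near. Qed.

Lemma erlang_mean_ln2 :
  erlang_mean 0 (fun x => ln x ^+ 2) = euler_gamma ^+ 2 + (pi : R) ^+ 2 / 6.
Proof.
have := v0E; rewrite /v => /eqP; rewrite subr_eq => /eqP.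
by rewrite /q => ->; rewrite /p erlang_mean_ln sqrrN addrC.
Qed.

End log_moments.

(** * Moments of the logarithmic residuals *)

Section rays.
Context {R : realType}.

(** Open rays form a generating pi-system, and the rays []- k, +oo[], of finite measure, cover the
    line. *)
Lemma probability_gt_unique (m1 m2 : {measure set R -> \bar R}) :
  (forall u : R, (m1 `]u, +oo[%classic < +oo)%E) ->
  (forall u : R, m1 `]u, +oo[%classic = m2 `]u, +oo[%classic) ->
  forall A : set R, measurable A -> m1 A = m2 A.
Proof.
move=> m1y m12; apply: (@measure_unique _ _ _
  (@RGenOInfty.G R) (fun k => `]- k%:R, +oo[%classic)).
- exact: RGenOInfty.measurableE.
- move=> _ _ [x ->] [y ->]; exists (Num.max x y).
  by apply/seteqP; split => z /=; rewrite !in_itv/= !andbT gt_max; [move=> [-> ->]|move=> /andP[-> ->]].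
- by move=> k; exists (- k%:R).
- apply/seteqP; split => // x _; exists (Num.truncn `|x|).+1 => //=.
  rewrite in_itv/= andbT ltrNl; apply: (@le_lt_trans _ _ `|x|).
    by rewrite -normrN ler_norm.
  exact: truncnS_gt.
- by move=> _ [x ->].
- by move=> k.
Qed.

End rays.

(** * The unit exponential law *)

Section exponential_variable.
Context {R : realType}.
Notation leb := (@lebesgue_measure R).
Notation itv0y := (`]0, +oo[%classic : set R).

Definition expo : probability (measurableTypeR R) R :=
  exponential_distribution_exponential_prob__canonical__probability_measure_Probability
    (@ltr01 R).

Lemma ge0_integral_expo (g : R -> \bar R) : measurable_fun setT g ->
  (forall x, 0 <= g x)%E ->
  (\int[expo]_x g x = \int[leb]_(x in itv0y) (g x * (expR (- x))%:E))%E.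
Proof.
move=> mg g0.
have mp : measurable_fun setT (exponential_pdf 1 : R -> R).
  exact: measurable_exponential_pdf.
have p0 x : 0 <= exponential_pdf 1 x :> R by exact: exponential_pdf_ge0.
have mg' : measurable_fun (setT : set (measurableTypeR R)) g.
  by move=> _ B mB; exact: mg.
rewrite (@ge0_integral_density _ (measurableTypeR R) R leb expo (exponential_pdf 1) p0 mp _ g mg' g0)//.
have mge : measurable_fun setT (fun x : R => (g x * (expR (- x))%:E)%E).
  apply: emeasurable_funM => //; apply/measurable_EFinP.
  by apply: measurableT_comp => //; exact: measurable_expR.
rewrite integral_itv_obnd_cbnd; last by apply: measurable_funTS => _ B mB; exact: mge.
rewrite [RHS]integral_mkcond; apply: eq_integral => x _.
rewrite patchE /exponential_pdf patchE.
by case: ifPn => _; rewrite ?mule0// mul1r mulN1r.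
Qed.

Lemma integral_expR_ray b c : 0 < c ->
  (\int[leb]_(x in `]b, +oo[) (expR (- (c * x)))%:E = (expR (- (c * b)) / c)%:E)%E.
Proof.
move=> c0; pose F x : R := - (expR (- (c * x)) / c).
have dexp (x : R) : is_derive x 1 F (expR (- (c * x))).
  apply: is_derive_eq; rewrite /GRing.scale/=.
  by field; rewrite gt_eqF.
have cexp (x : R) : {for x, continuous (fun x : R => expR (- (c * x)))}.
  apply: (@continuous_comp _ _ _ (fun x : R => - (c * x)) expR); last exact: continuous_expR.
  apply: (@continuousN _ R^o _ (fun x : R => c * x)).
  exact: mulrl_continuous.
rewrite integral_itv_obnd_cbnd; last first.
  apply/measurable_EFinP; apply: measurableT_comp; first exact: measurable_expR.
  by apply: measurableT_comp => //; exact: measurable_funM.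
rewrite (@ge0_continuous_FTC2y _ _ F _ 0).
- by rewrite -EFinB sub0r opprK.
- by move=> x _; exact: expR_ge0.
- by apply: continuous_subspaceT => x; exact: cexp.
- rewrite -oppr0 -(mul0r c^-1); apply: cvgN; apply: cvgM; last exact: cvg_cst.
  apply: (@cvg_comp _ _ _ (fun x => c * x) (fun y => expR (- y)) _ +oo%R); last exact: cvgr_expR.
  exact: gt0_cvgMry.
- by move=> x _; have [] := dexp x.
- apply: cvg_at_right_filter.
  by apply: differentiable_continuous; apply/derivable1_diffP; have [] := dexp b.
- by move=> x _; rewrite derive1E; have [] := dexp x.
Qed.

Lemma measurable_lt_ln b : measurable ([set y | b < ln y] : set R).
Proof.
rewrite (_ : mkset _ = (@ln R) @^-1` `]b, +oo[%classic); last first.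
  by apply/seteqP; split => y /=; rewrite in_itv/= andbT.
by rewrite -[X in measurable X]setTI; exact: measurable_ln.
Qed.

Lemma expo_lt_ln b : expo [set y | b < ln y] = (expR (- expR b))%:E.
Proof.
set A := mkset _; have mA : measurable A by exact: measurable_lt_ln.
rewrite -[LHS](_ : (\int[expo]_x (\1_A x)%:E)%E = _); last first.
  rewrite integral_indic ?setIT//.
rewrite ge0_integral_expo//; last first.
  by apply/measurable_EFinP; exact: measurable_indic.
transitivity (\int[leb]_(x in `]expR b, +oo[) (expR (- x))%:E)%E.
  rewrite [LHS]integral_mkcond [RHS]integral_mkcond; apply: eq_integral => x _.
  rewrite !patchE !mem_setE !in_itv/= !andbT indicE /A.
  have [x0|x0] := ltP 0 x.
    rewrite (_ : (x \in A) = (expR b < x)); last first.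
      by rewrite -[X in _ < X]lnK ?posrE// ltr_expR; apply/idP/idP; rewrite inE.
    by case: ifPn => _; rewrite ?mul1e ?mul0e.
  by rewrite ltNge (le_trans x0 (expR_ge0 _)).
have := integral_expR_ray (expR b) (@ltr01 R).
by rewrite mul1r divr1; under eq_integral do rewrite mul1r.
Qed.

End exponential_variable.

(** * Comparison with an exponential variable *)

Section log_ratio_law.
Context {R : realType} d (T : measurableType d) (P : probability T R).
Variables (X : T -> R) (nu L : R).
Hypotheses (nu0 : 0 < nu) (L0 : 0 < L) (mX : measurable_fun setT X)
  (X_gt0 : P [set w | X w <= 0] = 0%E)
  (laplaceX : forall z, 0 < z ->
    (\int[P]_w (expR (- (z * X w)))%:E = (L / (L + z `^ nu))%:E)%E).

Definition log_ratio (z : T * measurableTypeR R) : R :=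
  nu * (ln z.2 - ln (X z.1)) - ln L.

Lemma measurable_log_ratio : measurable_fun setT log_ratio.
Proof.
have m2 : measurable_fun setT (fun z : T * measurableTypeR R => ln z.2 : R).
  have m0 : measurable_fun setT (fun z : T * measurableTypeR R => z.2 : R).
    have h : measurable_fun setT (snd : T * measurableTypeR R -> measurableTypeR R).
      exact: measurable_snd.
    by move=> _ B mB; exact: h.
  by apply: measurableT_comp => //; exact: measurable_ln.
have m1 : measurable_fun setT (fun z : T * measurableTypeR R => ln (X z.1)).
  apply: measurableT_comp; first exact: measurable_ln.
  by apply: measurableT_comp => //; exact: measurable_fst.
apply: measurable_funB => //; apply: measurable_funM => //.
exact: measurable_funB.
Qed.

Lemma log_ratio_gt u :
  (P \x expo)%E [set z | u < log_ratio z] = ((1 + expR u)^-1)%:E.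
Proof.
rewrite /product_measure1 /=.
(* Given [X = x > 0] the event is [y > c x], of probability [exp (- c x)], so the answer is the
   Laplace transform at [c], where [c^nu = L e^u]. *)
pose c := expR ((u + ln L) / nu); have c0 : 0 < c by exact: expR_gt0.
have -> : (1 + expR u)^-1 = L / (L + c `^ nu).
  rewrite /c -expRM divfK ?(gt_eqF nu0)// expRD lnK ?posrE//.
  by rewrite -[X in L / (X + _)]mul1r -mulrDl invfM mulrCA mulfV ?mulr1// gt_eqF.
rewrite -laplaceX//; apply: ae_eq_integral => //.
- apply: (@measurable_fun_xsection _ _ _ _ _ expo).
  rewrite (_ : mkset _ = log_ratio @^-1` `]u, +oo[%classic); last first.
    by apply/seteqP; split => y /=; rewrite in_itv/= andbT.
  by rewrite -[X in measurable X]setTI; exact: measurable_log_ratio.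
- apply/measurable_EFinP; apply: measurableT_comp; first exact: measurable_expR.
  by apply: measurableT_comp => //; exact: measurable_funM.
(* The rewriting with [ln (X w)] needs [X w > 0]; the remaining set is null by hypothesis. *)
exists [set w | X w <= 0]; split => //.
  rewrite (_ : mkset _ = X @^-1` `]-oo, 0]%classic).
    by rewrite -[X in measurable X]setTI; exact: mX.
  by apply/seteqP; split => y /=; rewrite in_itv/=.
move=> w /= hw; rewrite leNgt; apply/negP => X0; apply: hw => _.
rewrite (_ : xsection _ w = [set y | (u + ln L) / nu + ln (X w) < ln y]); last first.
  apply/seteqP; split => y; rewrite /xsection/= inE/= /log_ratio/=.
    by move=> h; rewrite -ltrBrDr ltr_pdivrMr// mulrC; lra.
  by rewrite -ltrBrDr ltr_pdivrMr// mulrC => h; lra.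
by rewrite expo_lt_ln expRD lnK ?posrE.
Qed.

End log_ratio_law.

Section log_ratio_transfer.
Context {R : realType}.

Lemma expo_le0 : expo [set x : R | x <= 0] = 0%E.
Proof.
have mA : measurable ([set x | x <= 0] : set R).
  rewrite (_ : mkset _ = `]-oo, 0]%classic); first exact: measurable_itv.
  by apply/seteqP; split => y /=; rewrite in_itv/=.
rewrite -[LHS](_ : (\int[expo]_x (\1_[set x : R | (x <= 0)%R] x)%:E)%E = _); last first.
  by rewrite integral_indic ?setIT.
rewrite ge0_integral_expo//; last first.
  by apply/measurable_EFinP; exact: measurable_indic.
apply: integral0_eq => x /=; rewrite in_itv/= andbT => x0.
by rewrite indicE memNset ?mul0e//= leNgt x0.
Qed.

(** The exponential law is the case [nu = L = 1] of the hypothesis on [X], which makes it the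
    reference variable of the comparison. *)
Lemma laplace_expo (z : R) : 0 < z ->
  (\int[expo]_x (expR (- (z * x)))%:E = (1 / (1 + z `^ 1) : R)%:E)%E.
Proof.
move=> z0; rewrite powRr1 ?ltW//.
rewrite ge0_integral_expo; last 2 first.
- exact: measurable_expRN.
- by move=> x; rewrite lee_fin expR_ge0.
have z1 : 0 < 1 + z by rewrite addr_gt0.
rewrite -[RHS](_ : (expR (- ((1 + z) * 0)) / (1 + z))%:E = _); last first.
  by rewrite mulr0 oppr0 expR0.
rewrite -integral_expR_ray//; apply: eq_integral => x _.
by rewrite -EFinM -expRD; congr (expR _)%:E; ring.
Qed.

Context d (T : measurableType d) (P : probability T R).
Variables (X : T -> R) (nu L : R).
Hypotheses (nu0 : 0 < nu) (L0 : 0 < L) (mX : measurable_fun setT X)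
  (X_gt0 : P [set w | X w <= 0] = 0%E)
  (laplaceX : forall z, 0 < z ->
    (\int[P]_w (expR (- (z * X w)))%:E = (L / (L + z `^ nu))%:E)%E).

Let X1 : measurableTypeR R -> R := id.

(* The law of [log_ratio] does not depend on [X], [nu] and [L], hence it can be
   computed with an exponential variable in place of [X]. *)
Lemma log_ratio_transfer (g : R -> \bar R) : measurable_fun setT g ->
  (forall x, 0 <= g x)%E ->
  (\int[P \x expo]_z g (log_ratio X nu L z) =
   \int[expo \x expo]_z g (log_ratio X1 1 1 z))%E.
Proof.
move=> mg g0; have mV := measurable_log_ratio nu L mX.
have mX1 : measurable_fun setT (X1 : measurableTypeR R -> R).
  by move=> _ B mB; rewrite setTI.
have mV1 := measurable_log_ratio 1 1 mX1.
pose m := measure_function_pushforward__canonical__measure_function_Measure (P \x expo)%E mV.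
pose m1 := measure_function_pushforward__canonical__measure_function_Measure (expo \x expo)%E mV1.
have mE (A : set R) : measurable A -> m A = m1 A.
  have rayE (W : _ -> R) u : W @^-1` `]u, +oo[%classic = [set z | u < W z].
    by apply/seteqP; split => y /=; rewrite in_itv/= andbT.
  apply: probability_gt_unique => u.
    by rewrite /m/= /pushforward rayE log_ratio_gt// ltry.
  rewrite /m /m1/= /pushforward !rayE log_ratio_gt// log_ratio_gt//.
    exact: expo_le0.
  exact: laplace_expo.
transitivity (\int[m]_x g x)%E; first by rewrite ge0_integral_pushforward.
transitivity (\int[m1]_x g x)%E; last by rewrite ge0_integral_pushforward.
by apply: eq_measure_integral => A mA _; exact: mE.
Qed.

End log_ratio_transfer.

Section expo_log_moments.
Context {R : realType}.
Local Notation gamma := (@euler_gamma R).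

Lemma measurable_lnD (c : R) : measurable_fun setT (fun y : measurableTypeR R => ln y + c : R).
Proof.
have h : measurable_fun setT (fun y : R => ln y + c).
  by apply: measurable_funD => //; exact: measurable_ln.
by move=> _ B mB; exact: h.
Qed.

Lemma ge0_integral_expo_tame (g : R -> R) : tame g -> measurable_fun setT g ->
  (forall x, 0 <= g x) -> (\int[expo]_x (g x)%:E = (erlang_mean 0 g)%:E)%E.
Proof.
move=> tg mg g0; rewrite ge0_integral_expo//; last exact/measurable_EFinP.
have ig := integrable_tame 0 tg.
rewrite /erlang_mean divr1 /erlang_int /Rintegral fineK.
  by apply: eq_integral => x _; rewrite /erlang expr0 mul1r EFinM.
exact: (integral_fune_fin_num _ ig).
Qed.

(** The free shift [t] keeps the information on the mean inside nonnegative integrals. *)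
Lemma integral_expo_sqr (t : R) :
  (\int[expo]_x ((ln x + gamma + t) ^+ 2)%:E = (pi ^+ 2 / 6 + t ^+ 2)%:E)%E.
Proof.
have E : (fun x => (ln x + gamma + t) ^+ 2) =
    (fun x => ln x ^+ 2 + (2 * (gamma + t)) * ln x + (gamma + t) ^+ 2 * 1).
  by apply/funext => x; ring.
have t1 : tame (fun x : R => ln x ^+ 2 + (2 * (gamma + t)) * ln x).
  by apply: tameD; [exact: tame_lnX|apply: tameZ; exact: (tame_lnX 1)].
have t2 : tame (fun x : R => (gamma + t) ^+ 2 * 1) by exact: tame_cst.
rewrite ge0_integral_expo_tame; first last.
- by move=> x; exact: sqr_ge0.
- by apply: measurable_funX; apply: measurable_funD => //; apply: measurable_funD => //; exact: measurable_ln.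
- by rewrite E; exact: tameD.
rewrite E erlang_meanD// erlang_meanD//; last 2 first.
- exact: tame_lnX.
- by apply: tameZ; exact: (tame_lnX 1).
rewrite !erlang_meanZ; last 2 first.
- exact: tame_cst.
- exact: (tame_lnX 1).
rewrite erlang_mean1 erlang_mean_ln2 erlang_mean_ln.
by move: gamma (pi : R) => c p; congr (_%:E); ring.
Qed.

Definition log_abs3 : R := \int[expo]_x (`|ln x + gamma| ^+ 3).

(** The content is finiteness: [|u|^3 <= 1 + u^4], and the fourth power of [ln] is tame. *)
Lemma integral_expo_abs3 :
  (\int[expo]_x (`|ln x + gamma| ^+ 3)%:E = log_abs3%:E)%E.
Proof.
pose g (x : R) := 8 * ln x ^+ 4 + (1 + 8 * gamma ^+ 4) * 1.
have tg : tame g by apply: tameD; [apply: tameZ; exact: tame_lnX|exact: tame_cst].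
have g0 x : 0 <= g x.
  have h1 : 0 <= ln x ^+ 4 by exact: exprn_even_ge0.
  have h2 : 0 <= gamma ^+ 4 by exact: exprn_even_ge0.
  by rewrite /g; lra.
have mg : measurable_fun setT g.
  apply: measurable_funD => //; apply: measurable_funM => //.
  by apply: measurable_funX; exact: measurable_ln.
have ml3 : measurable_fun setT (fun x : measurableTypeR R => `|ln x + gamma| ^+ 3 : R).
  apply: measurable_funX; apply: measurableT_comp => //.
  exact: measurable_lnD.
rewrite /log_abs3 /Rintegral fineK// ge0_fin_numE; last first.
  by apply: integral_ge0 => x _; rewrite lee_fin exprn_ge0.
apply: (@le_lt_trans _ _ (\int[expo]_x (g x)%:E)%E); last first.
  by rewrite ge0_integral_expo_tame// ltry.
apply: ge0_le_integral => //.
- exact/measurable_EFinP.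
- by apply/measurable_EFinP => _ B mB; exact: mg.
move=> x _; rewrite lee_fin /g mulr1.
move: (ln x) gamma => a b.
have h1 : `|a + b| ^+ 3 <= 1 + (a + b) ^+ 4.
  have -> : (a + b) ^+ 4 = `|a + b| ^+ 4 by rewrite -normrX ger0_norm// exprn_even_ge0.
  have := normr_ge0 (a + b); move: `|a + b| => u u0.
  have [u1|u1] := leP u 1; first by rewrite ler_wpDr ?exprn_ge0// exprn_ile1.
  by rewrite ler_wpDl// ler_eXn2l// ltW.
apply: le_trans h1 _.
have h2 : (a + b) ^+ 4 <= 8 * a ^+ 4 + 8 * b ^+ 4.
  have e1 : (a + b) ^+ 2 <= 2 * (a ^+ 2 + b ^+ 2) by have := sqr_ge0 (a - b); nra.
  have e2 : (a ^+ 2 + b ^+ 2) ^+ 2 <= 2 * (a ^+ 4 + b ^+ 4).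
    by have := sqr_ge0 (a ^+ 2 - b ^+ 2); nra.
  rewrite (exprM _ 2 2).
  have e3 : ((a + b) ^+ 2) ^+ 2 <= (2 * (a ^+ 2 + b ^+ 2)) ^+ 2.
    by rewrite lerXn2r ?nnegrE ?sqr_ge0// mulr_ge0// addr_ge0 ?sqr_ge0.
  by apply: le_trans e3 _; rewrite exprMn; lra.
lra.
Qed.

End expo_log_moments.

Section log_residual.
Context {R : realType} d (T : measurableType d) (P : probability T R).
Variables (X : T -> R) (nu L : R).
Hypotheses (nu0 : 0 < nu) (L0 : 0 < L) (mX : measurable_fun setT X)
  (X_gt0 : P [set w | X w <= 0] = 0%E)
  (laplaceX : forall z, 0 < z ->
    (\int[P]_w (expR (- (z * X w)))%:E = (L / (L + z `^ nu))%:E)%E).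
Local Notation gamma := (@euler_gamma R).
Local Notation beta := ((pi : R) ^+ 2 / 6).

Definition log_residual w : R := ln (X w) + (gamma + ln L / nu).
Local Notation a := log_residual.

Lemma measurable_log_residual : measurable_fun setT a.
Proof.
apply: measurable_funD => //.
by apply: measurableT_comp; first exact: measurable_ln.
Qed.

Let log_ratioE z : log_ratio X nu L z = nu * (ln z.2 + gamma - a z.1).
Proof. by rewrite /log_ratio /log_residual; field; rewrite gt_eqF. Qed.

(** The exponential variable is integrated out first; its logarithm, centred by [- gamma],
    contributes its variance [beta] and no cross term. *)
Lemma integral_log_ratio_sqr c :
  (\int[P \x expo]_z ((log_ratio X nu L z + nu * c) ^+ 2)%:E =
   \int[P]_w ((nu ^+ 2 * (beta + (c - a w) ^+ 2))%:E))%E.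
Proof.
rewrite fubini_tonelli1; last 2 first.
- apply/measurable_EFinP; apply: measurable_funX; apply: measurable_funD => //.
  exact: measurable_log_ratio.
- by move=> z; rewrite lee_fin sqr_ge0.
apply: eq_integral => w _; rewrite /fubini_F /= [RHS]EFinM -integral_expo_sqr.
rewrite -ge0_integralZl//; last 3 first.
- apply/measurable_EFinP; apply: measurable_funX; apply: measurable_funD => //.
  exact: measurable_lnD.
- by move=> x _; rewrite lee_fin sqr_ge0.
- by rewrite lee_fin sqr_ge0.
by apply: eq_integral => y _; rewrite log_ratioE/= -EFinM; congr (_%:E); ring.
Qed.

Let ml : measurable_fun setT (fun z : T * measurableTypeR R => ln z.2 + gamma).
Proof.
have h : measurable_fun setT (snd : T * measurableTypeR R -> measurableTypeR R).
  exact: measurable_snd.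
exact: (measurableT_comp (measurable_lnD gamma) h).
Qed.

Let ma1 : measurable_fun setT (fun z : T * measurableTypeR R => a z.1).
Proof.
apply: (@measurableT_comp _ _ _ _ _ _ a); last exact: measurable_fst.
exact: measurable_log_residual.
Qed.

Let measurable_abs3 d' (T' : measurableType d') (f : T' -> R) :
  measurable_fun setT f -> measurable_fun setT (fun z => (`|f z| ^+ 3)%:E).
Proof.
move=> mf; apply/measurable_EFinP; apply: measurable_funX.
exact: measurableT_comp.
Qed.

Let integral_fst_abs3 : (\int[P]_w (`|a w| ^+ 3)%:E =
  \int[P \x expo]_z (`|a z.1| ^+ 3)%:E)%E.
Proof.
rewrite fubini_tonelli1; last 2 first.
- exact: measurable_abs3.
- by move=> z; rewrite lee_fin exprn_ge0.
apply: eq_integral => w _; rewrite /fubini_F /= integral_cst//.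
by rewrite [X in (_ * X)%E](_ : _ = 1%E) ?mule1//; exact: (@probability_setT _ _ _ expo).
Qed.

Let integral_snd_abs3 :
  (\int[P \x expo]_z (`|ln z.2 + gamma| ^+ 3)%:E = (log_abs3)%:E)%E.
Proof.
rewrite fubini_tonelli1; last 2 first.
- exact: measurable_abs3.
- by move=> z; rewrite lee_fin exprn_ge0.
under eq_integral do rewrite /fubini_F /= integral_expo_abs3.
rewrite integral_cst//.
by rewrite [X in (_ * X)%E](_ : _ = 1%E) ?mule1//; exact: probability_setT.
Qed.

Let integral_abs3_le (f g h : T * measurableTypeR R -> R) (k : R) : 0 <= k ->
  measurable_fun setT f -> measurable_fun setT g -> measurable_fun setT h ->
  (forall z, `|f z| <= k * (`|g z| + `|h z|)) ->
  (\int[P \x expo]_z (`|f z| ^+ 3)%:E <= (4 * k ^+ 3)%:E *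
    (\int[P \x expo]_z (`|g z| ^+ 3)%:E + \int[P \x expo]_z (`|h z| ^+ 3)%:E))%E.
Proof.
move=> k0 mf mg mh fgh.
have p0 (f' : T * measurableTypeR R -> R) z : (0 <= (`|f' z| ^+ 3)%:E)%E.
  by rewrite lee_fin exprn_ge0.
have mg3 := measurable_abs3 mg; have mh3 := measurable_abs3 mh.
rewrite -ge0_integralD// -ge0_integralZl//; first last.
- by rewrite lee_fin mulr_ge0// exprn_ge0.
- by move=> z _; rewrite adde_ge0.
- exact: emeasurable_funD.
apply: ge0_le_integral => //.
- exact: measurable_abs3.
- by apply: measurable_funeM; exact: emeasurable_funD.
move=> z _; rewrite -EFinD -EFinM lee_fin.
apply: (@le_trans _ _ ((k * (`|g z| + `|h z|)) ^+ 3)).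
  by rewrite lerXn2r ?nnegrE ?mulr_ge0 ?addr_ge0.
rewrite exprMn; have -> : 4 * k ^+ 3 * (`|g z| ^+ 3 + `|h z| ^+ 3) =
    k ^+ 3 * (4 * (`|g z| ^+ 3 + `|h z| ^+ 3)) by ring.
apply: ler_wpM2l; first exact: exprn_ge0.
move: (normr_ge0 (g z)) (normr_ge0 (h z)); move: `|g z| `|h z| => x y x0 y0.
(* [4 (x^3 + y^3) - (x + y)^3 = 3 (x + y) (x - y)^2]. *)
have : 0 <= (x + y) * (x - y) ^+ 2 by rewrite mulr_ge0 ?sqr_ge0 ?addr_ge0.
have -> : (x + y) * (x - y) ^+ 2 = x ^+ 3 + y ^+ 3 - x ^+ 2 * y - x * y ^+ 2 by ring.
have -> : (x + y) ^+ 3 = x ^+ 3 + 3 * (x ^+ 2 * y + x * y ^+ 2) + y ^+ 3 by ring.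
move=> h3; lra.
Qed.

(** The residual, the centred logarithm of the exponential and the log-ratio are linearly dependent.
    Third moments thus pass from the residual to the log-ratio, whose law is universal, and by the
    next lemma back to a residual, this time of an exponential variable. *)
Lemma integral_log_residual_abs3_le : (\int[P]_w (`|a w| ^+ 3)%:E <= 4%:E *
  ((log_abs3)%:E +
   (nu^-1 ^+ 3)%:E * \int[P \x expo]_z (`|log_ratio X nu L z| ^+ 3)%:E))%E.
Proof.
have mr := measurable_log_ratio nu L mX.
have ni : 0 <= nu^-1 by rewrite invr_ge0 ltW.
have := @integral_abs3_le (fun z => a z.1) (fun z => ln z.2 + gamma)
  (fun z => nu^-1 * log_ratio X nu L z) 1 ler01 ma1 ml (measurable_funM (measurable_cst _) mr).
rewrite integral_fst_abs3 expr1n mulr1 integral_snd_abs3.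
rewrite -ge0_integralZl//; first last.
- by rewrite lee_fin exprn_ge0.
- exact: measurable_abs3.
rewrite [X in _ -> (_ <= _ * (_ + X))%E](_ : _ =
  \int[P \x expo]_z (`|nu^-1 * log_ratio X nu L z| ^+ 3)%:E)%E; last first.
  by apply: eq_integral => z _; rewrite normrM (ger0_norm ni) exprMn EFinM.
apply => z; rewrite mul1r log_ratioE mulrA mulVf ?gt_eqF// mul1r.
move: (ln z.2 + gamma) (a z.1) => u v.
by have := ler_normB u (u - v); rewrite subKr.
Qed.

Lemma integral_log_ratio_abs3_le :
  (\int[P \x expo]_z (`|log_ratio X nu L z| ^+ 3)%:E <= (4 * nu ^+ 3)%:E *
   ((log_abs3)%:E + \int[P]_w (`|a w| ^+ 3)%:E))%E.
Proof.
have mr := measurable_log_ratio nu L mX.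
have := @integral_abs3_le (log_ratio X nu L) (fun z => ln z.2 + gamma)
  (fun z => a z.1) nu (ltW nu0) mr ml ma1.
rewrite -integral_fst_abs3 integral_snd_abs3; apply => z.
rewrite log_ratioE normrM (gtr0_norm nu0) ler_wpM2l ?(ltW nu0)//.
exact: ler_normB.
Qed.

End log_residual.

Section log_residual_moments.
Context {R : realType} d (T : measurableType d) (P : probability T R).
Variables (X : T -> R) (nu L : R).
Hypotheses (nu0 : 0 < nu) (L0 : 0 < L) (mX : measurable_fun setT X)
  (X_gt0 : P [set w | X w <= 0] = 0%E)
  (laplaceX : forall z, 0 < z ->
    (\int[P]_w (expR (- (z * X w)))%:E = (L / (L + z `^ nu))%:E)%E).
Local Notation gamma := (@euler_gamma R).
Local Notation beta := ((pi : R) ^+ 2 / 6).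
Local Notation a := (log_residual X nu L).

Let X1 : measurableTypeR R -> R := id.

Let mX1 : measurable_fun setT X1.
Proof. by move=> _ B mB; rewrite setTI. Qed.

Let log_residual1 w : log_residual X1 1 1 w = ln w + gamma.
Proof. by rewrite /log_residual ln1 mul0r addr0. Qed.

(** After the transfer to two independent exponential variables, [2 * beta] is the variance of the
    difference of their logarithms. *)
Lemma integral_log_residual_sqr c :
  (\int[P]_w ((nu ^+ 2 * (beta + (c - a w) ^+ 2))%:E) =
   (2 * beta + nu ^+ 2 * c ^+ 2)%:E)%E.
Proof.
rewrite -integral_log_ratio_sqr//.
have mg : measurable_fun setT (fun x : R => ((x + nu * c) ^+ 2)%:E).
  by apply/measurable_EFinP; apply: measurable_funX; exact: measurable_funD.
have g0 (x : R) : (0 <= ((x + nu * c) ^+ 2)%:E)%E by rewrite lee_fin sqr_ge0.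
rewrite (log_ratio_transfer nu0 L0 mX X_gt0 laplaceX mg g0).
rewrite -(mul1r (nu * c)) integral_log_ratio_sqr//.
under eq_integral do rewrite expr1n mul1r EFinD log_residual1 -(sqrrN (nu * c - _)) opprB.
rewrite ge0_integralD//; first last.
- apply/measurable_EFinP; apply: measurable_funX; apply: measurable_funD => //.
  exact: measurable_lnD.
- by move=> x _; rewrite lee_fin sqr_ge0.
- by move=> x _; rewrite lee_fin divr_ge0 ?sqr_ge0.
rewrite integral_expo_sqr integral_cst//.
rewrite [X in (_ * X + _)%E](_ : _ = 1%E); last exact: (@probability_setT _ _ _ expo).
rewrite mule1 -EFinD sqrrN exprMn; congr (_%:E).
by move: (pi : R) => p; ring.
Qed.

Let m_a : measurable_fun setT a.
Proof. exact: measurable_log_residual. Qed.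

Let integrable_beta_sqr c : P.-integrable setT (fun w => (beta + (c - a w) ^+ 2)%:E).
Proof.
have h0 w : 0 <= beta + (c - a w) ^+ 2 by rewrite addr_ge0 ?sqr_ge0// divr_ge0 ?sqr_ge0.
have mh : measurable_fun setT (fun w => (beta + (c - a w) ^+ 2)%:E).
  apply/measurable_EFinP; apply: measurable_funD => //; apply: measurable_funX.
  exact: measurable_funB.
apply/integrableP; split => //.
under eq_integral do rewrite gee0_abs ?lee_fin//.
have n2 : 0 < nu ^+ 2 by rewrite exprn_gt0.
have : (\int[P]_w ((nu ^+ 2)%:E * (beta + (c - a w) ^+ 2)%:E) =
    (2 * beta + nu ^+ 2 * c ^+ 2)%:E)%E.
  by rewrite -integral_log_residual_sqr; apply: eq_integral => w _; rewrite EFinM.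
rewrite ge0_integralZl//; last 2 first.
- by move=> w _; rewrite lee_fin.
- by rewrite lee_fin ltW.
move: (\int[P]_w _)%E => [r| |]//; first by rewrite ltry.
by rewrite gt0_muley ?lte_fin.
Qed.

Lemma integrable_log_residual_sqr : P.-integrable setT (fun w => (a w ^+ 2)%:E).
Proof.
apply: le_integrable (integrable_beta_sqr 0) => //.
  by apply/measurable_EFinP; exact: measurable_funX.
move=> w _; rewrite lee_fin sub0r sqrrN !ger0_norm ?sqr_ge0//; last first.
  by rewrite addr_ge0 ?sqr_ge0// divr_ge0 ?sqr_ge0.
by rewrite lerDr divr_ge0 ?sqr_ge0.
Qed.

Lemma integrable_log_residual : P.-integrable setT (EFin \o a).
Proof.
have i1 : P.-integrable setT (fun w => (1 + a w ^+ 2)%:E).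
  rewrite (_ : (fun _ => _) = (fun w => (cst 1 w)%:E + (a w ^+ 2)%:E)%E).
    apply: integrableD => //; last exact: integrable_log_residual_sqr.
    by apply: (@bounded_integrable _ _ _ P (cst 1) 1) => // x; rewrite normr1.
  by apply/funext => w; rewrite EFinD.
apply: le_integrable i1 => //; first exact/measurable_EFinP.
move=> w _ /=; rewrite lee_fin (ger0_norm (_ : 0 <= 1 + a w ^+ 2)); last first.
  by rewrite addr_ge0 ?sqr_ge0.
have := sqr_ge0 (`|a w| - 1); rewrite -(real_normK (num_real (a w))).
by move: `|a w| => u; nra.
Qed.

Let integrable_sqrB c : P.-integrable setT (fun w => ((c - a w) ^+ 2)%:E).
Proof.
apply: le_integrable (integrable_beta_sqr c) => //.
  by apply/measurable_EFinP; apply: measurable_funX; exact: measurable_funB.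
move=> w _; rewrite lee_fin !ger0_norm ?sqr_ge0//; last first.
  by rewrite addr_ge0 ?sqr_ge0// divr_ge0 ?sqr_ge0.
by rewrite lerDr divr_ge0 ?sqr_ge0.
Qed.

Let integral_sqrB c : \int[P]_w ((c - a w) ^+ 2) = 2 * beta / nu ^+ 2 + c ^+ 2 - beta.
Proof.
have i0 := integrable_beta_sqr c.
have n2 : nu ^+ 2 != 0 by rewrite expf_neq0// gt_eqF.
have I : \int[P]_w (beta + (c - a w) ^+ 2) = 2 * beta / nu ^+ 2 + c ^+ 2.
  have : ((nu ^+ 2)%:E * (\int[P]_w (beta + (c - a w) ^+ 2))%:E =
      (2 * beta + nu ^+ 2 * c ^+ 2)%:E)%E.
    rewrite /Rintegral fineK; last exact: (integral_fune_fin_num _ i0).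
    rewrite -integralZl// -integral_log_residual_sqr.
    by apply: eq_integral => w _; rewrite EFinM.
  rewrite -EFinM => -[] /(congr1 (fun x => x / nu ^+ 2)).
  rewrite mulrAC mulfV// mul1r => ->.
  by move: (pi : R) => p; field; rewrite gt_eqF.
have ib : P.-integrable setT (EFin \o cst (- beta) : T -> \bar R).
  exact: (@bounded_integrable _ _ _ P (cst (- beta)) `|- beta|).
rewrite -I -[in RHS](Rintegral_prob_cst P (- beta)) -RintegralD//.
by apply: eq_Rintegral => w _ /=; rewrite addrAC subrr add0r.
Qed.

(** By [integral_sqrB] the second moments about 1 and about 0 differ by exactly 1, while expanding
    the square makes the difference 1 minus twice the mean. *)
Lemma log_residual_mean : \int[P]_w a w = 0.
Proof.
have i2 : P.-integrable setT (EFin \o (fun w => 2 * a w)).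
  rewrite (_ : EFin \o _ = (fun w => 2%:E * (a w)%:E)%E); last by apply/funext.
  by apply: integrableZl => //; exact: integrable_log_residual.
have i1 : P.-integrable setT (EFin \o cst 1 : T -> \bar R).
  by apply: (@bounded_integrable _ _ _ P (cst 1) 1) => // x; rewrite normr1.
have : \int[P]_w ((1 - a w) ^+ 2) = \int[P]_w (((0 - a w) ^+ 2 + 1) - 2 * a w).
  by apply: eq_Rintegral => w _; ring.
have i01 : P.-integrable setT (EFin \o (fun w => (0 - a w) ^+ 2 + 1)).
  rewrite (_ : EFin \o _ = (fun w => ((0 - a w) ^+ 2)%:E + 1%:E)%E); last by apply/funext.
  by apply: integrableD => //; exact: integrable_sqrB.
rewrite RintegralB// RintegralD//; last exact: integrable_sqrB.
rewrite (Rintegral_prob_cst P 1) !integral_sqrB RintegralZl//; last exact: integrable_log_residual.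
by move: (pi : R) => p; lra.
Qed.

Lemma log_residual_variance : \int[P]_w (a w ^+ 2) = sigma2_eps nu.
Proof.
have -> : \int[P]_w (a w ^+ 2) = \int[P]_w ((0 - a w) ^+ 2).
  by apply: eq_Rintegral => w _; rewrite sub0r sqrrN.
rewrite integral_sqrB /sigma2_eps; move: (pi : R) => p; field.
by rewrite gt_eqF.
Qed.

(** The bound does not involve [L], so it is the same for all birth times. Its constant is
    [4 (1 + 8 / nu^3)] times [log_abs3], with 8 from [4 (1 + 1)] in the exponential case. *)
Lemma log_residual_abs3 :
  (\int[P]_w (`|a w| ^+ 3)%:E <= (32 / nu ^+ 3 * log_abs3 + 4 * log_abs3)%:E)%E.
Proof.
apply: le_trans (integral_log_residual_abs3_le P L nu0 mX) _.
have mg : measurable_fun setT (fun x : R => (`|x| ^+ 3)%:E).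
  by apply/measurable_EFinP; apply: measurable_funX; exact: normr_measurable.
have g0 (x : R) : (0 <= (`|x| ^+ 3)%:E)%E by rewrite lee_fin exprn_ge0.
rewrite (log_ratio_transfer nu0 L0 mX X_gt0 laplaceX mg g0).
have h : (\int[expo \x expo]_z (`|log_ratio X1 1 1 z| ^+ 3)%:E <= (8 * log_abs3)%:E)%E.
  apply: (le_trans (integral_log_ratio_abs3_le _ 1 ltr01 mX1)).
  under [X in (_ * (_ + X))%E]eq_integral do rewrite log_residual1.
  by rewrite integral_expo_abs3 -EFinD -EFinM lee_fin expr1n; lra.
have ni : 0 <= nu^-1 ^+ 3 by rewrite exprn_ge0// invr_ge0 ltW.
apply: (@le_trans _ _ (4%:E * (log_abs3%:E + (nu^-1 ^+ 3)%:E * (8 * log_abs3)%:E))%E).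
  by rewrite lee_wpmul2l// leeD2l// lee_wpmul2l.
rewrite [leLHS](_ : _ = (4 * (log_abs3 + nu^-1 ^+ 3 * (8 * log_abs3)))%:E)//.
by rewrite lee_fin exprVn; lra.
Qed.

End log_residual_moments.

(** * A quantitative central limit theorem *)

Section bounded_expectation.
Context d (T : measurableType d) (R : realType).
Implicit Types f g : T -> R.

Definition bounded_mfun f :=
  measurable_fun setT f /\ exists M : R, forall x, `|f x| <= M.

Lemma bounded_mfun_cst c : bounded_mfun (cst c).
Proof. by split => //; exists `|c|. Qed.

Lemma bounded_mfunD f g : bounded_mfun f -> bounded_mfun g ->
  bounded_mfun (fun x => f x + g x).
Proof.
move=> [mf [M fM]] [mg [N gN]]; split; first exact: measurable_funD.
by exists (M + N) => x; rewrite (le_trans (ler_normD _ _))// lerD.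
Qed.

Lemma bounded_mfunB f g : bounded_mfun f -> bounded_mfun g ->
  bounded_mfun (fun x => f x - g x).
Proof.
move=> [mf [M fM]] [mg [N gN]]; split; first exact: measurable_funB.
by exists (M + N) => x; rewrite (le_trans (ler_normB _ _))// lerD.
Qed.

Lemma bounded_mfunM f g : bounded_mfun f -> bounded_mfun g ->
  bounded_mfun (fun x => f x * g x).
Proof.
move=> [mf [M fM]] [mg [N gN]]; split; first exact: measurable_funM.
by exists (M * N) => x; rewrite normrM ler_pM.
Qed.

Lemma bounded_mfun_indic (A : set T) : measurable A -> bounded_mfun (\1_A : T -> R).
Proof.
move=> mA; split; first exact: measurable_indic.
by exists 1 => x; rewrite indicE; case: (_ \in _); rewrite ?normr1// normr0.
Qed.

Lemma bounded_mfun_comp d' (T' : measurableType d') (f : T' -> T) (g : T -> R) :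
  measurable_fun setT f -> bounded_mfun g -> measurable_fun setT (g \o f) /\
  exists M : R, forall x, `|g (f x)| <= M.
Proof.
move=> mf [mg [M gM]]; split; first exact: measurableT_comp.
by exists M => x.
Qed.

Variable P : probability T R.

Lemma integrable_bounded_mfun f : bounded_mfun f -> P.-integrable setT (EFin \o f).
Proof. by move=> [mf [M fM]]; exact: bounded_integrable fM. Qed.

Lemma mean_bD f g : bounded_mfun f -> bounded_mfun g ->
  \int[P]_x (f x + g x) = \int[P]_x f x + \int[P]_x g x.
Proof. by move=> bf bg; rewrite RintegralD//; exact: integrable_bounded_mfun. Qed.

Lemma mean_bZ c f : bounded_mfun f -> \int[P]_x (c * f x) = c * \int[P]_x f x.
Proof. by move=> bf; rewrite RintegralZl//; exact: integrable_bounded_mfun. Qed.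

Lemma mean_bB f g : bounded_mfun f -> bounded_mfun g ->
  \int[P]_x (f x - g x) = \int[P]_x f x - \int[P]_x g x.
Proof. by move=> bf bg; rewrite RintegralB//; exact: integrable_bounded_mfun. Qed.

Lemma EFin_mean f : bounded_mfun f ->
  (\int[P]_x (f x)%:E = (\int[P]_x f x)%R%:E)%E.
Proof.
move=> /integrable_bounded_mfun i; rewrite /Rintegral fineK//.
exact: (integral_fune_fin_num _ i).
Qed.

Lemma mean_indic (A : set T) : measurable A -> \int[P]_x (\1_A x : R) = fine (P A).
Proof. by move=> mA; rewrite /Rintegral integral_indic// setIT. Qed.

Lemma norm_mean_le f (M : R) : bounded_mfun f -> (forall x, `|f x| <= M) ->
  `|\int[P]_x f x| <= M.
Proof. by move=> [mf _] fM; exact: norm_Rintegral_bounded. Qed.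

End bounded_expectation.
Arguments bounded_mfun_cst {d T R} c.

(** * Product expectations from independence of events *)

Section layer_cake.
Context d (T : measurableType d) (R : realType) (P : probability T R).
Notation leb := (@lebesgue_measure R).

(* Layer cake: [g = \int 1_(0 < t < g) dt] reduces a product expectation to
   superlevel sets. *)
Lemma integral_layer_cake (F g : T -> R) (C : R) :
  measurable_fun setT F -> measurable_fun setT g ->
  (forall x, 0 <= F x) -> (forall x, 0 <= g x) -> 0 <= C ->
  (forall t, (\int[P]_x (F x * \1_[set x | t < g x] x)%:E =
     C%:E * P [set x | (t < g x)%R])%E) ->
  (\int[P]_x (F x * g x)%:E = C%:E * \int[P]_x (g x)%:E)%E.
Proof.
move=> mF mg F0 g0 C0 H.
pose A : set (T * measurableTypeR R) := [set z | 0 < z.2 < g z.1].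
have m2 : measurable_fun setT (fun z : T * measurableTypeR R => z.2 : R).
  have h : measurable_fun setT (snd : T * measurableTypeR R -> measurableTypeR R).
    exact: measurable_snd.
  by move=> _ B mB; exact: h.
have m1 (f : T -> R) : measurable_fun setT f ->
    measurable_fun setT (fun z : T * measurableTypeR R => f z.1).
  by move=> mf; apply: measurableT_comp => //; exact: measurable_fst.
have mA : measurable A.
  rewrite (_ : A = (fun z : T * measurableTypeR R => z.2 : R) @^-1` `]0, +oo[%classic `&`
      (fun z : T * measurableTypeR R => g z.1 - z.2) @^-1` `]0, +oo[%classic); last first.
    by apply/seteqP; split => z /=; rewrite /A/= !in_itv/= !andbT subr_gt0;
      [move=> /andP[]|move=> [-> ->]].
  apply: measurableI; rewrite -[X in measurable X]setTI; first exact: m2.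
  by apply: measurable_funB => //; exact: m1.
have mh (f : T -> R) : measurable_fun setT f ->
    measurable_fun setT (fun z : T * measurableTypeR R => (f z.1 * \1_A z)%:E).
  move=> mf; apply/measurable_EFinP; apply: measurable_funM; first exact: m1.
  exact: measurable_indic.
have h0 (f : T -> R) : (forall x, 0 <= f x) ->
    forall z : T * measurableTypeR R, (0 <= (f z.1 * \1_A z)%:E)%E.
  by move=> f0 z; rewrite lee_fin mulr_ge0.
have J (f : T -> R) : measurable_fun setT f -> (forall x, 0 <= f x) ->
    (\int[P]_x (f x * g x)%:E = \int[leb]_t \int[P]_x (f x * \1_A (x, t))%:E)%E.
  move=> mf f0.
  rewrite -(@fubini_tonelli _ _ _ _ _ P leb _ (mh _ mf) (h0 _ f0)); apply: eq_integral => x _.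
  rewrite /fubini_F /=; under eq_integral do rewrite EFinM.
  rewrite ge0_integralZl//; last 2 first.
  - apply/measurable_EFinP.
    rewrite (_ : (fun _ => _) = \1_(xsection A x)); last first.
      by apply/funext => t; rewrite !indicE mem_xsection.
    by apply: measurable_indic; exact: measurable_xsection.
  - by rewrite lee_fin.
  rewrite EFinM; congr (_ * _)%E.
  rewrite (_ : (fun _ => _) = fun t => (\1_(`]0, g x[%classic : set R) t)%:E); last first.
    apply/funext => t; rewrite !indicE (_ : ((x, t) \in A) = (t \in `]0, g x[%classic))//.
  rewrite integral_indic// setIT [RHS](_ : _ = leb `]0, g x[%classic)//.
  rewrite lebesgue_measure_itv/= lte_fin.
  by have [gx|gx] := ltP 0 (g x); [rewrite sube0|have := g0 x;
    have -> : g x = 0 by apply/eqP; rewrite eq_le gx g0].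
rewrite J//.
have := @J (cst 1) (measurable_cst _) (fun=> ler01); under eq_integral do rewrite mul1r.
move=> ->; rewrite -ge0_integralZl//; last 2 first.
- have mG := @measurable_fun_fubini_tonelli_G _ _ T (measurableTypeR R) R P _
    (mh (cst 1) (measurable_cst _)) (h0 (cst 1) (fun=> ler01)).
  by move=> _ B mB; exact: mG.
- by move=> t _; apply: integral_ge0 => x _; rewrite lee_fin mulr_ge0.
apply: eq_integral => t _.
have [t0|t0] := ltP 0 t.
  have E x : \1_A (x, t) = \1_[set x | t < g x] x :> R.
    rewrite !indicE (_ : ((x, t) \in A) = (x \in [set x | t < g x]))//.
    by apply/idP/idP; rewrite !inE/= /A/= t0.
  under eq_integral do rewrite E.
  rewrite H; congr (_ * _)%E; under eq_integral do rewrite E mul1r.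
  rewrite integral_indic ?setIT// -[X in measurable X]setTI.
  rewrite (_ : mkset _ = g @^-1` `]t, +oo[%classic); first exact: mg.
  by apply/seteqP; split => y /=; rewrite in_itv/= andbT.
have E x : \1_A (x, t) = 0 :> R.
  by rewrite indicE memNset// /A/= ltNge t0.
by rewrite !integral0_eq ?mule0// => x _; rewrite E mulr0.
Qed.

End layer_cake.

Section independent_sequence.
Context d (T : measurableType d) (R : realType) (P : probability T R).
Variable e : nat -> T -> R.
Hypothesis me : forall i, (0 < i)%N -> measurable_fun setT (e i).
Let event (J : seq nat) (B : nat -> set R) := \bigcap_(i in [set` J]) (e i @^-1` B i).
Hypothesis indep : forall (J : seq nat) (B : nat -> set R),
  uniq J -> (forall i, i \in J -> (0 < i)%N) -> (forall i, measurable (B i)) ->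
  P (event J B) = (\prod_(i <- J) P (e i @^-1` B i))%E.

Let measurable_event J B : (forall i, i \in J -> (0 < i)%N) ->
  (forall i, measurable (B i)) -> measurable (event J B).
Proof.
move=> J0 mB; apply: fin_bigcap_measurable => [|i /= iJ]; first exact: finite_seq.
by rewrite -[X in measurable X]setTI; apply: me => //; exact: J0.
Qed.

(* [F] is uncorrelated with every event on the variables beyond index [k]. *)
Definition indep_of_tail k (F : T -> R) := bounded_mfun F /\
  forall (J : seq nat) (B : nat -> set R),
  uniq J -> (forall i, i \in J -> (k < i)%N) -> (forall i, measurable (B i)) ->
  \int[P]_w (F w * \1_(event J B) w) = \int[P]_w F w * fine (P (event J B)).

Lemma indep_of_tail_cst k c : indep_of_tail k (cst c).
Proof.
split; first exact: bounded_mfun_cst.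
move=> J B uJ J0 mB; have mE : measurable (event J B).
  by apply: measurable_event => // i /J0; exact: leq_ltn_trans.
rewrite mean_bZ; last exact: bounded_mfun_indic.
by rewrite mean_indic// Rintegral_prob_cst.
Qed.

Lemma indep_of_tailD k F G : indep_of_tail k F -> indep_of_tail k G ->
  indep_of_tail k (fun w => F w + G w).
Proof.
move=> [bF iF] [bG iG]; split; first exact: bounded_mfunD.
move=> J B uJ J0 mB; have mE : measurable (event J B).
  by apply: measurable_event => // i /J0; exact: leq_ltn_trans.
have bE : bounded_mfun (\1_(event J B) : T -> R) by exact: bounded_mfun_indic.
under eq_Rintegral do rewrite mulrDl.
rewrite (mean_bD P (bounded_mfunM bF bE) (bounded_mfunM bG bE)).
by rewrite iF// iG// mean_bD// mulrDl.
Qed.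

Lemma indep_of_tailZ k c F : indep_of_tail k F -> indep_of_tail k (fun w => c * F w).
Proof.
move=> [bF iF]; split; first by apply: bounded_mfunM => //; exact: bounded_mfun_cst.
move=> J B uJ J0 mB; have mE : measurable (event J B).
  by apply: measurable_event => // i /J0; exact: leq_ltn_trans.
have bE : bounded_mfun (\1_(event J B) : T -> R) by exact: bounded_mfun_indic.
under eq_Rintegral do rewrite -mulrA.
rewrite mean_bZ; last exact: bounded_mfunM.
by rewrite iF// mean_bZ// mulrA.
Qed.

(** The layer cake replaces [g (e k.+1)] by indicators of its superlevel sets, for which the claim
    is about events only. *)
Let indep_ge0 k F (g : R -> R) J B : indep_of_tail k F -> (forall w, 0 <= F w) ->
  bounded_mfun g -> (forall x, 0 <= g x) ->
  uniq J -> (forall i, i \in J -> (k.+1 < i)%N) -> (forall i, measurable (B i)) ->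
  \int[P]_w (F w * g (e k.+1 w) * \1_(event J B) w) =
  \int[P]_w F w * \int[P]_w g (e k.+1 w) * fine (P (event J B)).
Proof.
move=> [bF iF] F0 bg g0 uJ J0 mB.
have mE : measurable (event J B).
  by apply: measurable_event => // i /J0; exact: leq_ltn_trans.
have bE : bounded_mfun (\1_(event J B) : T -> R) by exact: bounded_mfun_indic.
have bge : bounded_mfun (fun w => g (e k.+1 w)).
  exact: (@bounded_mfun_comp _ _ _ _ _ (e k.+1) g (me (ltn0Sn k)) bg).
have bFE := bounded_mfunM bF bE.
pose C := \int[P]_w F w * fine (P (event J B)).
have C0 : 0 <= C by apply: mulr_ge0; [exact: Rintegral_ge0|exact: fine_ge0].
have H t : (\int[P]_x (F x * \1_(event J B) x * \1_[set x | t < g (e k.+1 x)] x)%:E =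
     C%:E * P [set x | (t < g (e k.+1 x))%R])%E.
  pose S : set R := [set x | t < g x].
  have mS : measurable S.
    rewrite (_ : S = g @^-1` `]t, +oo[%classic).
      by rewrite -[X in measurable X]setTI; exact: bg.1.
    by apply/seteqP; split => y /=; rewrite in_itv/= andbT.
  (* A superlevel set of [g (e k.+1)] is one more event of the family: adjoining [k.+1] to [J] keeps
     all indices beyond [k], so the hypothesis on [F] applies. *)
  pose B' i := if i == k.+1 then S else B i.
  have kJ : k.+1 \notin J by apply/negP => /J0; rewrite ltnn.
  have uJ' : uniq (k.+1 :: J) by rewrite /= kJ.
  have mB' i : measurable (B' i) by rewrite /B'; case: ifPn.
  have EB : event J B' = event J B.
    apply: eq_bigcapr => i /= iJ; rewrite /B' ifN//.
    by apply: contraNneq kJ => <-.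
  have E' : event (k.+1 :: J) B' = event J B `&` [set x | t < g (e k.+1 x)].
    rewrite -EB; apply/seteqP; split => w.
      move=> h; split; last by have := h k.+1; rewrite /= /B' eqxx; apply; rewrite inE eqxx.
      by move=> i /= iJ; apply: h => /=; rewrite inE iJ orbT.
    move=> [h1 h2] i /=; rewrite inE => /orP[/eqP->|iJ]; last exact: h1.
    by rewrite /B' eqxx.
  have PE : P (event (k.+1 :: J) B') = (P (event J B) * P [set x | (t < g (e k.+1 x))%R])%E.
    rewrite indep//; last by move=> i; rewrite inE => /orP[/eqP->//|/J0]; exact: leq_ltn_trans.
    rewrite big_cons -indep//; last by move=> i /J0; exact: leq_ltn_trans.
    by rewrite EB muleC; congr (_ * P _)%E; rewrite /B' eqxx.
  have := iF (k.+1 :: J) B' uJ' _ mB'.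
  have J1 i : i \in k.+1 :: J -> (k < i)%N.
    by rewrite inE => /orP[/eqP->//|/J0]; exact: ltnW.
  have mE' : measurable (event (k.+1 :: J) B').
    by apply: measurable_event => // i /J1; exact: leq_ltn_trans.
  have bE' : bounded_mfun (\1_(event (k.+1 :: J) B') : T -> R) by exact: bounded_mfun_indic.
  move=> /(_ J1) h.
  transitivity (\int[P]_w (F w * \1_(event (k.+1 :: J) B') w)%:E)%E.
    by apply: eq_integral => w _; rewrite E' indicI mulrA.
  rewrite EFin_mean ?h; last exact: bounded_mfunM.
  rewrite PE fineM ?fin_num_measure//; last first.
    rewrite (_ : mkset _ = e k.+1 @^-1` S)//.
    by rewrite -[X in measurable X]setTI; exact: me.
  rewrite mulrA EFinM fineK// fin_num_measure//.
  rewrite (_ : mkset _ = e k.+1 @^-1` S)//.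
  by rewrite -[X in measurable X]setTI; exact: me.
have F1 w : 0 <= F w * \1_(event J B) w by rewrite mulr_ge0.
have := @integral_layer_cake _ _ _ P (fun w => F w * \1_(event J B) w)
  (fun w => g (e k.+1 w)) C bFE.1 bge.1 F1 (fun w => g0 _) C0 H.
rewrite (EFin_mean P (bounded_mfunM bFE bge)) (EFin_mean P bge) -EFinM => -[].
under eq_Rintegral do rewrite mulrAC.
by move=> ->; rewrite /C mulrAC.
Qed.

Let bge k (g : R -> R) : bounded_mfun g -> bounded_mfun (fun w => g (e k.+1 w)).
Proof.
move=> bg; exact: (@bounded_mfun_comp _ _ _ _ _ (e k.+1) g (me (ltn0Sn k)) bg).
Qed.

(** Both sides are bilinear in [F] and [g], and constants are covered; adding the bounds [M] and [N]
    reduces to nonnegative functions. *)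
Let indep_factor k F (g : R -> R) J B : indep_of_tail k F -> bounded_mfun g ->
  uniq J -> (forall i, i \in J -> (k.+1 < i)%N) -> (forall i, measurable (B i)) ->
  \int[P]_w (F w * g (e k.+1 w) * \1_(event J B) w) =
  \int[P]_w F w * \int[P]_w g (e k.+1 w) * fine (P (event J B)).
Proof.
move=> iF bg uJ J0 mB; have bF := iF.1.
have mE : measurable (event J B).
  by apply: measurable_event => // i /J0; exact: leq_ltn_trans.
have bE : bounded_mfun (\1_(event J B) : T -> R) by exact: bounded_mfun_indic.
have [_ [M FM]] := bF; have [_ [N gN]] := bg.
have N0 : 0 <= N by rewrite (le_trans _ (gN 0)).
wlog M0 : M FM / 0 <= M.
  by move=> h; apply: (h `|M|) => // x; rewrite (le_trans (FM x)) ?ler_norm.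
have h1 G : indep_of_tail k G -> (forall w, 0 <= G w) ->
  \int[P]_w (G w * g (e k.+1 w) * \1_(event J B) w) =
  \int[P]_w G w * \int[P]_w g (e k.+1 w) * fine (P (event J B)).
  move=> iG G0; have bG := iG.1.
  have bg' : bounded_mfun (fun x => g x + N).
    by apply: bounded_mfunD => //; exact: bounded_mfun_cst.
  have g'0 x : 0 <= g x + N.
    by have := gN x; rewrite ler_norml => /andP[h _]; rewrite -lerBlDr sub0r.
  have A1 := indep_ge0 iG G0 bg' g'0 uJ J0 mB.
  have A2 := indep_ge0 iG G0 (bounded_mfun_cst N) (fun=> N0) uJ J0 mB.
  move: A1; rewrite (mean_bD P (bge k bg) (bounded_mfun_cst N)).
  under eq_Rintegral do rewrite mulrDr mulrDl.
  rewrite mean_bD; last 2 first.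
  - by apply: bounded_mfunM => //; apply: bounded_mfunM => //; exact: bge.
  - by apply: bounded_mfunM => //; apply: bounded_mfunM => //; exact: bounded_mfun_cst.
  by rewrite A2 mulrDr mulrDl => /addIr.
have iF' : indep_of_tail k (fun w => F w + M).
  by apply: indep_of_tailD => //; exact: indep_of_tail_cst.
have F'0 x : 0 <= F x + M.
  by have := FM x; rewrite ler_norml => /andP[h _]; rewrite -lerBlDr sub0r.
have A2 := h1 _ (indep_of_tail_cst k M) (fun=> M0).
have := h1 _ iF' F'0; rewrite (mean_bD P bF (bounded_mfun_cst M)).
under eq_Rintegral do rewrite !mulrDl.
rewrite mean_bD; last 2 first.
- by apply: bounded_mfunM => //; apply: bounded_mfunM => //; exact: bge.
- apply: bounded_mfunM => //; apply: bounded_mfunM; last exact: bge.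
  exact: bounded_mfun_cst.
by rewrite A2 !mulrDl => /addIr.
Qed.

(** The induction step along the sequence: a factor in [e k.+1] is absorbed and the tail starts one
    index later. The empty family [J] gives the product formula for means. *)
Lemma indep_of_tailM k F (g : R -> R) : indep_of_tail k F -> bounded_mfun g ->
  indep_of_tail k.+1 (fun w => F w * g (e k.+1 w)) /\
  \int[P]_w (F w * g (e k.+1 w)) = \int[P]_w F w * \int[P]_w g (e k.+1 w).
Proof.
move=> iF bg.
have E : \int[P]_w (F w * g (e k.+1 w)) = \int[P]_w F w * \int[P]_w g (e k.+1 w).
  have := @indep_factor k F g [::] (fun=> setT) iF bg isT _ _.
  have -> : event [::] (fun=> setT) = setT by apply/seteqP; split.
  rewrite [X in fine X](_ : _ = 1%E); last exact: probability_setT.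
  rewrite mulr1 => <-//.
  by apply: eq_Rintegral => w _; rewrite indicT mulr1.
split => //; split.
  by apply: bounded_mfunM; [exact: iF.1|exact: bge].
by move=> J B uJ J0 mB; rewrite indep_factor// E.
Qed.

End independent_sequence.

Section trigonometric_bounds.
Context {R : realType}.
Implicit Types x c : R.

Lemma bounded_mfun_cosM c : bounded_mfun (fun x : R => cos (c * x)).
Proof.
split; last by exists 1 => w; rewrite ler_norml cos_geN1 cos_le1.
apply: measurableT_comp; last exact: measurable_funM.
exact: (continuous_measurable_fun (@continuous_cos R)).
Qed.

Lemma bounded_mfun_sinM c : bounded_mfun (fun x : R => sin (c * x)).
Proof.
split; last by exists 1 => w; rewrite ler_norml sin_geN1 sin_le1.
apply: measurableT_comp; last exact: measurable_funM.
exact: (continuous_measurable_fun (@continuous_sin R)).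
Qed.

Lemma norm_onem_expRN_le x : 0 <= x -> `|1 - x - expR (- x)| <= x ^+ 2 / 2.
Proof.
move=> x0; have h1 : 1 - x <= expR (- x) by exact: expR_ge1Dx.
rewrite ler0_norm; last by lra.
rewrite -subr_ge0.
have := @ge0_derive_le R (fun y => 2^-1 * y ^+ 2 + (1 - y) - expR (- y))
  (fun y => y - 1 + expR (- y)) x _ _ x0.
rewrite expr0n mulr0 add0r subr0 oppr0 expR0 subrr => h.
rewrite (_ : _ - _ = 2^-1 * x ^+ 2 + (1 - x) - expR (- x)); last by field.
apply: h => [y|y _].
  by apply: is_derive_eq; rewrite /GRing.scale/=; field.
by have := expR_ge1Dx (- y); lra.
Qed.

(** One telescoping step in real numbers: [X], [Y] are the means of cosine and sine for the first
    terms, [C], [S] those of the new term, [D] the previous Gaussian value and [ex] its new factor.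
    The constant is [K / 6 + K / 6] from the Taylor remainders plus [s2^2 / 8] from [exp], where
    [t <= 1] turns [t^4] into [t^3]. *)
Lemma mean_cos_clt_step (X Y C S D ex x t K s2 W : R) :
  0 <= t <= 1 -> x = t ^+ 2 * s2 / 2 -> `|1 - x - ex| <= x ^+ 2 / 2 -> 0 <= ex <= 1 ->
  `|X| <= 1 -> `|Y| <= 1 -> `|C - (1 - x)| <= t ^+ 3 * K / 6 -> `|S| <= t ^+ 3 * K / 6 ->
  `|X - D| <= (K / 3 + s2 ^+ 2 / 8) * W ->
  `|X * C - Y * S - ex * D| <= (K / 3 + s2 ^+ 2 / 8) * (W + t ^+ 3).
Proof.
move=> /andP[t0 t1] xE hx /andP[ex0 ex1] hX hY hC hS hD.
have -> : X * C - Y * S - ex * D =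
  X * (C - (1 - x)) + X * (1 - x - ex) + ex * (X - D) - Y * S by ring.
have m (a b u v : R) : `|a| <= u -> `|b| <= v -> `|a * b| <= u * v.
  by move=> h1 h2; rewrite normrM ler_pM.
have h1 := m _ _ _ _ hX hC; have h2 := m _ _ _ _ hX hx.
have h3 : `|ex * (X - D)| <= 1 * ((K / 3 + s2 ^+ 2 / 8) * W) by apply: m => //; rewrite ger0_norm.
have h4 := m _ _ _ _ hY hS.
have h5 : x ^+ 2 / 2 <= s2 ^+ 2 / 8 * t ^+ 3.
  have -> : x ^+ 2 / 2 = s2 ^+ 2 / 8 * t ^+ 4 by rewrite xE; field.
  apply: ler_wpM2l; first by rewrite divr_ge0 ?sqr_ge0.
  by rewrite exprS ler_piMl ?exprn_ge0.
have := ler_normB (X * (C - (1 - x)) + X * (1 - x - ex) + ex * (X - D)) (Y * S).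
have := ler_normD (X * (C - (1 - x)) + X * (1 - x - ex)) (ex * (X - D)).
have := ler_normD (X * (C - (1 - x))) (X * (1 - x - ex)).
have -> : (K / 3 + s2 ^+ 2 / 8) * (W + t ^+ 3) =
  (K / 3 + s2 ^+ 2 / 8) * W + t ^+ 3 * K / 3 + s2 ^+ 2 / 8 * t ^+ 3 by ring.
lra.
Qed.

End trigonometric_bounds.

Section trigonometric_clt.
Context d (T : measurableType d) (R : realType) (P : probability T R).
Variable e : nat -> T -> R.
Hypothesis me : forall i, (0 < i)%N -> measurable_fun setT (e i).
Hypothesis indep : forall (J : seq nat) (B : nat -> set R),
  uniq J -> (forall i, i \in J -> (0 < i)%N) -> (forall i, measurable (B i)) ->
  P (\bigcap_(i in [set` J]) (e i @^-1` B i)) = (\prod_(i <- J) P (e i @^-1` B i))%E.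
Variables (s2 K : R).
Hypothesis s2_ge0 : 0 <= s2.
Hypothesis ie : forall i, (0 < i)%N -> P.-integrable setT (EFin \o e i).
Hypothesis ie2 : forall i, (0 < i)%N -> P.-integrable setT (fun w => (e i w ^+ 2)%:E).
Hypothesis e_mean : forall i, (0 < i)%N -> \int[P]_w e i w = 0.
Hypothesis e_var : forall i, (0 < i)%N -> \int[P]_w (e i w ^+ 2) = s2.
Hypothesis e_abs3 : forall i, (0 < i)%N -> (\int[P]_w (`|e i w| ^+ 3)%:E <= K%:E)%E.

Lemma norm_mean_le_mean (h u : T -> R) : P.-integrable setT (EFin \o h) ->
  P.-integrable setT (EFin \o u) -> (forall w, `|h w| <= u w) ->
  `|\int[P]_w h w| <= \int[P]_w u w.
Proof.
move=> ih iu hu; apply: le_trans (le_normr_Rintegral _ ih) _ => //.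
apply: le_Rintegral => //.
exact: integrable_norm.
Qed.

Let ie3 i : (0 < i)%N -> P.-integrable setT (fun w => (`|e i w| ^+ 3)%:E).
Proof.
move=> i0; apply/integrableP; split.
  apply/measurable_EFinP; apply: measurable_funX.
  by apply: measurableT_comp => //; exact: me.
under eq_integral do rewrite gee0_abs ?lee_fin ?exprn_ge0//.
by rewrite (le_lt_trans (e_abs3 i0))// ltry.
Qed.

Let mean_e3 i a : (0 < i)%N -> \int[P]_w (`|a * e i w| ^+ 3 / 6) <= `|a| ^+ 3 * K / 6.
Proof.
move=> i0; have E : \int[P]_w (`|a * e i w| ^+ 3 / 6) =
    (`|a| ^+ 3 / 6) * \int[P]_w (`|e i w| ^+ 3).
  rewrite -RintegralZl//; last exact: ie3.
  by apply: eq_Rintegral => w _; rewrite normrM exprMn mulrAC.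
rewrite E (_ : `|a| ^+ 3 * K / 6 = `|a| ^+ 3 / 6 * K); last by ring.
apply: ler_wpM2l; first by rewrite divr_ge0 ?exprn_ge0.
have i3 := ie3 i0.
rewrite -lee_fin /Rintegral fineK; first exact: e_abs3.
exact: (integral_fune_fin_num _ i3).
Qed.

Let integrable_e3 i a : (0 < i)%N -> P.-integrable setT (fun w => (`|a * e i w| ^+ 3 / 6)%:E).
Proof.
move=> i0; rewrite (_ : (fun _ => _) = (fun w => (`|a| ^+ 3 / 6)%:E * (`|e i w| ^+ 3)%:E)%E).
  by apply: integrableZl => //; exact: ie3.
by apply/funext => w; rewrite -EFinM normrM exprMn mulrAC.
Qed.

Let bcos i a : (0 < i)%N -> bounded_mfun (fun w => cos (a * e i w)).
Proof. by move=> i0; exact: (bounded_mfun_comp (me i0) (bounded_mfun_cosM a)). Qed.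

Let bsin i a : (0 < i)%N -> bounded_mfun (fun w => sin (a * e i w)).
Proof. by move=> i0; exact: (bounded_mfun_comp (me i0) (bounded_mfun_sinM a)). Qed.

Lemma mean_sin_le i a : (0 < i)%N ->
  `|\int[P]_w sin (a * e i w)| <= `|a| ^+ 3 * K / 6.
Proof.
move=> i0.
have is_ : P.-integrable setT (fun w => (sin (a * e i w))%:E).
  by apply: integrable_bounded_mfun; exact: bsin.
have ia : P.-integrable setT (fun w => (a * e i w)%:E).
  rewrite (_ : (fun _ => _) = (fun w => a%:E * (e i w)%:E)%E); last by apply/funext.
  by apply: integrableZl => //; exact: ie.
have -> : \int[P]_w sin (a * e i w) = \int[P]_w (sin (a * e i w) - a * e i w).
  rewrite RintegralB// (@RintegralZl _ _ _ P setT (e i))//; last exact: ie.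
  by rewrite e_mean// mulr0 subr0.
apply: le_trans (mean_e3 a i0); apply: norm_mean_le_mean.
- rewrite (_ : EFin \o _ = (fun w => (sin (a * e i w))%:E - (a * e i w)%:E)%E); last by apply/funext.
  exact: integrableB.
- exact: integrable_e3.
- by move=> w; exact: norm_sin_taylor.
Qed.

Lemma mean_cos_le i a : (0 < i)%N ->
  `|\int[P]_w cos (a * e i w) - (1 - a ^+ 2 * s2 / 2)| <= `|a| ^+ 3 * K / 6.
Proof.
move=> i0.
have ic : P.-integrable setT (fun w => (cos (a * e i w))%:E).
  by apply: integrable_bounded_mfun; exact: bcos.
have ia : P.-integrable setT (fun w => ((a ^+ 2 / 2) * e i w ^+ 2)%:E).
  rewrite (_ : (fun _ => _) = (fun w => (a ^+ 2 / 2)%:E * (e i w ^+ 2)%:E)%E); last by apply/funext.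
  by apply: integrableZl => //; exact: ie2.
have i1 : P.-integrable setT (EFin \o cst (1 : R)).
  by apply: integrable_bounded_mfun; exact: bounded_mfun_cst.
have i1a : P.-integrable setT (EFin \o (fun w => 1 - (a ^+ 2 / 2) * e i w ^+ 2)).
  rewrite (_ : EFin \o _ = (fun w => (cst 1 w)%:E - ((a ^+ 2 / 2) * e i w ^+ 2)%:E)%E); last by apply/funext.
  exact: integrableB.
have -> : \int[P]_w cos (a * e i w) - (1 - a ^+ 2 * s2 / 2) =
    \int[P]_w (cos (a * e i w) - (1 - (a ^+ 2 / 2) * e i w ^+ 2)).
  rewrite RintegralB// RintegralB// (Rintegral_prob_cst P 1).
  rewrite RintegralZl//; last exact: ie2.
  by rewrite e_var// mulrAC.
apply: le_trans (mean_e3 a i0); apply: norm_mean_le_mean.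
- rewrite (_ : EFin \o _ = (fun w => (cos (a * e i w))%:E -
    (1 - (a ^+ 2 / 2) * e i w ^+ 2)%:E)%E); last by apply/funext.
  exact: integrableB.
- exact: integrable_e3.
- move=> w; have := norm_cos_taylor (a * e i w).
  by rewrite exprMn mulrAC.
Qed.

Let S (a : nat -> R) n w := \sum_(1 <= j < n.+1) a j * e j w.

Let SS (a : nat -> R) n w : S a n.+1 w = S a n w + a n.+1 * e n.+1 w.
Proof. by rewrite /S big_nat_recr. Qed.

(** Cosine and sine are carried together, as the addition formulas mix them. *)
Let indep_cs (a : nat -> R) n th :
  indep_of_tail P e n (fun w => cos (S a n w + th)) /\
  indep_of_tail P e n (fun w => sin (S a n w + th)).
Proof.
elim: n => [|n [IHc IHs]].
  have S0 w : S a 0 w = 0 by rewrite /S big_geq.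
  split.
    rewrite (_ : (fun _ => _) = cst (cos th)); first exact: indep_of_tail_cst.
    by apply/funext => w; rewrite S0 add0r.
  rewrite (_ : (fun _ => _) = cst (sin th)); first exact: indep_of_tail_cst.
  by apply/funext => w; rewrite S0 add0r.
have M := fun F g iF bg => (@indep_of_tailM _ _ _ P e me indep n F g iF bg).1.
have bc := bounded_mfun_cosM (a n.+1); have bs := bounded_mfun_sinM (a n.+1).
split.
  rewrite (_ : (fun _ => _) = (fun w => cos (S a n w + th) * cos (a n.+1 * e n.+1 w) +
      (-1) * (sin (S a n w + th) * sin (a n.+1 * e n.+1 w)))); last first.
    by apply/funext => w; rewrite SS addrAC cosD; ring.
  apply: indep_of_tailD => //; first exact: (M _ _ IHc bc).
  by apply: indep_of_tailZ => //; exact: (M _ _ IHs bs).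
rewrite (_ : (fun _ => _) = (fun w => sin (S a n w + th) * cos (a n.+1 * e n.+1 w) +
      cos (S a n w + th) * sin (a n.+1 * e n.+1 w))); last first.
  by apply/funext => w; rewrite SS addrAC sinD; ring.
apply: indep_of_tailD => //; first exact: (M _ _ IHs bc).
exact: (M _ _ IHc bs).
Qed.

Lemma mean_cos_clt (a : nat -> R) n th : (forall j, `|a j| <= 1) ->
  `|\int[P]_w cos (\sum_(1 <= j < n.+1) a j * e j w + th) -
    expR (- (s2 / 2 * \sum_(1 <= j < n.+1) a j ^+ 2)) * cos th| <=
  (K / 3 + s2 ^+ 2 / 8) * \sum_(1 <= j < n.+1) `|a j| ^+ 3.
Proof.
move=> a1; elim: n => [|n IH].
  rewrite !(@big_geq _ _ _ 1 1)// !mulr0 oppr0 expR0 mul1r.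
  under eq_Rintegral do rewrite big_geq// add0r.
  by rewrite Rintegral_prob_cst subrr normr0.
have [ic is_] := indep_cs a n th.
have bc := bounded_mfun_cosM (a n.+1); have bs := bounded_mfun_sinM (a n.+1).
have [iM EM] := @indep_of_tailM _ _ _ P e me indep n _ _ ic bc.
have [iN EN] := @indep_of_tailM _ _ _ P e me indep n _ _ is_ bs.
have E : \int[P]_w cos (\sum_(1 <= j < n.+2) a j * e j w + th) =
    \int[P]_w cos (S a n w + th) * \int[P]_w cos (a n.+1 * e n.+1 w) -
    \int[P]_w sin (S a n w + th) * \int[P]_w sin (a n.+1 * e n.+1 w).
  rewrite -EM -EN -mean_bB; last 2 first.
  - exact: iM.1.
  - exact: iN.1.
  by apply: eq_Rintegral => w _; rewrite -/(S a n.+1 w) SS addrAC cosD.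
rewrite E.
have h1 := mean_sin_le (a n.+1) (ltn0Sn n).
have h2 := mean_cos_le (a n.+1) (ltn0Sn n).
have h3 : `|\int[P]_w sin (S a n w + th)| <= 1.
  apply: norm_mean_le; first exact: is_.1.
  by move=> w; rewrite ler_norml sin_geN1 sin_le1.
have h4 : `|\int[P]_w cos (S a n w + th)| <= 1.
  apply: norm_mean_le; first exact: ic.1.
  by move=> w; rewrite ler_norml cos_geN1 cos_le1.
rewrite (@big_nat_recr _ _ _ n.+1 1)//= (@big_nat_recr _ _ _ n.+1 1)//=.
have -> : expR (- (s2 / 2 * (\sum_(1 <= i < n.+1) a i ^+ 2 + a n.+1 ^+ 2))) * cos th =
    expR (- (a n.+1 ^+ 2 * s2 / 2)) *
    (expR (- (s2 / 2 * \sum_(1 <= i < n.+1) a i ^+ 2)) * cos th).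
  by rewrite mulrA -expRD; congr (expR _ * _); ring.
have x0 : 0 <= a n.+1 ^+ 2 * s2 / 2.
  by apply: divr_ge0 => //; apply: mulr_ge0 => //; exact: sqr_ge0.
apply: mean_cos_clt_step h4 h3 h2 h1 IH.
- by rewrite normr_ge0 a1.
- by rewrite real_normK ?num_real.
- exact: norm_onem_expRN_le.
- by rewrite expR_ge0 expR_le1 oppr_le0.
Qed.

End trigonometric_clt.

(** * Gaussian averages *)

Section half_gaussian.
Context {R : realType}.
Notation leb := (@lebesgue_measure R).
Notation itv0y := (`]0, +oo[%classic : set R).
Implicit Types a b x : R.

Definition gaussian x : R := expR (- (x ^+ 2 / 2)).

Lemma gaussian_ge0 x : 0 <= gaussian x. Proof. exact: expR_ge0. Qed.

Lemma is_derive_gaussian x : is_derive x 1 gaussian (- (x * gaussian x)).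
Proof.
have d1 : is_derive x 1 (fun y : R => - (y ^+ 2 / 2)) (- x).
  rewrite (_ : (fun _ => _) = (fun y : R => - (2^-1 * (y * y)))); last first.
    by apply/funext => y; rewrite expr2 mulrC.
  by apply: is_derive_eq; rewrite /GRing.scale/=; field.
apply: (@is_derive_eq _ _ _ _ _ _ _ _ (is_derive1_comp (is_derive_expR _) d1)).
by rewrite /GRing.scale/= mulrN mulrC.
Qed.

Lemma continuous_gaussian : continuous gaussian.
Proof.
move=> x; apply: differentiable_continuous.
by apply/derivable1_diffP; have [] := is_derive_gaussian x.
Qed.

Lemma measurable_gaussian : measurable_fun setT gaussian.
Proof. exact: continuous_measurable_fun continuous_gaussian. Qed.

(** From [x^2 / 2 >= x - 1 / 2], the Gaussian is at most [exp (1 / 2) exp (- x)], so the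
    integrability of [erlang] applies. *)
Lemma integrable_half_gaussian (n : nat) (f : R -> R) (M : R) :
  measurable_fun setT f -> (forall x, 0 < x -> `|f x| <= M * x ^+ n) ->
  leb.-integrable itv0y (fun x => (f x * gaussian x)%:E).
Proof.
move=> mf fM.
have M0 : 0 <= M by have := fM 1 ltr01; rewrite expr1n mulr1; exact: le_trans.
have i1 := integrable_tame n (tame_cst (M * expR 2^-1)).
apply: le_integrable i1 => //.
  apply/measurable_EFinP/measurable_funTS; apply: measurable_funM => //.
  exact: measurable_gaussian.
move=> x /=; rewrite in_itv/= andbT => x0; rewrite lee_fin.
rewrite normrM (ger0_norm (gaussian_ge0 _)).
apply: le_trans (ler_norm _).
apply: (@le_trans _ _ (M * x ^+ n * gaussian x)).
  by rewrite ler_wpM2r ?gaussian_ge0 ?fM.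
rewrite /erlang.
have -> : M * expR 2^-1 * (x ^+ n * expR (- x)) = M * x ^+ n * (expR 2^-1 * expR (- x)) by ring.
rewrite ler_wpM2l ?mulr_ge0 ?exprn_ge0 ?(ltW x0)// -expRD ler_expR.
by have := sqr_ge0 (x - 1); lra.
Qed.

Definition half_cos a : R := \int[leb]_(x in itv0y) (cos (a * x) * gaussian x).

Let measurable_cosM a : measurable_fun setT (fun x : R => cos (a * x)).
Proof. exact: (bounded_mfun_cosM a).1. Qed.

Let measurable_sinM a : measurable_fun setT (fun x : R => sin (a * x)).
Proof. exact: (bounded_mfun_sinM a).1. Qed.

Let i_cos a : leb.-integrable itv0y (fun x => (cos (a * x) * gaussian x)%:E).
Proof.
apply: (@integrable_half_gaussian 0 _ 1) => // x x0.
by rewrite expr0 mulr1 ler_norml cos_geN1 cos_le1.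
Qed.

Let i_xsin a : leb.-integrable itv0y (fun x => (x * sin (a * x) * gaussian x)%:E).
Proof.
apply: (@integrable_half_gaussian 1 _ 1) => [|x x0]; first exact: measurable_funM.
rewrite expr1 mul1r normrM (gtr0_norm x0) ler_piMr// ?(ltW x0)//.
by rewrite ler_norml sin_geN1 sin_le1.
Qed.

Let i_x2 : leb.-integrable itv0y (fun x => (x ^+ 2 * gaussian x)%:E).
Proof.
apply: (@integrable_half_gaussian 2 _ 1) => [|x x0]; first exact: measurable_funX.
by rewrite mul1r ger0_norm ?sqr_ge0.
Qed.

Let V : R := \int[leb]_(x in itv0y) (x ^+ 2 * gaussian x).

Let is_derive_cosM a x : is_derive x 1 (fun y : R => cos (a * y)) (- (a * sin (a * x))).
Proof. by apply: is_derive_eq; rewrite /GRing.scale/=; ring. Qed.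

Let is_derive_sinM a x : is_derive x 1 (fun y : R => sin (a * y)) (a * cos (a * x)).
Proof. by apply: is_derive_eq; rewrite /GRing.scale/=; ring. Qed.

Let half_cos_parts a :
  \int[leb]_(x in itv0y) (x * sin (a * x) * gaussian x) = a * half_cos a.
Proof.
pose F x := - (sin (a * x) * gaussian x).
pose f x := x * sin (a * x) * gaussian x - a * (cos (a * x) * gaussian x).
have dF x : is_derive x 1 F (f x).
  have ds := is_derive_sinM a x; have dg := is_derive_gaussian x.
  apply: (@is_derive_eq _ _ _ _ _ _ _ _ (is_deriveN (is_deriveM ds dg))).
  by rewrite /GRing.scale/= /f; ring.
have cc (h : R -> R) (dh : R -> R) : (forall x, is_derive x 1 h (dh x)) -> continuous h.
  move=> H x; apply: differentiable_continuous.
  by apply/derivable1_diffP; have [] := H x.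
have cf x : {for x, continuous f}.
  have c1 := cc _ _ (is_derive_cosM a); have c2 := cc _ _ (is_derive_sinM a).
  apply: continuousB; apply: continuousM.
  - by apply: continuousM; [exact: cvg_id|exact: c2].
  - exact: continuous_gaussian.
  - exact: cst_continuous.
  - by apply: continuousM; [exact: c1|exact: continuous_gaussian].
have ic : leb.-integrable itv0y (fun x => (a * (cos (a * x) * gaussian x))%:E).
  rewrite (_ : (fun _ => _) = fun x => (a%:E * (cos (a * x) * gaussian x)%:E)%E); last by apply/funext.
  exact: integrableZl.
have intf : leb.-integrable itv0y (EFin \o f).
  rewrite (_ : EFin \o f =
    fun x => ((x * sin (a * x) * gaussian x)%:E - (a * (cos (a * x) * gaussian x))%:E)%E);
    last by apply/funext.
  exact: integrableB.
have F0 : F 0 = 0 by rewrite /F mulr0 sin0 mul0r oppr0.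
have Fy : F x @[x --> +oo] --> 0.
  apply: norm_cvg0; apply: (@squeeze_cvgr _ _ _ _ (fun=> 0) (fun x => expR 2^-1 * expR (- x))).
  - near=> x; rewrite normr_ge0/= /F normrN normrM (ger0_norm (gaussian_ge0 _)).
    apply: (@le_trans _ _ (1 * gaussian x)).
      by rewrite ler_wpM2r ?gaussian_ge0// ler_norml sin_geN1 sin_le1.
    by rewrite mul1r -expRD ler_expR; have := sqr_ge0 (x - 1); lra.
  - exact: cvg_cst.
  - rewrite -[X in _ --> X](mulr0 (expR 2^-1)); apply: cvgM; first exact: cvg_cst.
    exact: cvgr_expR.
have F0r : F x @[x --> 0^'+] --> F 0.
  by apply: cvg_at_right_filter; exact: (cc _ _ dF).
have := integrable_FTC0y (fun x _ => dF x) (fun x _ => cf x) Fy F0r intf.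
rewrite F0 subrr => e.
have : \int[leb]_(x in itv0y) f x = 0 by rewrite /Rintegral e.
have mI : @measurable _ (measurableTypeR R) itv0y by exact: measurable_itv.
have E := RintegralZl a mI (i_cos a); rewrite /= in E.
have E2 := RintegralB mI (i_xsin a) ic; rewrite /= in E2.
by rewrite /f E2 E => /eqP; rewrite subr_eq0 => /eqP.
Unshelve. all: by end_near. Qed.

Let cos_taylor (u v : R) : `|cos (u + v) - cos u + v * sin u| <= 2 * v ^+ 2.
Proof.
have -> : cos (u + v) - cos u + v * sin u = cos u * (cos v - 1) - sin u * (sin v - v).
  by rewrite cosD; ring.
have hc : `|cos v - 1| <= v ^+ 2 / 2.
  have h w : 0 <= w -> `|cos w - 1| <= w ^+ 2 / 2.
    by move=> w0; rewrite distrC ger0_norm ?subr_ge0 ?cos_le1// onem_cos_le.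
  have [v0|v0] := leP 0 v; first exact: h.
  by rewrite -cosN -sqrrN; apply: h; rewrite oppr_ge0 ltW.
have hs : `|sin v - v| <= v ^+ 2.
  have h1 := norm_sin_taylor v.
  have h2 : `|sin v - v| <= 1 + `|v|.
    by rewrite (le_trans (ler_normB _ _))// lerD2r ler_norml sin_geN1 sin_le1.
  rewrite -(real_normK (num_real v)); have := normr_ge0 v.
  move: h1 h2; move: `|sin v - v| `|v| => y t h1 h2 t0.
  (* Up to 6 the cubic remainder [t^3 / 6] is at most [t^2]; beyond, the trivial bound [1 + t]
     is. *)
  have [t6|t6] := leP t 6; last by nra.
  apply: le_trans h1 _; rewrite exprSr; nra.
have nc : `|cos u| <= 1 by rewrite ler_norml cos_geN1 cos_le1.
have ns : `|sin u| <= 1 by rewrite ler_norml sin_geN1 sin_le1.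
have k1 : `|cos u * (cos v - 1)| <= 1 * (v ^+ 2 / 2) by rewrite normrM ler_pM.
have k2 : `|sin u * (sin v - v)| <= 1 * v ^+ 2 by rewrite normrM ler_pM.
have := ler_normB (cos u * (cos v - 1)) (sin u * (sin v - v)).
by have := sqr_ge0 v; lra.
Qed.

(** Differentiation under the integral sign, with a quadratic remainder controlled by the second
    moment [V]; the derivative is already rewritten by parts. *)
Let half_cos_taylor a b :
  `|half_cos b - half_cos a + (b - a) * (a * half_cos a)| <= 2 * (b - a) ^+ 2 * V.
Proof.
have mI : @measurable _ (measurableTypeR R) itv0y by exact: measurable_itv.
pose h x := (cos (b * x) * gaussian x - cos (a * x) * gaussian x) +
  (b - a) * (x * sin (a * x) * gaussian x).
have i1 : leb.-integrable itv0y (fun x => (cos (b * x) * gaussian x - cos (a * x) * gaussian x)%:E).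
  rewrite (_ : (fun _ => _) =
    fun x => ((cos (b * x) * gaussian x)%:E - (cos (a * x) * gaussian x)%:E)%E);
    last by apply/funext.
  exact: integrableB.
have i2 : leb.-integrable itv0y (fun x => ((b - a) * (x * sin (a * x) * gaussian x))%:E).
  rewrite (_ : (fun _ => _) = fun x => ((b - a)%:E * (x * sin (a * x) * gaussian x)%:E)%E);
    last by apply/funext.
  exact: integrableZl.
have i3 : leb.-integrable itv0y (fun x => (2 * (b - a) ^+ 2 * (x ^+ 2 * gaussian x))%:E).
  rewrite (_ : (fun _ => _) = fun x => ((2 * (b - a) ^+ 2)%:E * (x ^+ 2 * gaussian x)%:E)%E);
    last by apply/funext.
  exact: integrableZl.
have ih : leb.-integrable itv0y (EFin \o h).
  rewrite (_ : EFin \o h =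
    fun x => ((cos (b * x) * gaussian x - cos (a * x) * gaussian x)%:E +
      ((b - a) * (x * sin (a * x) * gaussian x))%:E)%E);
    last by apply/funext.
  exact: integrableD.
have -> : half_cos b - half_cos a + (b - a) * (a * half_cos a) = \int[leb]_(x in itv0y) h x.
  have E := RintegralZl (b - a) mI (i_xsin a); rewrite /= in E.
  rewrite /h RintegralD// RintegralB//; try exact: i_cos.
  by rewrite E half_cos_parts.
apply: le_trans (le_normr_Rintegral _ ih) _ => //.
rewrite /V -RintegralZl//; apply: le_Rintegral => //; first exact: integrable_norm.
move=> x _; rewrite /h.
have -> : cos (b * x) * gaussian x - cos (a * x) * gaussian x +
    (b - a) * (x * sin (a * x) * gaussian x) =
    (cos (a * x + (b - a) * x) - cos (a * x) + ((b - a) * x) * sin (a * x)) * gaussian x.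
  have -> : b * x = a * x + (b - a) * x by ring.
  by ring.
rewrite normrM (ger0_norm (gaussian_ge0 _)) mulrA ler_wpM2r ?gaussian_ge0//.
by apply: le_trans (cos_taylor _ _) _; rewrite exprMn mulrA.
Qed.

Let is_derive_half_cos a : is_derive a 1 half_cos (- (a * half_cos a)).
Proof.
have V0 : 0 <= V.
  by apply: Rintegral_ge0 => x _; rewrite mulr_ge0 ?sqr_ge0 ?gaussian_ge0.
have C : h^-1 *: (half_cos (h *: (1 : R) + a) - half_cos a) @[h --> (0 : R)^'] --> - (a * half_cos a).
  apply/cvgrPdist_le => eps eps0; near=> h.
  have h0 : h != 0 by near: h; exact: nbhs_dnbhs_neq.
  have he : `|h| <= eps / (2 * V + 1).
    by near: h; apply: dnbhs0_le; rewrite divr_gt0// ltr_wpDl// mulr_ge0.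
  rewrite /GRing.scale/= mulr1.
  have := half_cos_taylor a (h + a); rewrite addrK => H.
  have -> : - (a * half_cos a) - h^-1 * (half_cos (h + a) - half_cos a) =
     - (h^-1 * (half_cos (h + a) - half_cos a + h * (a * half_cos a))).
    by field.
  rewrite normrN normrM normfV ler_pdivrMl ?normr_gt0//.
  apply: le_trans H _; rewrite -(real_normK (num_real h)) expr2.
  rewrite ler_pdivlMr ?ltr_wpDl// ?mulr_ge0// in he.
  rewrite mulrA -mulrA mulrAC mulrC ler_wpM2l//; have := normr_ge0 h; nra.
by apply: DeriveDef; [apply/cvg_ex; eexists; exact: C|apply/cvg_lim => //; exact: C].
Unshelve. all: by end_near. Qed.

(** The solution of [H' = - a H]. The Gaussian integral [half_cos 0] stays unevaluated; the total
    mass of the normal law will fix it. *)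
Lemma half_cosE a : half_cos a = half_cos 0 * expR (- (a ^+ 2 / 2)).
Proof.
pose psi x := half_cos x * expR (x ^+ 2 / 2).
have dpsi x : is_derive x 1 psi 0.
  have d1 : is_derive x 1 (fun y : R => y ^+ 2 / 2) x.
    rewrite (_ : (fun _ => _) = (fun y : R => 2^-1 * (y * y))); last first.
      by apply/funext => y; rewrite expr2 mulrC.
    by apply: is_derive_eq; rewrite /GRing.scale/=; field.
  have d2 := is_derive1_comp (is_derive_expR _) d1.
  have d3 := is_derive_half_cos x.
  apply: (@is_derive_eq _ _ _ _ _ _ _ _ (is_deriveM d3 d2)).
  by rewrite /GRing.scale/=; ring.
have := is_derive_0_is_cst a 0 dpsi.
rewrite /psi expr0n mul0r expR0 mulr1 => <-.
by rewrite -mulrA -expRD subrr expR0 mulr1.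
Qed.

End half_gaussian.

Section mean_product.
Context {R : realType} d1 (T1 : measurableType d1) d2 (T2 : measurableType d2).
Variables (P : probability T1 R) (Q : probability T2 R).
Variable F : T1 * T2 -> R.
Hypothesis bF : bounded_mfun F.

Let iF : (P \x Q)%E.-integrable setT (EFin \o F).
Proof.
have [mF [M FM]] := bF.
exact: (@bounded_integrable _ _ _ (P \x Q)%E F M mF FM).
Qed.

Lemma bounded_mfun_pair1 x : bounded_mfun (fun y => F (x, y)).
Proof.
have [mF [M FM]] := bF; split; last by exists M.
exact: (measurableT_comp mF (measurable_pair1 x)).
Qed.

Lemma bounded_mfun_pair2 y : bounded_mfun (fun x => F (x, y)).
Proof.
have [mF [M FM]] := bF; split; last by exists M.
exact: (measurableT_comp mF (measurable_pair2 y)).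
Qed.

Lemma mean_fubini1 : \int[(P \x Q)%E]_z F z = \int[P]_x \int[Q]_y F (x, y).
Proof.
rewrite /Rintegral -(integral12_prod_meas1 iF); congr fine.
apply: eq_integral => x _; rewrite fineK//.
have i := integrable_bounded_mfun Q (bounded_mfun_pair1 x).
exact: (integral_fune_fin_num _ i).
Qed.

Lemma mean_fubini2 : \int[(P \x Q)%E]_z F z = \int[Q]_y \int[P]_x F (x, y).
Proof.
rewrite /Rintegral -(integral21_prod_meas1 iF); congr fine.
apply: eq_integral => y _; rewrite fineK//.
have i := integrable_bounded_mfun P (bounded_mfun_pair2 y).
exact: (integral_fune_fin_num _ i).
Qed.

Lemma bounded_mfun_mean1 : bounded_mfun (fun x => \int[Q]_y F (x, y)).
Proof.
have [mF [M FM]] := bF; split; last first.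
  by exists M => x; apply: norm_mean_le => //; exact: bounded_mfun_pair1.
(* Measurability of a partial integral is available for nonnegative integrands, hence the shift by
   [M]. *)
have h : measurable_fun setT (fun x => (\int[Q]_y (F (x, y) + M)%:E)%E).
  apply: (@measurable_fun_fubini_tonelli_F _ _ T1 T2 R Q (fun z => (F z + M)%:E)).
    by apply/measurable_EFinP; exact: measurable_funD.
  by move=> z; rewrite lee_fin; have := FM z; rewrite ler_norml => /andP[+ _]; lra.
have h2 : measurable_fun setT (fun x => \int[Q]_y F (x, y) + M).
  apply/measurable_EFinP; apply: eq_measurable_fun h => x _ /=.
  rewrite EFin_mean; last first.
    by apply: bounded_mfunD; [exact: bounded_mfun_pair1|exact: bounded_mfun_cst].
  rewrite (mean_bD Q (bounded_mfun_pair1 x) (bounded_mfun_cst M)).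
  by rewrite Rintegral_prob_cst.
rewrite (_ : (fun _ => _) = fun x => (\int[Q]_y F (x, y) + M) - M).
  exact: measurable_funB.
by apply/funext => x; rewrite addrK.
Qed.

End mean_product.

Lemma bounded_mfun_mean2 {R : realType} d1 (T1 : measurableType d1) d2
    (T2 : measurableType d2) (P : probability T1 R) (F : T1 * T2 -> R) :
  bounded_mfun F -> bounded_mfun (fun y => \int[P]_x F (x, y)).
Proof.
move=> bF; apply: (@bounded_mfun_mean1 _ _ T2 _ T1 P (fun z => F (z.2, z.1))).
by apply: (@bounded_mfun_comp _ _ _ _ _ (fun z : T2 * T1 => (z.2, z.1)) F) => //; exact: measurable_swap.
Qed.

(** * Trigonometric means under the normal law *)

Section normal_mean.
Context {R : realType}.
Notation leb := (@lebesgue_measure R).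

Lemma ge0_integral_opp (g : R -> \bar R) : measurable_fun setT g ->
  (forall x, 0 <= g x)%E -> (\int[leb]_x g x = \int[leb]_x g (- x)%R)%E.
Proof.
move=> mg g0; pose phi (x : measurableTypeR R) : measurableTypeR R := - x.
have mphi : measurable_fun setT phi.
  have h : measurable_fun setT (-%R : R -> R) by exact: oppr_measurable.
  by move=> _ B mB; exact: h.
pose m2 := measure_function_pushforward__canonical__measure_function_Measure leb mphi.
rewrite (eq_measure_integral m2); first by rewrite ge0_integral_pushforward.
by move=> A mA _; exact: (esym (lebesgue_measureN mA)).
Qed.

Definition std_normal : probability (measurableTypeR R) R := normal_prob (0 : R) 1.
Local Notation pk := (normal_peak (1 : R)).

Lemma ge0_integral_gm (g : R -> \bar R) : measurable_fun setT g ->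
  (forall x, 0 <= g x)%E ->
  (\int[std_normal]_x g x = pk%:E * \int[leb]_x (g x * (gaussian x)%:E))%E.
Proof.
move=> mg g0.
have mg' : measurable_fun (setT : set (measurableTypeR R)) g.
  by move=> _ B mB; exact: mg.
have mp : measurable_fun setT (normal_pdf 0 1 : R -> R) by exact: measurable_normal_pdf.
rewrite (@ge0_integral_density _ (measurableTypeR R) R leb std_normal (normal_pdf 0 1)
  (normal_pdf_ge0 _ _) mp _ g mg' g0)//.
rewrite -ge0_integralZl//; first last.
- by rewrite lee_fin normal_peak_ge0.
- by move=> x _; rewrite mule_ge0// lee_fin gaussian_ge0.
- apply: emeasurable_funM => //; apply/measurable_EFinP.
  by move=> _ B mB; exact: measurable_gaussian.
apply: eq_integral => x _; rewrite muleCA -EFinM; congr (_ * _%:E)%E.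
rewrite normal_pdfE ?oner_neq0//; congr (_ * expR _).
by rewrite subr0 expr1n mulNr.
Qed.

Lemma bounded_mfunT (f : R -> R) : bounded_mfun f ->
  @bounded_mfun _ (measurableTypeR R) R f.
Proof. by move=> [mf bf]; split => // _ B mB; exact: mf. Qed.

Lemma mean_gm_opp (f : R -> R) : bounded_mfun f ->
  \int[std_normal]_x f (- x) = \int[std_normal]_x f x.
Proof.
move=> bf; have [mf [M fM]] := bf.
have bfo : bounded_mfun (fun x : R => f (- x)).
  by apply: (@bounded_mfun_comp _ _ _ _ _ (fun x : R => - x) f) => //; exact: oppr_measurable.
have f0 x : (0 <= (f x + M)%:E)%E.
  by rewrite lee_fin; have := fM x; rewrite ler_norml => /andP[+ _]; lra.
have mE (h : R -> R) : measurable_fun setT h -> measurable_fun setT (fun x => (h x + M)%:E).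
  by move=> mh; apply/measurable_EFinP; exact: measurable_funD.
have : (\int[std_normal]_x (f (- x) + M)%:E = \int[std_normal]_x (f x + M)%:E)%E.
  rewrite ge0_integral_gm//; last by apply: (mE (fun x => f (- x))); exact: bfo.1.
  rewrite ge0_integral_gm//; last exact: mE.
  congr (_ * _)%E; rewrite [RHS]ge0_integral_opp.
  - by apply: eq_integral => x _; rewrite /gaussian sqrrN.
  - apply: emeasurable_funM; first exact: mE.
    by apply/measurable_EFinP; exact: measurable_gaussian.
  - by move=> x; rewrite mule_ge0// lee_fin gaussian_ge0.
have b1 := bounded_mfunT bf; have b2 := bounded_mfunT bfo.
have bc := @bounded_mfun_cst _ (measurableTypeR R) R M.
rewrite (EFin_mean std_normal (bounded_mfunD b1 bc)) (EFin_mean std_normal (bounded_mfunD b2 bc)).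
by rewrite (mean_bD std_normal b1 bc) (mean_bD std_normal b2 bc) => -[] /addIr.
Qed.

Lemma integral_gm_even (f : R -> R) : continuous f -> (forall x, 0 <= f x) ->
  (forall x, f (- x) = f x) ->
  leb.-integrable `]0, +oo[ (fun x => (f x * gaussian x)%:E) ->
  (\int[std_normal]_x (f x)%:E =
   (2 * pk * \int[leb]_(x in `]0, +oo[) (f x * gaussian x))%:E)%E.
Proof.
move=> cf f0 fN fi.
have mf : measurable_fun setT f by exact: continuous_measurable_fun.
rewrite ge0_integral_gm//; last exact/measurable_EFinP.
under eq_integral do rewrite -EFinM.
rewrite (@ge0_symfun_integralT _ (fun x => f x * gaussian x)); last 3 first.
- by move=> x; rewrite mulr_ge0 ?gaussian_ge0.
- move=> x; apply: (@continuousM _ _ f gaussian); first exact: cf.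
  exact: continuous_gaussian.
- by move=> x /=; rewrite fN /gaussian sqrrN.
rewrite -set_itvcy -integral_itv_obnd_cbnd; last first.
  apply/measurable_EFinP/measurable_funTS; apply: measurable_funM => //.
  exact: measurable_gaussian.
rewrite [RHS]EFinM /Rintegral fineK; last exact: (integral_fune_fin_num _ fi).
by rewrite muleA -EFinM (mulrC 2).
Qed.

Lemma mean_gm_cosM a : \int[std_normal]_x cos (a * x) = expR (- (a ^+ 2 / 2)).
Proof.
(* Adding 1 makes the even integrand nonnegative, so the integral folds to the half-line. *)
have H b : \int[std_normal]_x (1 + cos (b * x)) = 2 * pk * (half_cos 0 + half_cos b).
  have ic c : leb.-integrable `]0, +oo[ (fun x => (cos (c * x) * gaussian x)%:E).
    apply: (@integrable_half_gaussian _ 0 _ 1) => [|x x0]; first exact: (bounded_mfun_cosM c).1.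
    by rewrite expr0 mulr1 ler_norml cos_geN1 cos_le1.
  have i1 : leb.-integrable `]0, +oo[ (fun x => ((1 + cos (b * x)) * gaussian x)%:E).
    rewrite (_ : (fun _ => _) = fun x => ((cos (0 * x) * gaussian x)%:E + (cos (b * x) * gaussian x)%:E)%E).
      exact: integrableD.
    by apply/funext => x; rewrite mul0r cos0 mulrDl.
  rewrite /Rintegral (@integral_gm_even (fun x => 1 + cos (b * x))) //=.
  - congr (_ * _).
    have mI : @measurable _ (measurableTypeR R) `]0, +oo[%classic by exact: measurable_itv.
    have E := RintegralD mI (ic 0) (ic b); rewrite /= in E; rewrite /half_cos -E.
    by apply: eq_Rintegral => x _; rewrite mul0r cos0 mulrDl.
  - move=> x; apply: (@cvgD _ R^o); first exact: cvg_cst.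
    apply: (@continuous_comp _ _ _ (fun x => b * x) cos); first exact: mulrl_continuous.
    exact: continuous_cos.
  - by move=> x; rewrite mulrN cosN.
have M b : \int[std_normal]_x (1 + cos (b * x)) = 1 + \int[std_normal]_x cos (b * x).
  have bc := bounded_mfunT (bounded_mfun_cosM b).
  have b1 := @bounded_mfun_cst _ (measurableTypeR R) R 1.
  by rewrite (mean_bD std_normal b1 bc) Rintegral_prob_cst.
(* At [b = 0] the total mass 1 of the law determines [pk * half_cos 0]. *)
have E0 : 2 * pk * (half_cos 0 + half_cos 0) = 2.
  rewrite -H M; under eq_Rintegral do rewrite mul0r cos0.
  by rewrite (Rintegral_prob_cst std_normal 1).
have := M a; rewrite H (half_cosE a).
move: E0; move: pk (half_cos 0) (expR _) (\int[std_normal]_x cos (a * x)) => p h e I E0 E1.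
have E2 : 2 * p * h = 1 by lra.
have : 2 * p * (h + h * e) = 2 * p * h + 2 * p * h * e by ring.
by rewrite E1 E2; lra.
Qed.

Lemma mean_gm_cos a th : \int[std_normal]_x cos (a * x + th) = expR (- (a ^+ 2 / 2)) * cos th.
Proof.
have bc := bounded_mfunT (bounded_mfun_cosM a).
have bs := bounded_mfunT (bounded_mfun_sinM a).
have s0 : \int[std_normal]_x sin (a * x) = 0.
  have := mean_gm_opp (bounded_mfun_sinM a).
  have -> : \int[std_normal]_x sin (a * - x) = \int[std_normal]_x ((-1) * sin (a * x)).
    by apply: eq_Rintegral => x _; rewrite mulrN sinN mulN1r.
  by rewrite (mean_bZ std_normal (-1) bs); lra.
have b2 (c : R) (f : measurableTypeR R -> R) : bounded_mfun f -> bounded_mfun (fun x => c * f x).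
  by move=> bf; exact: (bounded_mfunM (bounded_mfun_cst c) bf).
transitivity (\int[std_normal]_x (cos th * cos (a * x) - sin th * sin (a * x))).
  by apply: eq_Rintegral => x _; rewrite cosD; ring.
rewrite (mean_bB std_normal (b2 (cos th) _ bc) (b2 (sin th) _ bs)).
by rewrite (mean_bZ std_normal _ bc) (mean_bZ std_normal _ bs) s0 mulr0 subr0 mean_gm_cosM mulrC.
Qed.

Lemma integral_gm_sqr : exists V : R, (\int[std_normal]_x (x ^+ 2)%:E = V%:E)%E.
Proof.
eexists; apply: (@integral_gm_even (fun x => x ^+ 2)) => //.
- exact: sqr_continuous.
- by move=> x; exact: sqr_ge0.
- by move=> x; rewrite sqrrN.
apply: (@integrable_half_gaussian _ 2 _ 1) => [|x x0]; first exact: measurable_funX.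
by rewrite mul1r ger0_norm ?sqr_ge0.
Qed.

Lemma measurable_fstR d (T : measurableType d) :
  measurable_fun setT (fun z : measurableTypeR R * T => z.1 : R).
Proof.
have h : measurable_fun setT (fst : measurableTypeR R * T -> measurableTypeR R).
  exact: measurable_fst.
by move=> _ B mB; exact: h.
Qed.

Lemma measurable_sndR d (T : measurableType d) :
  measurable_fun setT (fun z : T * measurableTypeR R => z.2 : R).
Proof.
have h : measurable_fun setT (snd : T * measurableTypeR R -> measurableTypeR R).
  exact: measurable_snd.
by move=> _ B mB; exact: h.
Qed.

Lemma bounded_mfun_cos_comp d (T : measurableType d) (f : T -> R) :
  measurable_fun setT f -> bounded_mfun (fun x => cos (f x)).
Proof.
move=> mf; split; last by exists 1 => w; rewrite ler_norml cos_geN1 cos_le1.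
apply: measurableT_comp => //.
exact: (continuous_measurable_fun (@continuous_cos R)).
Qed.

Lemma mean_gm2_cos a b th : \int[(std_normal \x std_normal)%E]_z cos (a * z.1 + b * z.2 + th) =
  expR (- ((a ^+ 2 + b ^+ 2) / 2)) * cos th.
Proof.
rewrite mean_fubini1; last first.
  apply: bounded_mfun_cos_comp; apply: measurable_funD => //.
  apply: measurable_funD; apply: measurable_funM => //.
transitivity (\int[std_normal]_x (expR (- (b ^+ 2 / 2)) * cos (a * x + th))).
  apply: eq_Rintegral => x _ /=; rewrite -mean_gm_cos.
  by apply: eq_Rintegral => y _; congr cos; ring.
rewrite mean_bZ; last first.
  apply: bounded_mfun_cos_comp.
  have h : measurable_fun setT (fun x : R => a * x + th).
    by apply: measurable_funD => //; exact: measurable_funM.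
  by move=> _ B mB; exact: h.
by rewrite mean_gm_cos mulrA -expRD; congr (expR _ * _); field.
Qed.

End normal_mean.

(** * Levy's continuity theorem in the plane *)

Section mean_limits.
Context {R : realType} d (T : measurableType d) (P : probability T R).

Lemma mean_dct (f_ : nat -> T -> R) (f : T -> R) (M : R) :
  (forall n, measurable_fun setT (f_ n)) -> (forall n x, `|f_ n x| <= M) ->
  (forall x, f_ n x @[n --> \oo] --> f x) ->
  \int[P]_x f_ n x @[n --> \oo] --> \int[P]_x f x.
Proof.
move=> mf fM cf.
have mlim : measurable_fun setT f.
  by apply: (@measurable_fun_cvg _ _ R setT f_) => // x _; exact: cf.
have fM' x : `|f x| <= M.
  by apply: (ler_cvg_to (cvg_norm (cf x)) (cvg_cst M)); exact: nearW.
have ic : P.-integrable setT (EFin \o cst M) .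
  exact: (integrable_bounded_mfun P (bounded_mfun_cst M)).
have cE x : [set: T] x -> (f_ n x)%:E @[n --> \oo] --> (f x)%:E.
  by move=> _; apply: cvg_EFin; [exact: nearW|exact: cf].
have [_ _] := @dominated_convergence _ T R P setT measurableT
  (fun n => EFin \o f_ n) (EFin \o f) (EFin \o cst M)
  (fun n => (measurable_EFinP _ _).2 (mf n)) ((measurable_EFinP _ _).2 mlim)
  (aeW P cE) ic
  (aeW P (fun x n _ => fM n x)).
have E (g : T -> R) : measurable_fun setT g -> (forall x, `|g x| <= M) ->
    (\int[P]_x (EFin \o g) x = (\int[P]_x g x)%:E)%E.
  by move=> mg gM; apply: EFin_mean; split => //; exists M.
rewrite E//; under eq_fun do rewrite E//.
by move/fine_cvg.
Qed.

End mean_limits.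

Section continuous_measurable.
Context {R : realType}.
Implicit Types h : R * R -> R.

Lemma measurable_floor_eq (k : int) (n : nat) :
  measurable ([set x | Num.floor (x * n.+1%:R) = k] : set R).
Proof.
rewrite (_ : mkset _ = `[k%:~R / n.+1%:R, (k + 1)%:~R / n.+1%:R[%classic).
  exact: measurable_itv.
apply/seteqP; split => x /=; rewrite in_itv/= ler_pdivrMr// ltr_pdivlMr//.
  by move=> <-; rewrite floor_le_tmp floorD1_gt.
by move=> h; apply/eqP; rewrite floor_eq.
Qed.

Lemma continuous_pairr h (c : R) : continuous h -> continuous (fun y : R => h (c, y)).
Proof.
move=> ch y; have hc : (c, y') @[y' --> y] --> (c, y).
  exact: (@cvg_pair _ _ _ (nbhs y) (nbhs c) (nbhs y) _ _ _ (fun=> c) id (cvg_cst c) cvg_id).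
exact: (cvg_comp _ _ hc (ch (c, y))).
Qed.

(** Measurability for the product sigma-algebra: rounding the first coordinate down to a grid of
    step [1 / (n + 1)] gives functions measurable on countably many strips, which converge to [h]
    pointwise. *)
Lemma continuous_measurable2 h : continuous h ->
  measurable_fun setT (h : measurableTypeR R * measurableTypeR R -> R).
Proof.
move=> ch; pose a (n : nat) (x : R) : R := (Num.floor (x * n.+1%:R))%:~R / n.+1%:R.
have ca x : a n x @[n --> \oo] --> x.
  apply/cvgrPdist_le => e e0; near=> n.
  have n0 : 0 < n.+1%:R :> R by [].
  have := floor_itv (x * n.+1%:R) => /andP[h1 h2].
  rewrite -ler_pdivrMr// in h1; rewrite -ltr_pdivlMr// intrD mulrDl mulr1z mul1r in h2.
  rewrite -/(a n x) in h1 h2; rewrite ger0_norm ?subr_ge0//.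
  apply: (@le_trans _ _ n.+1%:R^-1); first by move: h1 h2; move: (a n x) n.+1%:R^-1 => y v h1 h2; lra.
  by apply: ltW; near: n; exact: (near_infty_natSinv_lt (PosNum e0)).
apply: (@measurable_fun_cvg _ _ R setT
  (fun n (z : measurableTypeR R * measurableTypeR R) => h (a n z.1, z.2))).
- move=> n _ B mB; rewrite setTI.
  pose S (k : int) : set (measurableTypeR R * measurableTypeR R) :=
    [set x | Num.floor (x * n.+1%:R) = k] `*` [set y | B (h (k%:~R / n.+1%:R, y))].
  (* The strips are indexed by integers; [unpickle] turns this into a union over naturals, codes of
     no integer giving the empty set. *)
  have -> : (fun z : measurableTypeR R * measurableTypeR R => h (a n z.1, z.2)) @^-1` B =
      \bigcup_m (if unpickle m is Some k then S k else set0).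
    apply/seteqP; split => [[x y]/= hB|[x y] [m _]].
      exists (pickle (Num.floor (x * n.+1%:R))); first exact: I.
      by rewrite pickleK; split.
    by case: unpickle => [k [/= <-]|].
  apply: bigcupT_measurable => m; case: unpickle => // k.
  apply: measurableX; first exact: measurable_floor_eq.
  have mh : measurable_fun setT (fun y : R => h (k%:~R / n.+1%:R, y)).
    by apply: continuous_measurable_fun; exact: continuous_pairr.
  have := mh measurableT B mB; by rewrite setTI.
- move=> [x y] _ /=.
  apply: (@continuous_cvg _ _ _ _ _ (fun n => (a n x, y)) h (x, y)); first exact: ch.
  exact: (@cvg_pair _ _ _ _ (nbhs (x : R)) (nbhs (y : R)) _ _ _ (a ^~ x) (fun=> y) (ca x) (cvg_cst (y : R))).
Unshelve. all: by end_near. Qed.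

(** Compactness of the square of half-side [L + 1]. Since [r <= 1], a point outside it and its
    translate both lie where [h] vanishes. *)
Lemma unif_continuous_compact_support h (L eps : R) : continuous h -> 0 < eps ->
  (forall z, L < `|z.1| \/ L < `|z.2| -> h z = 0) ->
  exists2 r : R, 0 < r & forall z w : R * R, `|w.1| <= r -> `|w.2| <= r ->
    `|h (z.1 + w.1, z.2 + w.2) - h z| <= eps.
Proof.
move=> ch eps0 hL.
pose I : set R := `[- (L + 1), L + 1]%classic.
have cK : compact (I `*` I) by apply: compact_setX; exact: segment_compact.
have /compact_near_coveringP H := cK.
have near0 : \forall r \near (0 : R)^'+, I `*` I `<=` (fun z => forall w : R * R,
    `|w.1| <= r -> `|w.2| <= r -> `|h (z.1 + w.1, z.2 + w.2) - h z| <= eps).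
  apply: H => x _.
  have /cvgrPdist_lt/(_ (eps / 2)) := ch x.
  rewrite divr_gt0// => /(_ isT)/nbhs_ballP[rho /= rho0 hb].
  have hb' (z : R * R) : `|x.1 - z.1| < rho -> `|x.2 - z.2| < rho -> `|h x - h z| < eps / 2.
    by move=> h1 h2; apply: hb; split.
  have r2 : 0 < rho / 2 by rewrite divr_gt0.
  exists (ball x (rho / 2), [set r | r < rho / 2]).
    by split; [exact: nbhsx_ballx|exact: nbhs_right_lt].
  move=> [z r] /= [[b1 b2] rr] w w1 w2; rewrite /ball/= in b1 b2.
  have k1 : `|h x - h z| < eps / 2 by apply: hb'; rewrite (lt_trans (_ : _ < rho / 2))//; lra.
  have k2 : `|h x - h (z.1 + w.1, z.2 + w.2)| < eps / 2.
    apply: hb' => /=.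
      by have := ler_normB (x.1 - z.1) w.1; rewrite opprD addrA; lra.
    by have := ler_normB (x.2 - z.2) w.2; rewrite opprD addrA; lra.
  have -> : h (z.1 + w.1, z.2 + w.2) - h z =
    (h x - h z) - (h x - h (z.1 + w.1, z.2 + w.2)) by ring.
  by apply: le_trans (ler_normB _ _) _; lra.
have [r [[r0 r1] hr]] : exists r : R, (0 < r /\ r <= 1) /\ I `*` I `<=` (fun z => forall w : R * R,
    `|w.1| <= r -> `|w.2| <= r -> `|h (z.1 + w.1, z.2 + w.2) - h z| <= eps).
  near (0 : R)^'+ => r; exists r; split; last by near: r.
  by split; near: r; [exact: nbhs_right_gt|exact: nbhs_right_le].
exists r => // z w w1 w2.
have [zI|zI] := pselect ((I `*` I) z); first exact: hr.
have out (u v : R) : ~ I u -> `|v| <= r -> L < `|u| /\ L < `|u + v|.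
  move=> uI vr; have h1 : L + 1 < `|u|.
    rewrite ltNge; apply/negP => hu; apply: uI.
    by rewrite /I/= in_itv/= -ler_norml.
  by have := lerB_normD u v; split; lra.
have [z1|z2] : ~ I z.1 \/ ~ I z.2 by apply/not_andP => -[a b]; apply: zI.
  have [a b] := out _ w.1 z1 w1.
  by rewrite !hL ?subrr ?normr0 ?ltW//=; left.
have [a b] := out _ w.2 z2 w2.
by rewrite !hL ?subrr ?normr0 ?ltW//=; right.
Unshelve. all: by end_near. Qed.

End continuous_measurable.

(** * Gaussian kernels and smoothing *)

Section gaussian_kernel.
Context {R : realType}.
Local Notation gm2 := (@std_normal R \x @std_normal R)%E.
Variable delta : R.
Hypothesis delta0 : 0 < delta.

Definition kernel u v y1 y2 : R := gaussian ((u - y1) / delta) * gaussian ((v - y2) / delta).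

Lemma kernel_ge0 u v y1 y2 : 0 <= kernel u v y1 y2.
Proof. by rewrite mulr_ge0 ?gaussian_ge0. Qed.

Lemma gaussian_le1 (x : R) : gaussian x <= 1.
Proof. by rewrite /gaussian expR_le1 oppr_le0 divr_ge0 ?sqr_ge0. Qed.

Lemma kernel_le1 u v y1 y2 : kernel u v y1 y2 <= 1.
Proof. by rewrite /kernel mulr_ile1 ?gaussian_ge0 ?gaussian_le1. Qed.

Lemma kernelE u v y1 y2 : kernel u v y1 y2 = \int[gm2]_t
  cos (t.1 / delta * u + t.2 / delta * v + - ((y1 * t.1 + y2 * t.2) / delta)).
Proof.
transitivity (\int[gm2]_t cos ((u - y1) / delta * t.1 + (v - y2) / delta * t.2 + 0)).
  rewrite mean_gm2_cos cos0 mulr1 /kernel /gaussian -expRD; congr expR.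
  by field; rewrite gt_eqF.
by apply: eq_Rintegral => t _; congr cos; field; rewrite gt_eqF.
Qed.

Section mean_kernel.
Context d (T : measurableType d) (P : probability T R).
Variables (U V : T -> R).
Hypotheses (mU : measurable_fun setT U) (mV : measurable_fun setT V).

Lemma bounded_mfun_cos_phase y1 y2 :
  bounded_mfun (fun z : (measurableTypeR R * measurableTypeR R) * T =>
    cos (z.1.1 / delta * U z.2 + z.1.2 / delta * V z.2 + - ((y1 * z.1.1 + y2 * z.1.2) / delta))).
Proof.
have m1 : measurable_fun setT (fun z : (measurableTypeR R * measurableTypeR R) * T => z.1.1 : R).
  have h : measurable_fun setT (fun z : (measurableTypeR R * measurableTypeR R) * T => z.1.1).
    by apply: measurableT_comp.
  by move=> _ B mB; exact: h.
have m2 : measurable_fun setT (fun z : (measurableTypeR R * measurableTypeR R) * T => z.1.2 : R).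
  have h : measurable_fun setT (fun z : (measurableTypeR R * measurableTypeR R) * T => z.1.2).
    by apply: measurableT_comp.
  by move=> _ B mB; exact: h.
have mU2 : measurable_fun setT (fun z : (measurableTypeR R * measurableTypeR R) * T => U z.2).
  by apply: measurableT_comp => //; exact: measurable_snd.
have mV2 : measurable_fun setT (fun z : (measurableTypeR R * measurableTypeR R) * T => V z.2).
  by apply: measurableT_comp => //; exact: measurable_snd.
apply: bounded_mfun_cos_comp; apply: measurable_funD.
  by apply: measurable_funD; apply: measurable_funM => //; exact: measurable_funM.
apply: measurableT_comp => //; apply: measurable_funM => //.
by apply: measurable_funD; exact: measurable_funM.
Qed.

Lemma mean_kernel y1 y2 : \int[P]_w kernel (U w) (V w) y1 y2 =
  \int[gm2]_t \int[P]_w cos (t.1 / delta * U w + t.2 / delta * V w +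
    - ((y1 * t.1 + y2 * t.2) / delta)).
Proof.
have b := bounded_mfun_cos_phase y1 y2.
rewrite -(mean_fubini1 gm2 P b) (mean_fubini2 gm2 P b).
by apply: eq_Rintegral => w _; rewrite kernelE.
Qed.

End mean_kernel.

Lemma mean_kernel_cvg d (T : measurableType d) (P : probability T R)
    (U V : nat -> T -> R) y1 y2 :
  (forall n, measurable_fun setT (U n)) -> (forall n, measurable_fun setT (V n)) ->
  (forall a b th, \int[P]_w cos (a * U n w + b * V n w + th) @[n --> \oo] -->
    expR (- ((a ^+ 2 + b ^+ 2) / 2)) * cos th) ->
  \int[P]_w kernel (U n w) (V n w) y1 y2 @[n --> \oo] -->
  \int[gm2]_z kernel z.1 z.2 y1 y2.
Proof.
move=> mU mV CF.
have m1 : measurable_fun setT (fun z : measurableTypeR R * measurableTypeR R => z.1 : R).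
  exact: measurable_fstR.
have m2 : measurable_fun setT (fun z : measurableTypeR R * measurableTypeR R => z.2 : R).
  exact: measurable_sndR.
rewrite (mean_kernel gm2 m1 m2).
under eq_fun do rewrite mean_kernel//.
apply: (@mean_dct _ _ _ gm2 _ _ 1).
- move=> n; have b := bounded_mfun_cos_phase (mU n) (mV n) y1 y2.
  exact: (bounded_mfun_mean1 P b).1.
- move=> n t; apply: norm_mean_le; last by move=> w; rewrite ler_norml cos_geN1 cos_le1.
  have b := bounded_mfun_cos_phase (mU n) (mV n) y1 y2.
  exact: (bounded_mfun_pair1 b).
- by move=> t; rewrite mean_gm2_cos; exact: CF.
Qed.

End gaussian_kernel.

Section gaussian_smoothing.
Context {R : realType}.
Notation leb := (@lebesgue_measure R).
Local Notation gm2 := (@std_normal R \x @std_normal R)%E.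
Variables delta L : R.
Hypotheses (delta0 : 0 < delta) (L0 : 0 < L).

Let LL : - L < L. Proof. by rewrite -subr_gt0 opprK addr_gt0. Qed.

(* Lebesgue measure on [[-L, L]] is used through the uniform law, so that all the
   integrals are means of bounded functions. *)
Definition unif : probability (measurableTypeR R) R := uniform_prob LL.

(** [L + L] undoes the density of the uniform law, and [normal_peak 1 / delta] normalises a Gaussian
    kernel of width [delta]. *)
Definition smoothing_factor : R := (L + L) * (normal_peak 1 / delta).
Local Notation c := smoothing_factor.

Lemma bounded_mfun_affine (k : R -> R) u : bounded_mfun k ->
  bounded_mfun (fun x : R => k (u + delta * x)).
Proof.
move=> bk; have ma : measurable_fun setT (fun x : R => u + delta * x).
  by apply: measurable_funD => //; exact: measurable_funM.
exact: (bounded_mfun_comp ma bk).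
Qed.

Lemma bounded_mfun_gaussian w : bounded_mfun (fun y : R => gaussian ((w - y) / delta)).
Proof.
split; last by exists 1 => y; rewrite ger0_norm ?gaussian_ge0 ?gaussian_le1.
apply: measurableT_comp; first exact: measurable_gaussian.
by apply: measurable_funM => //; exact: measurable_funB.
Qed.

Lemma mean_unif_gaussian (k : R -> R) u : bounded_mfun k -> (forall x, 0 <= k x) ->
  (forall x, L < `|x| -> k x = 0) ->
  c * \int[unif]_y (k y * gaussian ((u - y) / delta)) = \int[@std_normal R]_x k (u + delta * x).
Proof.
move=> bk k0 kL.
have pk0 : 0 < normal_peak 1 :> R by apply: normal_peak_gt0; exact: oner_neq0.
have b1 := bounded_mfunM bk (bounded_mfun_gaussian u).
have b2 := bounded_mfun_affine u bk.
have E1 := EFin_mean unif (bounded_mfunT b1); have E2 := EFin_mean std_normal (bounded_mfunT b2).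
apply: EFin_inj; rewrite EFinM -E1 -E2.
rewrite [X in (_ * X)%E](@integral_uniform _ _ _ LL
  (fun y => (k y * gaussian ((u - y) / delta))%:E)); last 2 first.
- by apply/measurable_EFinP; exact: b1.1.
- by move=> x; rewrite lee_fin mulr_ge0 ?gaussian_ge0.
rewrite ge0_integral_gm; last 2 first.
- by apply/measurable_EFinP; exact: b2.1.
- by move=> x; rewrite lee_fin.
have -> : (\int[leb]_(x in `[(- L)%R, L]) (k x * gaussian ((u - x) / delta))%:E =
    \int[leb]_x (k x * gaussian ((u - x) / delta))%:E)%E.
  rewrite integral_mkcond; apply: eq_integral => x _; rewrite patchE.
  case: ifPn => // /negP xL; rewrite kL ?mul0r// ltNge; apply/negP => h; apply: xL.
  by rewrite inE/= in_itv/= -ler_norml.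
rewrite (@ge0_integral_affine _ delta u); last 3 first.
- exact: delta0.
- by apply/measurable_EFinP; exact: b1.1.
- by move=> x; rewrite lee_fin mulr_ge0 ?gaussian_ge0.
rewrite !muleA -!EFinM; congr (_%:E * _)%E.
  by rewrite /c opprK; field; rewrite !gt_eqF// addr_gt0.
apply: eq_integral => x _; rewrite -EFinM addrC; congr (_ * _)%:E.
have -> : (u - (u + delta * x)) / delta = - x by field; rewrite gt_eqF.
by rewrite /gaussian sqrrN.
Qed.

Variable g : R * R -> R.
Let g' : measurableTypeR R * measurableTypeR R -> R := g.
Hypotheses (bg : bounded_mfun g') (g0 : forall z, 0 <= g z)
  (gL : forall z, L < `|z.1| \/ L < `|z.2| -> g z = 0).

Let measurable_affine (a b : R) :
  measurable_fun setT (fun x : measurableTypeR R => a + b * x : measurableTypeR R).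
Proof.
have h : measurable_fun setT (fun x : R => a + b * x).
  by apply: measurable_funD => //; exact: measurable_funM.
by move=> _ B mB; exact: h.
Qed.

Definition smooth u v : R := \int[gm2]_x g (u + delta * x.1, v + delta * x.2).

Lemma bounded_mfun_shift u v : bounded_mfun
  (fun x : measurableTypeR R * measurableTypeR R => g (u + delta * x.1, v + delta * x.2)).
Proof.
apply: (@bounded_mfun_comp _ _ _ _ _ (fun x : measurableTypeR R * measurableTypeR R =>
  (u + delta * x.1, v + delta * x.2) : measurableTypeR R * measurableTypeR R) g') => //.
apply: measurable_fun_pair.
  by apply: (measurableT_comp (measurable_affine u delta)).
by apply: (measurableT_comp (measurable_affine v delta)).
Qed.

Lemma bounded_mfun_kernel u v : bounded_mfun
  (fun y : measurableTypeR R * measurableTypeR R => kernel delta u v y.1 y.2).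
Proof.
have mG w := (bounded_mfunT (bounded_mfun_gaussian w)).1.
split; last by exists 1 => y; rewrite ger0_norm ?kernel_ge0 ?kernel_le1.
apply: measurable_funM.
  by apply: (measurableT_comp (mG u)).
by apply: (measurableT_comp (mG v)).
Qed.

(** A substitution in each coordinate moves the Gaussian noise out of the argument of [g]: the point
    [(u, v)] then occurs only in the kernel, whose mean is an average of cosines. *)
Lemma smoothE u v : smooth u v =
  c ^+ 2 * \int[(unif \x unif)%E]_y (g y * kernel delta u v y.1 y.2).
Proof.
have bK := bounded_mfun_kernel u v.
rewrite (mean_fubini1 unif unif (bounded_mfunM bg bK)).
have bsh1 y1 : @bounded_mfun _ R R (fun y2 => g (y1, y2)).
  by have [m b] := bounded_mfun_pair1 bg y1; split => // _ B mB; exact: m.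
have bsh : bounded_mfun (fun z : measurableTypeR R * measurableTypeR R => g (z.1, v + delta * z.2)).
  apply: (@bounded_mfun_comp _ _ _ _ _ (fun x : measurableTypeR R * measurableTypeR R =>
    (x.1, v + delta * x.2) : measurableTypeR R * measurableTypeR R) g') => //.
  apply: measurable_fun_pair => //.
  by apply: (measurableT_comp (measurable_affine v delta)).
pose k y1 := \int[@std_normal R]_x g (y1, v + delta * x).
have bk : @bounded_mfun _ R R k.
  by have [m b] := bounded_mfun_mean1 std_normal bsh; split => // _ B mB; exact: m.
have inner y1 : k y1 * gaussian ((u - y1) / delta) =
    c * \int[unif]_y2 (g (y1, y2) * kernel delta u v y1 y2).
  rewrite /k -(mean_unif_gaussian v (bsh1 y1)); last 2 first.
  - by move=> x; exact: g0.
  - by move=> x Lx; apply: gL; right.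
  rewrite -mulrA; congr (_ * _); rewrite mulrC -mean_bZ; last first.
    exact: (bounded_mfunM (bounded_mfunT (bsh1 y1)) (bounded_mfunT (bounded_mfun_gaussian v))).
  by apply: eq_Rintegral => y _; rewrite /kernel mulrCA.
rewrite /smooth (mean_fubini1 std_normal std_normal (bounded_mfun_shift u v)).
transitivity (\int[@std_normal R]_x k (u + delta * x)) => //.
rewrite -(mean_unif_gaussian u bk); last 2 first.
- by move=> y1; apply: Rintegral_ge0 => x _; exact: g0.
- move=> y1 Ly; rewrite /k -[RHS](Rintegral_prob_cst std_normal 0).
  by apply: eq_Rintegral => x _; apply: gL; left.
rewrite expr2 -mulrA; congr (_ * _); rewrite -mean_bZ; last first.
  exact: (bounded_mfun_mean1 unif (bounded_mfunM bg bK)).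
by apply: eq_Rintegral => y _; exact: inner.
Qed.

Lemma bounded_mfun_joint_kernel d (T : measurableType d) (U V : T -> R) :
  measurable_fun setT U -> measurable_fun setT V ->
  bounded_mfun (fun z : (measurableTypeR R * measurableTypeR R) * T =>
    kernel delta (U z.2) (V z.2) z.1.1 z.1.2).
Proof.
move=> mU mV; split; last by exists 1 => y; rewrite ger0_norm ?kernel_ge0 ?kernel_le1.
have m1 : measurable_fun setT (fun z : (measurableTypeR R * measurableTypeR R) * T => z.1.1 : R).
  have h : measurable_fun setT (fun z : (measurableTypeR R * measurableTypeR R) * T => z.1.1).
    by apply: measurableT_comp.
  by move=> _ B mB; exact: h.
have m2 : measurable_fun setT (fun z : (measurableTypeR R * measurableTypeR R) * T => z.1.2 : R).
  have h : measurable_fun setT (fun z : (measurableTypeR R * measurableTypeR R) * T => z.1.2).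
    by apply: measurableT_comp.
  by move=> _ B mB; exact: h.
have mU2 : measurable_fun setT (fun z : (measurableTypeR R * measurableTypeR R) * T => U z.2).
  by apply: measurableT_comp => //; exact: measurable_snd.
have mV2 : measurable_fun setT (fun z : (measurableTypeR R * measurableTypeR R) * T => V z.2).
  by apply: measurableT_comp => //; exact: measurable_snd.
apply: measurable_funM; apply: (measurableT_comp measurable_gaussian);
  by apply: measurable_funM => //; exact: measurable_funB.
Qed.

Lemma bounded_mfun_smooth d (T : measurableType d) (U V : T -> R) :
  measurable_fun setT U -> measurable_fun setT V ->
  bounded_mfun (fun w => smooth (U w) (V w)).
Proof.
move=> mU mV; have bJ := bounded_mfun_joint_kernel mU mV.
have bg1 : bounded_mfun (fun z : (measurableTypeR R * measurableTypeR R) * T => g z.1).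
  by apply: (@bounded_mfun_comp _ _ _ _ _ fst g') => //; exact: measurable_fst.
rewrite (_ : (fun _ => _) = fun w => c ^+ 2 *
    \int[(unif \x unif)%E]_y (g y * kernel delta (U w) (V w) y.1 y.2)).
  apply: bounded_mfunM; first exact: bounded_mfun_cst.
  exact: (bounded_mfun_mean2 (unif \x unif)%E (bounded_mfunM bg1 bJ)).
by apply/funext => w; exact: smoothE.
Qed.

Lemma mean_smooth d (T : measurableType d) (P : probability T R) (U V : T -> R) :
  measurable_fun setT U -> measurable_fun setT V ->
  \int[P]_w smooth (U w) (V w) =
  c ^+ 2 * \int[(unif \x unif)%E]_y (g y * \int[P]_w kernel delta (U w) (V w) y.1 y.2).
Proof.
move=> mU mV; have bJ := bounded_mfun_joint_kernel mU mV.
have bg1 : bounded_mfun (fun z : (measurableTypeR R * measurableTypeR R) * T => g z.1).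
  by apply: (@bounded_mfun_comp _ _ _ _ _ fst g') => //; exact: measurable_fst.
have bF := bounded_mfunM bg1 bJ.
transitivity (c ^+ 2 * \int[P]_w \int[(unif \x unif)%E]_y
    (g y * kernel delta (U w) (V w) y.1 y.2)).
  rewrite -mean_bZ; first by apply: eq_Rintegral => w _; exact: smoothE.
  exact: (bounded_mfun_mean2 (unif \x unif)%E bF).
rewrite -(mean_fubini2 (unif \x unif)%E P bF) (mean_fubini1 (unif \x unif)%E P bF).
congr (_ * _); apply: eq_Rintegral => y _ /=; rewrite mean_bZ//.
exact: (bounded_mfun_pair1 bJ).
Qed.

Lemma mean_smooth_cvg d (T : measurableType d) (P : probability T R)
    (U V : nat -> T -> R) :
  (forall n, measurable_fun setT (U n)) -> (forall n, measurable_fun setT (V n)) ->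
  (forall a b th, \int[P]_w cos (a * U n w + b * V n w + th) @[n --> \oo] -->
    expR (- ((a ^+ 2 + b ^+ 2) / 2)) * cos th) ->
  \int[P]_w smooth (U n w) (V n w) @[n --> \oo] -->
  \int[gm2]_z smooth z.1 z.2.
Proof.
move=> mU mV CF.
have m1 : measurable_fun setT (fun z : measurableTypeR R * measurableTypeR R => z.1 : R).
  exact: measurable_fstR.
have m2 : measurable_fun setT (fun z : measurableTypeR R * measurableTypeR R => z.2 : R).
  exact: measurable_sndR.
rewrite (mean_smooth gm2 m1 m2); under eq_fun do rewrite mean_smooth//.
apply: cvgM; first exact: cvg_cst.
have [mg [M gM]] := bg.
apply: (@mean_dct _ _ _ (unif \x unif)%E _ _ M).
- move=> n; apply: measurable_funM => //.
  exact: (bounded_mfun_mean1 P (bounded_mfun_joint_kernel (mU n) (mV n))).1.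
- move=> n y; rewrite -[M]mulr1 normrM; apply: ler_pM => //.
  apply: norm_mean_le; last by move=> w; rewrite ger0_norm ?kernel_ge0 ?kernel_le1.
  exact: (bounded_mfun_pair1 (bounded_mfun_joint_kernel (mU n) (mV n))).
- move=> y; apply: cvgM; first exact: cvg_cst.
  exact: mean_kernel_cvg.
Qed.

End gaussian_smoothing.

Section levy_continuity.
Context {R : realType}.
Local Notation gm2 := (@std_normal R \x @std_normal R)%E.

Let bounded_continuous2 (g : R * R -> R) (M : R) : continuous g -> (forall z, `|g z| <= M) ->
  bounded_mfun (g : measurableTypeR R * measurableTypeR R -> R).
Proof. by move=> cg gM; split; [exact: continuous_measurable2|exists M]. Qed.

Lemma integral_gm2_sqr : exists2 V : R, (\int[gm2]_x (x.1 ^+ 2)%:E = V%:E)%E &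
  (\int[gm2]_x (x.2 ^+ 2)%:E = V%:E)%E.
Proof.
have [V hV] := @integral_gm_sqr R; exists V.
  rewrite fubini_tonelli1; last 2 first.
  - by apply/measurable_EFinP; apply: measurable_funX; exact: measurable_fstR.
  - by move=> z; rewrite lee_fin sqr_ge0.
  rewrite -hV; apply: eq_integral => x _; rewrite /fubini_F /= integral_cst//.
  by rewrite [X in (_ * X)%E](_ : _ = 1%E) ?mule1//; exact: (@probability_setT _ _ _ (@std_normal R)).
rewrite fubini_tonelli1; last 2 first.
- by apply/measurable_EFinP; apply: measurable_funX; exact: measurable_sndR.
- by move=> z; rewrite lee_fin sqr_ge0.
under eq_integral do rewrite /fubini_F /= hV.
rewrite integral_cst//.
by rewrite [X in (_ * X)%E](_ : _ = 1%E) ?mule1//; exact: (@probability_setT _ _ _ (@std_normal R)).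
Qed.

(** Displacements of size at most [r] cost [eps]. Larger ones cost at most [2 M], which is then
    below [C x^2], so their share is bounded by the second moment [V], as in Chebyshev's
    inequality. *)
Lemma smooth_approx (g : R * R -> R) (M eps r : R) : continuous g ->
  (forall z, `|g z| <= M) -> 0 < r -> 0 < eps ->
  (forall z w : R * R, `|w.1| <= r -> `|w.2| <= r ->
    `|g (z.1 + w.1, z.2 + w.2) - g z| <= eps) ->
  exists2 delta : R, 0 < delta & forall u v, `|smooth delta g u v - g (u, v)| <= 2 * eps.
Proof.
move=> cg gM r0 eps0 hr.
have [V V1 V2] := integral_gm2_sqr.
have V0 : 0 <= V by rewrite -lee_fin -V1 integral_ge0// => x _; rewrite lee_fin sqr_ge0.
have M0 : 0 <= M by apply: le_trans (gM (0, 0)).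
pose k := 4 * M / r ^+ 2 * V + 1.
have k0 : 0 < k by rewrite ltr_wpDl// mulr_ge0// divr_ge0 ?sqr_ge0 ?mulr_ge0.
(* The Chebyshev part is [(k - 1) delta^2]; [delta <= 1] and [delta k <= eps] bring it below
   [eps]. *)
pose delta := Num.min 1 (eps / k).
have d0 : 0 < delta by rewrite lt_min ltr01 divr_gt0.
exists delta => // u v.
have bsh := bounded_mfun_shift delta (bounded_continuous2 cg gM) u v.
have bd : bounded_mfun (fun x : measurableTypeR R * measurableTypeR R =>
    g (u + delta * x.1, v + delta * x.2) - g (u, v)).
  exact: (bounded_mfunD bsh (bounded_mfun_cst (- g (u, v)))).
have -> : smooth delta g u v - g (u, v) =
    \int[gm2]_x (g (u + delta * x.1, v + delta * x.2) - g (u, v)).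
  rewrite (mean_bB gm2 bsh (bounded_mfun_cst (g (u, v)))).
  by rewrite Rintegral_prob_cst.
have ib := integrable_bounded_mfun gm2 bd.
apply: le_trans (le_normr_Rintegral _ ib) _ => //.
pose C := 2 * M * delta ^+ 2 / r ^+ 2.
have C0 : 0 <= C by rewrite divr_ge0 ?sqr_ge0// mulr_ge0 ?sqr_ge0// mulr_ge0.
have pw x1 x2 : `|g (u + delta * x1, v + delta * x2) - g (u, v)| <=
    eps + (C * x1 ^+ 2 + C * x2 ^+ 2).
  have q0 (y : R) : 0 <= C * y ^+ 2 by rewrite mulr_ge0 ?sqr_ge0.
  have far (y : R) : r < `|delta * y| -> 2 * M <= C * y ^+ 2.
    move=> ry; have -> : C * y ^+ 2 = 2 * M * (`|delta * y| ^+ 2 / r ^+ 2).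
      by rewrite real_normK ?num_real// exprMn /C; ring.
    rewrite ler_peMr ?mulr_ge0// ler_pdivlMr ?exprn_gt0// mul1r.
    by apply: lerXn2r; rewrite ?nnegrE ?normr_ge0 ?(ltW r0) ?(ltW ry).
  have g2 : `|g (u + delta * x1, v + delta * x2) - g (u, v)| <= 2 * M.
    have := ler_normB (g (u + delta * x1, v + delta * x2)) (g (u, v)).
    by have := gM (u + delta * x1, v + delta * x2); have := gM (u, v); lra.
  have q1 := q0 x1; have q2 := q0 x2.
  have [h1|h1] := leP `|delta * x1| r; last by have := far _ h1; lra.
  have [h2|h2] := leP `|delta * x2| r; last by have := far _ h2; lra.
  by have := hr (u, v) (delta * x1, delta * x2) h1 h2; rewrite /=; lra.
rewrite -lee_fin -EFin_mean; last first.
  have [m [N hN]] := bd; split; first by apply: measurableT_comp.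
  by exists N => x; rewrite normr_id.
have m1 : measurable_fun setT (fun x : measurableTypeR R * measurableTypeR R => (x.1 ^+ 2)%:E).
  by apply/measurable_EFinP; apply: measurable_funX; exact: measurable_fstR.
have m2 : measurable_fun setT (fun x : measurableTypeR R * measurableTypeR R => (x.2 ^+ 2)%:E).
  by apply/measurable_EFinP; apply: measurable_funX; exact: measurable_sndR.
have s0 (y : R) : (0 <= C%:E * (y ^+ 2)%:E)%E by rewrite -EFinM lee_fin mulr_ge0 ?sqr_ge0.
have mC1 := measurable_funeM C%:E m1; have mC2 := measurable_funeM C%:E m2.
apply: (@le_trans _ _ (\int[gm2]_x (eps%:E + (C%:E * (x.1 ^+ 2)%:E + C%:E * (x.2 ^+ 2)%:E)))%E).
  apply: ge0_le_integral => //.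
  - by apply/measurable_EFinP; apply: measurableT_comp => //; exact: bd.1.
  - by apply: emeasurable_funD => //; exact: emeasurable_funD.
  - by move=> x _; rewrite -!EFinM -!EFinD lee_fin; exact: pw.
have sq0 (y : R) : (0 <= (y ^+ 2)%:E)%E by rewrite lee_fin sqr_ge0.
have q1 : (\int[gm2]_x (C%:E * (x.1 ^+ 2)%:E) = (C * V)%:E)%E.
  by rewrite ge0_integralZl// V1.
have q2 : (\int[gm2]_x (C%:E * (x.2 ^+ 2)%:E) = (C * V)%:E)%E.
  by rewrite ge0_integralZl// V2.
have q3 : (\int[gm2]_x eps%:E = eps%:E)%E.
  rewrite integral_cst// [X in (_ * X)%E](_ : _ = 1%E) ?mule1//.
  exact: (@probability_setT _ _ _ gm2).
rewrite ge0_integralD//; last 3 first.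
- by move=> x _; rewrite lee_fin ltW.
- by move=> x _; rewrite adde_ge0.
- exact: emeasurable_funD.
rewrite ge0_integralD// q1 q2 q3 -!EFinD lee_fin.
have dk : delta * k <= eps by rewrite -ler_pdivlMr// /delta ge_min lexx orbT.
have d1 : delta <= 1 by rewrite /delta ge_min lexx.
have d2 : delta ^+ 2 <= delta by rewrite expr2 ler_piMr// ltW.
have w0 : 0 <= 4 * M / r ^+ 2 * V by rewrite mulr_ge0// divr_ge0 ?sqr_ge0// mulr_ge0.
have -> : C * V + C * V = (4 * M / r ^+ 2 * V) * delta ^+ 2 by rewrite /C; ring.
have h1 := ler_wpM2l w0 d2.
have h2 : (4 * M / r ^+ 2 * V) * delta <= delta * k.
  by rewrite mulrC ler_wpM2l ?(ltW d0)// /k lerDl.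
by move: h1 h2 dk; move: (4 * M / r ^+ 2 * V) (delta * k) => X Y; lra.
Qed.

Lemma mean_cvg_compact_support (g : R * R -> R) (M L : R)
    d (T : measurableType d) (P : probability T R) (U V : nat -> T -> R) :
  continuous g -> (forall z, `|g z| <= M) -> (forall z, 0 <= g z) -> 0 < L ->
  (forall z, L < `|z.1| \/ L < `|z.2| -> g z = 0) ->
  (forall n, measurable_fun setT (U n)) -> (forall n, measurable_fun setT (V n)) ->
  (forall a b th, \int[P]_w cos (a * U n w + b * V n w + th) @[n --> \oo] -->
    expR (- ((a ^+ 2 + b ^+ 2) / 2)) * cos th) ->
  \int[P]_w g (U n w, V n w) @[n --> \oo] --> \int[gm2]_z g z.
Proof.
move=> cg gM g0 L0 gL mU mV CF; apply/cvgrPdist_le => e e0.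
(* Smoothing costs [2 eps] for the sequence and [2 eps] for the limit, the convergence of the
   smoothed means [eps]. *)
pose eps := e / 6; have eps0 : 0 < eps by rewrite divr_gt0.
have [r r0 hr] := unif_continuous_compact_support cg eps0 gL.
have [delta d0 hd] := smooth_approx cg gM r0 eps0 hr.
have bg := bounded_continuous2 cg gM.
have C := mean_smooth_cvg d0 L0 bg g0 gL mU mV CF.
have close d' (T' : measurableType d') (Q : probability T' R) (A B : T' -> R) :
    measurable_fun setT A -> measurable_fun setT B ->
    `|\int[Q]_w smooth delta g (A w) (B w) - \int[Q]_w g (A w, B w)| <= 2 * eps.
  move=> mA mB.
  have mpair : measurable_fun setT (fun w => (A w, B w) : measurableTypeR R * measurableTypeR R).
    by apply: measurable_fun_pair => _ S mS; [exact: mA|exact: mB].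
  have b1 : bounded_mfun (fun w => g (A w, B w)).
    exact: (bounded_mfun_comp mpair bg).
  have b2 : bounded_mfun (fun w => smooth delta g (A w) (B w)).
    by have := bounded_mfun_smooth d0 L0 bg g0 gL mA mB.
  rewrite -(mean_bB Q b2 b1); apply: norm_mean_le; last by move=> w; exact: hd.
  exact: bounded_mfunB.
have h1 : measurable_fun setT (fun z : measurableTypeR R * measurableTypeR R => z.1 : R).
  exact: measurable_fstR.
have h2 : measurable_fun setT (fun z : measurableTypeR R * measurableTypeR R => z.2 : R).
  exact: measurable_sndR.
have k2 := close _ _ gm2 _ _ h1 h2.
have k3 : \int[gm2]_z g (z.1, z.2) = \int[gm2]_z g z.
  by apply: eq_Rintegral => -[].
rewrite k3 in k2.
move/cvgrPdist_le : C => /(_ _ eps0) [N _ hN]; exists N => // n Nn.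
have k1 := close _ _ P _ _ (mU n) (mV n).
have := hN n Nn; move: k1 k2; rewrite /=.
move: (\int[P]_w smooth _ _ _ _) (\int[P]_w g _)
  (\int[gm2]_w smooth _ _ _ _) (\int[gm2]_z g z) => a b x y h3 h4 h5.
have -> : y - b = - (x - y) + (x - a) + (a - b) by ring.
have := ler_normD (- (x - y) + (x - a)) (a - b); have := ler_normD (- (x - y)) (x - a).
have eE : e = 6 * eps by rewrite /eps; field.
by rewrite normrN eE; lra.
Qed.

Definition cutoff (L x : R) : R := Num.max 0 (Num.min 1 (L + 1 - `|x|)).

Lemma cutoff_ge0 L x : 0 <= cutoff L x. Proof. by rewrite /cutoff le_max lexx. Qed.

Lemma cutoff_le1 L x : cutoff L x <= 1.
Proof. by rewrite /cutoff ge_max ler01 ge_min lexx. Qed.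

Lemma cutoff_eq0 L x : L + 1 < `|x| -> cutoff L x = 0.
Proof.
move=> Lx; have h : L + 1 - `|x| <= 0 by lra.
rewrite /cutoff; apply/max_idPl; rewrite ge_min h orbT//.
Qed.

Lemma cutoff_eq1 L x : `|x| <= L -> cutoff L x = 1.
Proof.
move=> Lx; have h : 1 <= L + 1 - `|x| by lra.
by rewrite /cutoff (min_idPl h); apply/max_idPr.
Qed.

Lemma continuous_cutoff2 L : continuous (fun z : R * R => cutoff L z.1 * cutoff L z.2).
Proof.
have cc : continuous (cutoff L).
  have -> : cutoff L = (fun=> 0 : R^o) \max ((fun=> 1 : R^o) \min (fun x => L + 1 - `|x| : R^o)).
    by apply/funext.
  move=> x; apply: continuous_max; first exact: cst_continuous.
  apply: continuous_min; first exact: cst_continuous.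
  apply: (@continuousB _ R^o _ (fun=> L + 1) (fun x : R => `|x|)); first exact: cst_continuous.
  exact: norm_continuous.
move=> z; apply: (@continuousM _ _ (fun z => cutoff L z.1) (fun z => cutoff L z.2)).
  by apply: (@continuous_comp _ _ _ fst (cutoff L)); [exact: cvg_fst|exact: cc].
by apply: (@continuous_comp _ _ _ snd (cutoff L)); [exact: cvg_snd|exact: cc].
Qed.

Lemma cutoff2_ge0 L (z : R * R) : 0 <= cutoff L z.1 * cutoff L z.2.
Proof. by rewrite mulr_ge0 ?cutoff_ge0. Qed.

Lemma cutoff2_le1 L (z : R * R) : cutoff L z.1 * cutoff L z.2 <= 1.
Proof. by rewrite mulr_ile1 ?cutoff_ge0 ?cutoff_le1. Qed.

Lemma norm_cutoff2_le1 L (z : R * R) : `|cutoff L z.1 * cutoff L z.2| <= 1.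
Proof. by rewrite ger0_norm ?cutoff2_ge0 ?cutoff2_le1. Qed.

(** Tightness of the normal law, from which the truncation levels [k] below are taken. *)
Lemma cvg_mean_cutoff2 :
  \int[gm2]_z (cutoff k%:R z.1 * cutoff k%:R z.2) @[k --> \oo] --> (1 : R).
Proof.
pose chi (k : nat) (z : R * R) := cutoff k%:R z.1 * cutoff k%:R z.2.
suff : \int[gm2]_z chi k z @[k --> \oo] --> (1 : R) by [].
rewrite -(Rintegral_prob_cst gm2 1).
apply: (@mean_dct _ _ _ gm2 chi _ 1).
- by move=> n; exact: (bounded_continuous2 (@continuous_cutoff2 n%:R) (norm_cutoff2_le1 n%:R)).1.
- by move=> n z; exact: norm_cutoff2_le1.
move=> z; apply: cvg_near_cst; near=> n.
rewrite /chi !cutoff_eq1 ?mulr1//.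
  by near: n; exact: nbhs_infty_ger.
by near: n; exact: nbhs_infty_ger.
Unshelve. all: by end_near. Qed.

(** Tightness of the sequence need not be assumed: the mass outside a large square is measured by
    the mean of [1 - chi k], whose limit is given by the compactly supported case applied to [chi k]
    itself. *)
Theorem levy_continuity2 (h : R * R -> R) (M : R)
    d (T : measurableType d) (P : probability T R) (U V : nat -> T -> R) :
  continuous h -> (forall z, `|h z| <= M) ->
  (forall n, measurable_fun setT (U n)) -> (forall n, measurable_fun setT (V n)) ->
  (forall a b th, \int[P]_w cos (a * U n w + b * V n w + th) @[n --> \oo] -->
    expR (- ((a ^+ 2 + b ^+ 2) / 2)) * cos th) ->
  \int[P]_w h (U n w, V n w) @[n --> \oo] --> \int[gm2]_z h z.
Proof.
move=> ch hM mU mV CF.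
have M0 : 0 <= M by apply: le_trans (hM (0, 0)).
pose chi (k : nat) (z : R * R) := cutoff k%:R z.1 * cutoff k%:R z.2.
have chi0 k z : 0 <= chi k z by exact: cutoff2_ge0.
have chi1 k z : chi k z <= 1 by exact: cutoff2_le1.
have nchi k z : `|chi k z| <= 1 by exact: norm_cutoff2_le1.
have cchi k : continuous (chi k) by exact: continuous_cutoff2.
have bchi k := bounded_continuous2 (cchi k) (nchi k).
have bh := bounded_continuous2 ch hM.
have chiE k z : (k%:R + 1 < `|z.1| \/ k%:R + 1 < `|z.2|) -> chi k z = 0.
  by rewrite /chi => -[] /cutoff_eq0 ->; rewrite ?mul0r ?mulr0.
apply/cvgrPdist_le => e e0.
pose eps := e / (4 * M + 2); have m2 : 0 < 4 * M + 2 by lra.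
have eps0 : 0 < eps by rewrite divr_gt0.
have [k hk] : exists k, `|1 - \int[gm2]_z chi k z| <= eps.
  move/cvgrPdist_le : cvg_mean_cutoff2 => /(_ _ eps0) [N _ hN]; exists N.
  by apply: hN => /=.
have L0 : 0 < k%:R + 1 :> R by rewrite ltr_wpDl.
have C1 := mean_cvg_compact_support (cchi k) (nchi k) (chi0 k) L0 (chiE k) mU mV CF.
(* The compactly supported case asks for nonnegative functions, so [h] is shifted by [M] before
   truncation and [M * chi k] is subtracted again. *)
pose g z := (h z + M) * chi k z.
have cg : continuous g.
  move=> z; apply: (@continuousM _ _ (fun z => h z + M) (chi k)); last exact: cchi.
  by apply: (@continuousD _ R^o _ h (cst M)); [exact: ch|exact: cst_continuous].
have hM0 z : 0 <= h z + M by have := hM z; rewrite ler_norml => /andP[]; lra.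
have g0 z : 0 <= g z by rewrite mulr_ge0.
have gM z : `|g z| <= 2 * M.
  rewrite ger0_norm// -[leRHS]mulr1 ler_pM//.
  by have := hM z; rewrite ler_norml => /andP[]; lra.
have gE z : (k%:R + 1 < `|z.1| \/ k%:R + 1 < `|z.2|) -> g z = 0.
  by move=> /chiE; rewrite /g => ->; rewrite mulr0.
have C2 := mean_cvg_compact_support cg gM g0 L0 gE mU mV CF.
have key d' (T' : measurableType d') (Q : probability T' R) (A B : T' -> R) :
    measurable_fun setT A -> measurable_fun setT B ->
    `|\int[Q]_w h (A w, B w) - (\int[Q]_w g (A w, B w) - M * \int[Q]_w chi k (A w, B w))| <=
    M * (1 - \int[Q]_w chi k (A w, B w)).
  move=> mA mB.
  have mpair : measurable_fun setT (fun w => (A w, B w) : measurableTypeR R * measurableTypeR R).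
    by apply: measurable_fun_pair => _ S mS; [exact: mA|exact: mB].
  have b1 := bounded_mfun_comp mpair bh.
  have b2 := bounded_mfun_comp mpair (bounded_continuous2 cg gM).
  have b3 := bounded_mfun_comp mpair (bchi k).
  have b4 : bounded_mfun (fun w => M * chi k (A w, B w)) by exact: (bounded_mfunM (bounded_mfun_cst M) b3).
  have b5 : bounded_mfun (fun w => g (A w, B w) - M * chi k (A w, B w)) by exact: bounded_mfunB.
  have -> : M * (1 - \int[Q]_w chi k (A w, B w)) =
      \int[Q]_w (M - M * chi k (A w, B w)).
    by rewrite (mean_bB Q (bounded_mfun_cst M) b4) (Rintegral_prob_cst Q M) (mean_bZ Q M b3) mulrBr mulr1.
  rewrite -(mean_bZ Q M b3) -(mean_bB Q b2 b4) -(mean_bB Q b1 b5).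
  apply: norm_mean_le_mean.
  - by apply: integrable_bounded_mfun; exact: bounded_mfunB.
  - by apply: integrable_bounded_mfun; apply: bounded_mfunB => //; exact: bounded_mfun_cst.
  move=> w; rewrite /g.
  have -> : h (A w, B w) - ((h (A w, B w) + M) * chi k (A w, B w) - M * chi k (A w, B w)) =
    h (A w, B w) * (1 - chi k (A w, B w)) by ring.
  rewrite normrM (ger0_norm (_ : 0 <= 1 - _)) ?subr_ge0//.
  have -> : M - M * chi k (A w, B w) = M * (1 - chi k (A w, B w)) by ring.
  by rewrite ler_wpM2r ?subr_ge0.
have h1 : measurable_fun setT (fun z : measurableTypeR R * measurableTypeR R => z.1 : R).
  exact: measurable_fstR.
have h2 : measurable_fun setT (fun z : measurableTypeR R * measurableTypeR R => z.2 : R).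
  exact: measurable_sndR.
have kg := key _ _ gm2 _ _ h1 h2.
have k3 (f : R * R -> R) : \int[gm2]_z f (z.1, z.2) = \int[gm2]_z f z.
  by apply: eq_Rintegral => -[].
rewrite !k3 in kg.
move/cvgrPdist_le : C1 => /(_ _ eps0) [N1 _ hN1].
move/cvgrPdist_le : C2 => /(_ _ eps0) [N2 _ hN2].
exists (maxn N1 N2) => // n /=; rewrite geq_max => /andP[n1 n2].
have kn := key _ _ P _ _ (mU n) (mV n).
have := hN1 n n1; have := hN2 n n2; move: kn kg hk; rewrite /=.
move: (\int[P]_w h _) (\int[P]_w g _) (\int[P]_w chi _ _) => a b c.
move: (\int[gm2]_w h _) (\int[gm2]_w g _) (\int[gm2]_w chi _ _) => x y z.
move=> q1 q2 q3 q4 q5.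
have eE : e = eps * (4 * M + 2) by rewrite divfK// gt_eqF.
have -> : x - a = (x - (y - M * z)) + ((y - b) - M * (z - c)) - (a - (b - M * c)) by ring.
apply: le_trans (ler_normB _ _) _; apply: le_trans (lerD (ler_normD _ _) q1) _.
apply: le_trans (lerD (lerD q2 (ler_normB _ _)) (lexx _)) _.
rewrite normrM (ger0_norm M0).
have l1 : M * `|z - c| <= M * eps by rewrite ler_wpM2l.
have l2 : M * (1 - z) <= M * eps by rewrite ler_wpM2l// (le_trans (ler_norm _)).
have l3 : M * (1 - c) <= M * (eps + eps).
  rewrite ler_wpM2l// (_ : 1 - c = (1 - z) + (z - c)); last by ring.
  by rewrite lerD// (le_trans (ler_norm _)).
rewrite eE; have -> : eps * (4 * M + 2) = M * eps + M * eps + M * (eps + eps) + eps + eps by ring.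
by move: l1 l2 l3 q4; lra.
Qed.

End levy_continuity.

(** * Square roots of symmetric 2 x 2 matrices *)

Section sqrt_factor.
Context {R : realType}.
Implicit Types (p q r a b u v : R).

Lemma mulmx22 (A : 'M[R]_2) a b :
  A *m col2 a b = col2 (A 0 0 * a + A 0 1 * b) (A 1 0 * a + A 1 1 * b).
Proof.
apply/matrixP => i j; rewrite !mxE big_ord_recl big_ord1 !mxE/=.
have -> : lift ord0 ord0 = 1 :> 'I_2 by apply/val_inj.
by case: i => -[|[|//]] hi; rewrite ?mxE/=; congr (A _ _ * _ + A _ _ * _); apply/val_inj.
Qed.

Lemma col2_ind (V : 'cV[R]_2) : V = col2 (V 0 0) (V 1 0).
Proof.
apply/matrixP => i j; rewrite !mxE (ord1 j).
by case: i => -[|[|//]] hi; rewrite /=; congr (V _ _); apply/val_inj.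
Qed.

Lemma mx22M (a b c d a' b' c' d' : R) : mx22 a b c d *m mx22 a' b' c' d' =
  mx22 (a * a' + b * c') (a * b' + b * d') (c * a' + d * c') (c * b' + d * d').
Proof.
apply/matrixP => i j; rewrite !mxE big_ord_recl big_ord1 !mxE/=.
by case: i => -[|[|//]] hi; case: j => -[|[|//]] hj.
Qed.

Lemma mx22_tr (a b c d : R) : (mx22 a b c d)^T = mx22 a c b d.
Proof.
apply/matrixP => i j; rewrite !mxE.
by case: i => -[|[|//]] hi; case: j => -[|[|//]] hj.
Qed.

Lemma sym_posdef_mx22 p q r : 0 < p -> 0 < p * r - q ^+ 2 -> sym_posdef (mx22 p q q r).
Proof.
move=> p0 d0; split; first exact: mx22_tr.
move=> V; rewrite (col2_ind V); move: (V 0 0) (V 1 0) => x y V0.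
rewrite -mulmxA mulmx22 !mxE/= big_ord_recl big_ord1 !mxE/=.
have h : 0 < p * x ^+ 2 + 2 * q * x * y + r * y ^+ 2.
  rewrite -(pmulr_rgt0 _ p0).
  have -> : p * (p * x ^+ 2 + 2 * q * x * y + r * y ^+ 2) =
    (p * x + q * y) ^+ 2 + (p * r - q ^+ 2) * y ^+ 2 by ring.
  have [y0|y0] := eqVneq y 0.
    have x0 : x != 0.
      apply: contraNneq V0 => x0; rewrite x0 y0; apply/eqP/matrixP => i j.
      by rewrite !mxE; case: ifP.
    by rewrite y0 mulr0 addr0 expr0n mulr0 addr0 exprn_even_gt0//= mulf_neq0// gt_eqF.
  by rewrite ltr_wpDl ?sqr_ge0// mulr_gt0// exprn_even_gt0.
apply: lt_le_trans h _; rewrite le_eqVlt; apply/orP; left; apply/eqP; ring.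
Qed.

Lemma sqrtmx_mx22 p q r : 0 < p -> 0 < p * r - q ^+ 2 ->
  let S := sqrtmx (mx22 p q q r) in S^T = S /\ S *m S = mx22 p q q r.
Proof.
move=> p0 d0 S.
have [[ST _] SS] : sym_posdef S /\ S *m S = mx22 p q q r.
  apply: (@xgetPex _ 0 [set S | sym_posdef S /\ S *m S = mx22 p q q r]).
  (* By Cayley-Hamilton a root [S] of [A] satisfies [S^2 - t S + D = 0] with
     [D = det S = sqrt (det A)], [t = tr S] and [t^2 = tr A + 2 D]; hence the witness
     [(A + D) / t]. *)
  pose D := Num.sqrt (p * r - q ^+ 2).
  have D0 : 0 < D by rewrite sqrtr_gt0.
  have DE : D ^+ 2 = p * r - q ^+ 2 by rewrite sqr_sqrtr// ltW.
  have r0 : 0 < r.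
    by rewrite -(pmulr_rgt0 _ p0); have := sqr_ge0 q; lra.
  pose t := Num.sqrt (p + r + 2 * D).
  have t0 : 0 < t by rewrite sqrtr_gt0; lra.
  have tE : t ^+ 2 = p + r + 2 * D by rewrite sqr_sqrtr//; lra.
  have tn : t != 0 by rewrite gt_eqF.
  exists (mx22 ((p + D) / t) (q / t) (q / t) ((r + D) / t)); split.
    apply: sym_posdef_mx22; first by rewrite divr_gt0// addr_gt0.
    have -> : (p + D) / t * ((r + D) / t) - (q / t) ^+ 2 =
      ((p * r - q ^+ 2) + (p + r) * D + D ^+ 2) / t ^+ 2 by field.
    rewrite divr_gt0 ?exprn_gt0// addr_gt0 ?exprn_gt0// addr_gt0// mulr_gt0// addr_gt0//.
  have rE : r = t ^+ 2 - p - 2 * D by rewrite tE; ring.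
  have qE : q ^+ 2 = p * r - D ^+ 2 by rewrite DE; ring.
  rewrite mx22M; congr mx22.
  - have -> : (p + D) / t * ((p + D) / t) + q / t * (q / t) =
      ((p + D) ^+ 2 + q ^+ 2) / t ^+ 2 by field.
    by rewrite qE rE; field.
  - have -> : (p + D) / t * (q / t) + q / t * ((r + D) / t) = q * (p + r + 2 * D) / t ^+ 2 by field.
    by rewrite -tE mulfK// expf_neq0.
  - have -> : q / t * ((p + D) / t) + (r + D) / t * (q / t) = q * (p + r + 2 * D) / t ^+ 2 by field.
    by rewrite -tE mulfK// expf_neq0.
  - have -> : q / t * (q / t) + (r + D) / t * ((r + D) / t) =
      ((r + D) ^+ 2 + q ^+ 2) / t ^+ 2 by field.
    have -> : (r + D) ^+ 2 + q ^+ 2 = r * t ^+ 2 by rewrite qE tE; ring.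
    by rewrite mulfK// expf_neq0.
by [].
Qed.

(** If [S] is the symmetric root and [B] the triangular factor, [B B^T = S^2], so [Q = S^-1 B]
    satisfies [Q Q^T = 1]. The signs of [b11] and [b22] are free. *)
Lemma invsqrtmx_factor (b11 b21 b22 : R) : b11 != 0 -> b22 != 0 ->
  exists Q : 'M[R]_2,
    [/\ Q 0 0 ^+ 2 + Q 0 1 ^+ 2 = 1, Q 1 0 ^+ 2 + Q 1 1 ^+ 2 = 1,
        Q 0 0 * Q 1 0 + Q 0 1 * Q 1 1 = 0 &
        forall u v, invsqrtmx (mx22 (b11 ^+ 2) (b11 * b21) (b11 * b21) (b21 ^+ 2 + b22 ^+ 2)) *m
          col2 (b11 * u) (b21 * u + b22 * v) =
          col2 (Q 0 0 * u + Q 0 1 * v) (Q 1 0 * u + Q 1 1 * v)].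
Proof.
move=> b1 b2; set A := mx22 _ _ _ _.
have p0 : 0 < b11 ^+ 2 by rewrite exprn_even_gt0.
have dE : b11 ^+ 2 * (b21 ^+ 2 + b22 ^+ 2) - (b11 * b21) ^+ 2 = (b11 * b22) ^+ 2 by ring.
have d0 : 0 < b11 ^+ 2 * (b21 ^+ 2 + b22 ^+ 2) - (b11 * b21) ^+ 2.
  by rewrite dE exprn_even_gt0//= mulf_neq0.
have [ST SS] := sqrtmx_mx22 p0 d0; rewrite -/A in ST SS.
pose B : 'M[R]_2 := mx22 b11 0 b21 b22.
have BB : B *m B^T = sqrtmx A *m sqrtmx A.
  by rewrite SS /B mx22_tr mx22M /A; congr mx22; ring.
(* The adjugate of [A] shows that [A], hence its root, is invertible. *)
have AI : mx22 (b21 ^+ 2 + b22 ^+ 2) (- (b11 * b21)) (- (b11 * b21)) (b11 ^+ 2) *m A =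
    ((b11 * b22) ^+ 2)%:M.
  rewrite /A mx22M; apply/matrixP => i j; rewrite !mxE.
  by case: i => -[|[|//]] hi; case: j => -[|[|//]] hj; rewrite /= ?mulr1n ?mulr0n; ring.
have SU : sqrtmx A \in unitmx.
  have c0 : (b11 * b22) ^+ 2 != 0 by rewrite expf_neq0// mulf_neq0.
  have h : (((b11 * b22) ^+ 2)^-1 *:
    mx22 (b21 ^+ 2 + b22 ^+ 2) (- (b11 * b21)) (- (b11 * b21)) (b11 ^+ 2) *m sqrtmx A) *m sqrtmx A = 1%:M.
    by rewrite -mulmxA SS -scalemxAl AI -mul_scalar_mx -scalar_mxM mulVf.
  by have [_] := mulmx1_unit h.
pose Q : 'M[R]_2 := invmx (sqrtmx A) *m B.
have QQ : Q *m Q^T = 1%:M.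
  rewrite /Q trmx_mul trmx_inv ST mulmxA -(mulmxA _ B) BB.
  by rewrite mulmxA mulVmx// mul1mx mulmxV.
have e (i j : 'I_2) : Q i 0 * Q j 0 + Q i 1 * Q j 1 = (1%:M : 'M[R]_2) i j.
  rewrite -QQ; move: (Q) => M; rewrite !mxE big_ord_recl big_ord1 !mxE.
  have -> : lift ord0 ord0 = 1 :> 'I_2 by apply/val_inj.
  by have -> : ord0 = 0 :> 'I_2 by apply/val_inj.
exists Q; split.
- by have := e 0 0; rewrite !mxE/= !expr2.
- by have := e 1 1; rewrite !mxE/= !expr2.
- by have := e 0 1; rewrite !mxE/=.
- move=> u v; rewrite -[RHS]mulmx22 /Q -mulmxA; congr (_ *m _).
  by rewrite /B mulmx22 !mxE/=; congr col2; ring.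
Qed.

End sqrt_factor.

(** * Linearization of the estimators *)

Section log_design.
Context {R : realType}.
Implicit Types n j : nat.
Local Notation m := (@mean_ln R).
Local Notation s := (@ss_ln R).

Let lnj_ge0 j : (0 < j)%N -> 0 <= ln j%:R :> R.
Proof. by move=> j0; apply: ln_ge0; rewrite ler1n. Qed.

Let lnj_le j n : (0 < j)%N -> (j <= n)%N -> ln j%:R <= ln n%:R :> R.
Proof.
move=> j0 jn; rewrite ler_ln ?posrE ?ltr0n ?ler_nat//.
exact: leq_trans jn.
Qed.

Lemma mean_ln_ge0 n : 0 <= m n.
Proof.
rewrite mulr_ge0 ?invr_ge0//.
rewrite big_seq_cond; apply: sumr_ge0 => j; rewrite andbT mem_index_iota => /andP[j0 _].
exact: lnj_ge0.
Qed.

Lemma mean_ln_le n : (0 < n)%N -> m n <= ln n%:R.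
Proof.
move=> n0; rewrite /mean_ln ler_pdivrMl ?ltr0n// mulrC mulr_natr.
apply: (@le_trans _ _ (\sum_(1 <= j < n.+1) ln n%:R)); last first.
  by rewrite sumr_const_nat subn1.
rewrite big_seq_cond [leRHS]big_seq_cond; apply: ler_sum => j.
by rewrite andbT mem_index_iota ltnS => /andP[j0 jn]; exact: lnj_le.
Qed.

Lemma norm_ln_centered j n : (0 < j)%N -> (j <= n)%N -> `|ln j%:R - m n| <= ln n%:R.
Proof.
move=> j0 jn; have n0 := leq_trans j0 jn.
have h1 := lnj_ge0 j0; have h2 := lnj_le j0 jn.
have h3 := mean_ln_ge0 n; have h4 := mean_ln_le n0.
by rewrite ler_norml; apply/andP; split; lra.
Qed.

Lemma sum_ln_centered n : (0 < n)%N -> \sum_(1 <= j < n.+1) (ln j%:R - m n) = 0.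
Proof.
move=> n0; rewrite big_split/= sumrN sumr_const_nat subn1/= /mean_ln.
by rewrite -[(_ * _) *+ n]mulr_natr mulrAC mulVf ?mul1r ?subrr// pnatr_eq0 -lt0n.
Qed.

Lemma sum_ln_mul_centered n : (0 < n)%N ->
  \sum_(1 <= j < n.+1) ln j%:R * (ln j%:R - m n) = s n.
Proof.
move=> n0; have -> : s n = \sum_(1 <= j < n.+1) ln j%:R * (ln j%:R - m n) -
    m n * \sum_(1 <= j < n.+1) (ln j%:R - m n).
  rewrite mulr_sumr -sumrB; apply: eq_bigr => j _; by rewrite -mulrBl expr2.
by rewrite sum_ln_centered// mulr0 subr0.
Qed.

(** Pair [j] with [j + h], where [h] is half of [n]: as [j <= h], the two logarithms differ by at
    least [ln 2], so each pair contributes [(ln 2)^2 / 2] whatever the centre, and there are at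
    least [n / 4] pairs. *)
Lemma ss_ln_ge n : (2 <= n)%N -> n%:R * (ln 2 ^+ 2 / 8) <= s n.
Proof.
move=> n2; pose h := (n./2)%N.
have hn : (h + h <= n)%N by rewrite addnn -[leqRHS](odd_double_half n) leq_addl.
have h4 : (n <= 4 * h)%N.
  have := odd_double_half n; rewrite -/h; case: (odd n) => /=; lia.
have sq0 (x : R) : 0 <= (x - m n) ^+ 2 by exact: sqr_ge0.
have -> : s n = \sum_(1 <= j < (h + h).+1) (ln j%:R - m n) ^+ 2 +
    \sum_((h + h).+1 <= j < n.+1) (ln j%:R - m n) ^+ 2.
  by rewrite -big_cat_nat.
have -> : \sum_(1 <= j < (h + h).+1) (ln j%:R - m n) ^+ 2 =
    \sum_(1 <= j < h.+1) ((ln j%:R - m n) ^+ 2 + (ln (j + h)%:R - m n) ^+ 2).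
  rewrite (@big_cat_nat _ _ _ h.+1)//=; last by rewrite ltnS leq_addl.
  rewrite big_split/=; congr (_ + _).
  transitivity (\sum_(1 + h <= i < (h + h).+1) (ln i%:R - m n) ^+ 2); first by rewrite add1n.
  by rewrite big_addn subSn ?leq_addl// addnK.
apply: (@le_trans _ _ (\sum_(1 <= j < h.+1) (ln 2 ^+ 2 / 2))).
  rewrite sumr_const_nat subn1/= -[leRHS]mulr_natr.
  have : n%:R <= 4 * h%:R :> R by rewrite -natrM ler_nat.
  have := sqr_ge0 (ln 2 : R); nra.
rewrite -[leLHS]addr0 lerD ?sumr_ge0//.
rewrite big_seq_cond [leRHS]big_seq_cond; apply: ler_sum => j.
rewrite andbT mem_index_iota ltnS => /andP[j0 jh].
have d : ln 2 <= ln (j + h)%:R - ln j%:R :> R.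
  rewrite -ln_div ?posrE ?ltr0n ?addn_gt0 ?j0//.
  rewrite ler_ln ?posrE ?divr_gt0 ?ltr0n ?addn_gt0 ?j0//.
  by rewrite ler_pdivlMr ?ltr0n// -natrM ler_nat mul2n -addnn leq_add2l.
have l2 : 0 <= ln 2 :> R by apply: ln_ge0; rewrite ler1n.
move: d; move: (ln j%:R) (ln (j + h)%:R) => x y d.
have : (y - x) ^+ 2 / 2 <= (x - m n) ^+ 2 + (y - m n) ^+ 2.
  by have := sqr_ge0 (x + y - 2 * m n); nra.
apply: le_trans; rewrite ler_pM2r// lerXn2r ?nnegrE// (le_trans l2)//.
Qed.

Let q n : R := Num.sqrt (Num.sqrt n%:R).

Let q_cvg : (q n)^-1 @[n --> \oo] --> (0 : R).
Proof.
have h : Num.sqrt (Num.sqrt n.+1%:R^-1) @[n --> \oo] --> (0 : R).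
  have c1 : Num.sqrt (n.+1%:R^-1 : R) @[n --> \oo] --> Num.sqrt (0 : R).
    by apply: continuous_cvg; [exact: sqrt_continuous|exact: cvg_harmonic].
  rewrite -[X in _ --> X]sqrtr0 -[X in _ --> Num.sqrt X]sqrtr0.
  by apply: continuous_cvg; [exact: sqrt_continuous|exact: c1].
rewrite -cvg_shiftS; apply: cvg_trans h; apply: near_eq_cvg; near=> n.
by rewrite /q !sqrtrV// sqrtr_ge0.
Unshelve. all: by end_near. Qed.

Lemma near_sqr_ln_small (eps : R) : 0 < eps ->
  \forall n \near \oo, (1 + ln n%:R) ^+ 2 / Num.sqrt n%:R <= eps.
Proof.
(* With [t = n^(1/8)], [ln n = 8 ln t <= 8 (t - 1)], so [1 + ln n <= 9 t] and
   [(9 t)^2 = 81 n^(1/4)]: the quotient is at most [81 n^(- 1/4)]. *)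
move=> eps0; have e81 : 0 < eps / 81 by rewrite divr_gt0.
near=> n.
have n0 : (0 < n)%N by near: n; exact: nbhs_infty_gt.
have qe : `|0 - (q n)^-1| <= eps / 81.
  by near: n; move/cvgrPdist_le : q_cvg => /(_ _ e81).
have n1 : 1 <= n%:R :> R by rewrite ler1n.
pose t : R := Num.sqrt (q n).
have s1 (x : R) : 1 <= x -> 1 <= Num.sqrt x.
  by move=> x1; rewrite -[leLHS]sqrtr1 ler_wsqrtr.
have t1 : 1 <= t by rewrite /t /q !s1.
have tq : t ^+ 2 = q n by rewrite sqr_sqrtr// sqrtr_ge0.
have q1 : 1 <= q n by rewrite /q !s1.
have qs : q n ^+ 2 = Num.sqrt n%:R by rewrite sqr_sqrtr// sqrtr_ge0.
have nE : n%:R = t ^+ 8.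
  by rewrite (exprM _ 2 4) tq (exprM _ 2 2) qs sqr_sqrtr// ler0n.
have t0 : 0 < t by rewrite (lt_le_trans ltr01).
have lnE : ln n%:R = 8 * ln t.
  by rewrite nE lnXn// mulr_natl.
have lt : ln t <= t - 1.
  have := @le_ln1Dx R (t - 1); rewrite (addrC 1) subrK; apply; lra.
have l0 := ln_ge0 t1.
rewrite -qs -tq; have h : (1 + ln n%:R) ^+ 2 <= (9 * t) ^+ 2.
  rewrite lerXn2r ?nnegrE ?addr_ge0 ?mulr_ge0 ?(ltW t0)//; rewrite lnE; lra.
rewrite ler_pdivrMr ?exprn_gt0// ?exprn_gt0//.
apply: le_trans h _; rewrite sub0r normrN ger0_norm ?invr_ge0 in qe; last exact: sqrtr_ge0.
have q0 : 0 < q n by rewrite (lt_le_trans ltr01).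
have h2 : 1 <= eps / 81 * q n by rewrite -ler_pdivrMr// mul1r.
rewrite exprMn tq; have -> : 9 ^+ 2 * q n = 81 * q n * 1 by ring.
have -> : eps * q n ^+ 2 = 81 * q n * (eps / 81 * q n) by field.
by rewrite ler_wpM2l// mulr_ge0// ltW.
Unshelve. all: by end_near. Qed.

End log_design.

Section linearization.
Context {R : realType}.
Implicit Types (nu lambda sigma x D : R).

(** [(1 - D) exp D <= 1 <= (1 + D + 2 D^2) (1 - D)], the second inequality using [2 D <= 1]. *)
Lemma norm_expR_taylor D : `|D| <= 1 / 2 -> `|expR D - 1 - D| <= 2 * D ^+ 2.
Proof.
move=> hD; have h1 := expR_ge1Dx D; have h2 := expR_ge1Dx (- D).
rewrite ler_norml in hD; move/andP: hD => [d1 d2].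
rewrite ger0_norm; last by lra.
have e0 := expR_gt0 D; have h3 : (1 - D) * expR D <= 1.
  have : expR (- D) * expR D = 1 by rewrite -expRD addNr expR0.
  by move: h2; nra.
have h4 : expR D * (1 - D) <= (1 + D + 2 * D ^+ 2) * (1 - D).
  apply: le_trans (_ : 1 <= _); first by rewrite mulrC.
  have : (1 + D + 2 * D ^+ 2) * (1 - D) - 1 = D ^+ 2 * (1 - 2 * D) by ring.
  have : 0 <= D ^+ 2 * (1 - 2 * D) by rewrite mulr_ge0 ?sqr_ge0//; lra.
  lra.
have := h4; rewrite ler_pM2r; lra.
Qed.

Let norm_ratio_le x q : `|q| <= 1 / 2 -> `|x * q / (1 - q)| <= 2 * `|x| * `|q|.
Proof.
rewrite ler_norml => /andP[d1 d2]; have q1 : 0 < 1 - q by lra.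
rewrite normrM normfV (gtr0_norm q1) ler_pdivrMr// normrM.
have : 0 <= `|x| * `|q| by rewrite mulr_ge0.
by move: (`|x|) (`|q|) => a b ab; nra.
Qed.

(** The estimator is exactly [nu / (1 - q)], so its normalised error is [N1 / (1 - q)] without
    remainder. *)
Lemma linearize_nu nu sigma v N1 : 0 < nu -> 0 < sigma -> 0 < v ->
  let q := nu * (sigma * N1 / v) in `|q| <= 1 / 2 ->
  let nuh := - (1 / (- (1 / nu) + sigma * N1 / v)) in
  v * (nuh - nu) / (sigma * nu ^+ 2) = N1 / (1 - q) /\
  `|N1 / (1 - q) - N1| <= 2 * `|N1| * `|q|.
Proof.
move=> nu0 s0 v0 q hq nuh; have hq' := hq.
rewrite ler_norml in hq'; move/andP: hq' => [d1 d2].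
have q1 : 1 - q != 0 by rewrite gt_eqF//; lra.
have nn : nu != 0 by rewrite gt_eqF.
have vn : v != 0 by rewrite gt_eqF.
have sn : sigma != 0 by rewrite gt_eqF.
have E : - (1 / nu) + sigma * N1 / v = - (1 - q) / nu by rewrite /q; field; rewrite nn vn.
split.
  rewrite /nuh E.
  have -> : - (1 / (- (1 - q) / nu)) - nu = nu * q / (1 - q).
    by move: q q1 {E hq d1 d2 nuh} => q q1; field; rewrite nn q1.
  by rewrite {1}/q; move: (1 - q) q1 => p p0; field; rewrite nn vn sn p0.
have -> : N1 / (1 - q) - N1 = N1 * q / (1 - q).
  by move: q q1 {E hq d1 d2 nuh} => q q1; field.
exact: norm_ratio_le.
Qed.

(* [lh = lambda * expR D], where [D] is linear in [N1], [N2] up to the factor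
   [1 / (1 - q)]. *)
Lemma linearize_lambda nu lambda sigma g v w m N1 N2 : 0 < nu -> 0 < lambda ->
  0 < sigma -> 0 < v -> 0 < w ->
  let E1 := sigma * N1 / v in let eb := sigma * N2 / w in
  let q := nu * E1 in `|q| <= 1 / 2 ->
  let A := m + ln lambda in
  let D := nu * (A * E1 - eb) / (1 - q) in `|D| <= 1 / 2 ->
  forall lh V,
  lh = expR ((- (ln lambda / nu) - g + eb - m * E1 + g) / (- (1 / nu) + E1)) ->
  V = A * w / v * (N1 / (1 - q)) - w * (lh - lambda) / (sigma * lambda * nu) ->
  `|V - N2| <= 2 * `|N2| * `|q| + 2 * w * D ^+ 2 / (sigma * nu).
Proof.
move=> nu0 l0 s0 v0 w0 E1 eb q hq A D hD lh V lhE VE0; have hq' := hq.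
rewrite ler_norml in hq'; move/andP: hq' => [d1 d2].
have q1 : 1 - q != 0 by rewrite gt_eqF//; lra.
have nn : nu != 0 by rewrite gt_eqF.
have vn : v != 0 by rewrite gt_eqF.
have wn : w != 0 by rewrite gt_eqF.
have sn : sigma != 0 by rewrite gt_eqF.
have ln0 : lambda != 0 by rewrite gt_eqF.
have lE : lh = lambda * expR D.
  rewrite lhE; have -> : - (1 / nu) + E1 = - (1 - q) / nu by rewrite /q; field.
  have -> : (- (ln lambda / nu) - g + eb - m * E1 + g) / (- (1 - q) / nu) = ln lambda + D.
    have qE : E1 = q / nu by rewrite /q; field.
    have alg (X b p : R) : 1 - p != 0 ->
        (- (X / nu) - g + b - m * (p / nu) + g) / (- (1 - p) / nu) =
        X + nu * ((m + X) * (p / nu) - b) / (1 - p).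
      by move=> p1; field; rewrite nn p1.
    by rewrite /D /A qE alg.
  by rewrite expRD lnK ?posrE.
have VE : V - N2 = N2 * q / (1 - q) - w * (expR D - 1 - D) / (sigma * nu).
  have -> : V - N2 = A * w / v * (N1 / (1 - q)) - w * D / (sigma * nu) - N2
      - w * (expR D - 1 - D) / (sigma * nu).
    have alg (x e D' : R) : x - w * (lambda * e - lambda) / (sigma * lambda * nu) - N2 =
        x - w * D' / (sigma * nu) - N2 - w * (e - 1 - D') / (sigma * nu).
      by field; rewrite nn ln0 sn.
    by rewrite VE0 lE; exact: alg.
  have alg (p A' : R) : 1 - p != 0 -> A' * w / v * (N1 / (1 - p)) -
      w * (nu * (A' * (sigma * N1 / v) - sigma * N2 / w) / (1 - p)) / (sigma * nu) - N2 =
      N2 * p / (1 - p).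
    by move=> p1; field; rewrite ?nn ?sn ?p1 ?vn ?wn.
  by congr (_ - _); rewrite /D /E1 /eb alg.
rewrite VE; apply: le_trans (ler_normB _ _) _; apply: lerD.
  exact: norm_ratio_le.
rewrite normrM normfV (gtr0_norm (_ : 0 < sigma * nu)) ?mulr_gt0//.
rewrite ler_pM2r ?invr_gt0 ?mulr_gt0// normrM (gtr0_norm w0) (mulrC 2) -mulrA.
by rewrite ler_pM2l// norm_expR_taylor.
Qed.

(* [U], [V] are the errors of the two estimators, in the coordinates where their
   limit is standard normal. *)
Lemma near_linearize nu lambda sigma B eps : 0 < nu -> 0 < lambda -> 0 < sigma ->
  0 <= B -> 0 < eps ->
  \forall n \near \oo, forall N1 N2 v w m a1 a0 U V : R, `|N1| <= B -> `|N2| <= B ->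
  v = Num.sqrt (ss_ln n) -> w = Num.sqrt n%:R -> m = mean_ln n ->
  a1 = - (1 / nu) + sigma * N1 / v ->
  a0 = - (ln lambda / nu) - euler_gamma + sigma * N2 / w - m * (sigma * N1 / v) ->
  U = v * (- (1 / a1) - nu) / (sigma * nu ^+ 2) ->
  V = (m + ln lambda) * w / v * U -
    w * (expR ((a0 + euler_gamma) / a1) - lambda) / (sigma * lambda * nu) ->
  `|U - N1| <= eps /\ `|V - N2| <= eps.
Proof.
move=> nu0 l0 s0 B0 eps0.
pose c : R := Num.sqrt (ln 2 ^+ 2 / 8).
have l2 : 0 < ln 2 :> R by rewrite ln_gt0// ltr1n.
have c0 : 0 < c by rewrite sqrtr_gt0 divr_gt0 ?exprn_gt0.
(* With [l = ln n], [K1 / w] will bound [|q|] and [K2 (1 + l) / w] will bound [|D|], the 2 in [K2]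
   coming from [1 / (1 - q) <= 2]. [K] dominates every coefficient of [eta] met below. *)
pose K1 := nu * sigma * B / c.
pose K2 := 2 * nu * sigma * B * ((1 + `|ln lambda|) / c + 1).
have K10 : 0 <= K1.
  by apply: divr_ge0; [apply: mulr_ge0 => //; apply: mulr_ge0|]; exact: ltW.
have K20 : 0 <= K2.
  by rewrite !mulr_ge0 ?(ltW nu0) ?(ltW s0)// addr_ge0// divr_ge0 ?addr_ge0// ltW.
pose K := 2 * K1 + 2 * K2 + 2 * B * K1 + 2 * K2 ^+ 2 / (sigma * nu) + 1.
have K3 : 0 <= 2 * B * K1 by apply: mulr_ge0 => //; exact: mulr_ge0.
have K4 : 0 <= 2 * K2 ^+ 2 / (sigma * nu).
  by apply: divr_ge0; apply: mulr_ge0 => //; [exact: sqr_ge0|exact: ltW|exact: ltW].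
have K0 : 0 < K by rewrite /K; lra.
pose eta := Num.min 1 eps / K.
have eta0 : 0 < eta by rewrite divr_gt0// lt_min ltr01.
have etaK : eta * K <= 1 /\ eta * K <= eps.
  by rewrite /eta divfK ?gt_eqF// !ge_min !lexx orbT.
near=> n.
have n2 : (2 <= n)%N by near: n; exact: nbhs_infty_ge.
have hL : (1 + ln n%:R) ^+ 2 / Num.sqrt n%:R <= eta.
  by near: n; exact: near_sqr_ln_small.
move=> N1 N2 v w m a1 a0 U V hN1 hN2 vE wE mE a1E a0E UE0 VE0.
have n0 : 0 < n%:R :> R by rewrite ltr0n (ltn_trans _ n2).
have w0 : 0 < w by rewrite wE sqrtr_gt0.
have v0 : 0 < v.
  rewrite vE sqrtr_gt0; apply: lt_le_trans (ss_ln_ge n2).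
  by rewrite mulr_gt0// divr_gt0 ?exprn_gt0.
have vw : c * w <= v.
  rewrite /c wE vE -sqrtrM ?divr_ge0 ?sqr_ge0// ler_wsqrtr// mulrC.
  exact: ss_ln_ge.
have ln0 : 0 <= ln n%:R :> R by apply: ln_ge0; rewrite ler1n (ltn_trans _ n2).
have m0 : 0 <= m by rewrite mE; exact: mean_ln_ge0.
have mn : m <= ln n%:R by rewrite mE; apply: mean_ln_le; rewrite (ltn_trans _ n2).
move: hL; rewrite -wE; move: ln0 mn; move: (ln n%:R) => l ln0 mn hL.
have iv : v^-1 <= c^-1 * w^-1 by rewrite -invfM lef_pV2 ?posrE ?mulr_gt0.
have x0 : 0 < w^-1 by rewrite invr_gt0.
have iv0 : 0 <= v^-1 by rewrite invr_ge0 ltW.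
have ic0 : 0 <= c^-1 by rewrite invr_ge0 ltW.
have l1 : 1 <= 1 + l by rewrite lerDl.
have Lx : w^-1 <= eta.
  by apply: le_trans hL; rewrite ler_peMl ?(ltW x0)// exprn_ege1.
have Ll : (1 + l) * w^-1 <= eta.
  apply: le_trans hL; rewrite ler_wpM2r ?(ltW x0)// expr2 ler_peMl//.
  by rewrite addr_ge0.
have E1le : `|sigma * N1 / v| <= sigma * B * (c^-1 * w^-1).
  rewrite normrM (ger0_norm iv0) normrM (gtr0_norm s0).
  apply: ler_pM => //; first by rewrite mulr_ge0// ltW.
  by rewrite ler_wpM2l// ltW.
have eble : `|sigma * N2 / w| <= sigma * B * w^-1.
  rewrite normrM (gtr0_norm x0) normrM (gtr0_norm s0).
  by rewrite ler_wpM2r ?(ltW x0)// ler_wpM2l// ltW.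
pose q := nu * (sigma * N1 / v).
have qle : `|q| <= K1 * eta.
  rewrite normrM (gtr0_norm nu0); apply: le_trans (_ : K1 * w^-1 <= _); last by rewrite ler_wpM2l.
  have -> : K1 * w^-1 = nu * (sigma * B * (c^-1 * w^-1)) by rewrite /K1; ring.
  by rewrite ler_wpM2l// ltW.
have [eK1 eK2] := etaK.
have Keta (k : R) : 0 <= k -> k <= K -> k * eta <= 1 /\ k * eta <= eps.
  move=> k0 kK; have h : k * eta <= eta * K by rewrite mulrC ler_wpM2l// ltW.
  by split; exact: le_trans h _.
have [q1 _] : 2 * K1 * eta <= 1 /\ 2 * K1 * eta <= eps.
  by apply: Keta; [rewrite mulr_ge0|rewrite /K; lra].
have hq : `|q| <= 1 / 2 by apply: le_trans qle _; lra.
have [UE hU] := linearize_nu nu0 s0 v0 hq.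
have {}UE : U = N1 / (1 - q) by rewrite UE0 a1E; exact: UE.
have h2q (N : R) : `|N| <= B -> 2 * `|N| * `|q| <= 2 * B * K1 * eta.
  move=> hN; have -> : 2 * B * K1 * eta = 2 * B * (K1 * eta) by ring.
  by apply: ler_pM => //; rewrite ler_wpM2l.
have [_ k3] : 2 * B * K1 * eta <= 1 /\ 2 * B * K1 * eta <= eps.
  by apply: Keta => //; rewrite /K; lra.
split.
  by rewrite UE; apply: le_trans hU _; apply: le_trans (h2q _ hN1) k3.
pose A := m + ln lambda.
pose D := nu * (A * (sigma * N1 / v) - sigma * N2 / w) / (1 - q).
have Ale : `|A| <= (1 + `|ln lambda|) * (1 + l).
  rewrite /A; apply: le_trans (ler_normD _ _) _; rewrite (ger0_norm m0).
  have : 0 <= `|ln lambda| * l by rewrite mulr_ge0.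
  by move: (normr_ge0 (ln lambda)); move: (`|ln lambda|) => X; lra.
have Dle : `|D| <= K2 * ((1 + l) * w^-1).
  have hq' := hq; rewrite ler_norml in hq'; move/andP: hq' => [d1 d2].
  have q0 : 0 < 1 - q by lra.
  rewrite /D normrM normfV (gtr0_norm q0) ler_pdivrMr// normrM (gtr0_norm nu0).
  have h1 : `|A * (sigma * N1 / v) - sigma * N2 / w| <=
      sigma * B * ((1 + `|ln lambda|) / c + 1) * ((1 + l) * w^-1).
    apply: le_trans (ler_normB _ _) _; rewrite normrM.
    apply: le_trans (lerD (ler_pM (normr_ge0 _) (normr_ge0 _) Ale E1le) eble) _.
    have -> : sigma * B * ((1 + `|ln lambda|) / c + 1) * ((1 + l) / w) =
      (1 + `|ln lambda|) * (1 + l) * (sigma * B * (c^-1 * w^-1)) + (1 + l) * (sigma * B * w^-1) by ring.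
    rewrite lerD2l ler_peMl//.
    by apply: mulr_ge0; [apply: mulr_ge0 => //; exact: ltW|exact: ltW].
  have h2 : 0 <= nu * (sigma * B * ((1 + `|ln lambda|) / c + 1) * ((1 + l) * w^-1)).
    by rewrite mulr_ge0 ?(ltW nu0)// (le_trans _ h1).
  have -> : K2 * ((1 + l) / w) * (1 - q) =
      nu * (sigma * B * ((1 + `|ln lambda|) / c + 1) * ((1 + l) / w)) * (2 * (1 - q)).
    by rewrite /K2; ring.
  apply: le_trans (ler_wpM2l (ltW nu0) h1) _; rewrite ler_peMr//; lra.
have Dle2 : `|D| <= K2 * eta by apply: le_trans Dle _; rewrite ler_wpM2l.
have [d2 _] : 2 * K2 * eta <= 1 /\ 2 * K2 * eta <= eps.
  by apply: Keta; [rewrite mulr_ge0|rewrite /K; lra].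
have hD : `|D| <= 1 / 2 by apply: le_trans Dle2 _; lra.
have VE1 : V = A * w / v * (N1 / (1 - q)) -
    w * (expR ((- (ln lambda / nu) - euler_gamma + sigma * N2 / w - m * (sigma * N1 / v) + euler_gamma) /
      (- (1 / nu) + sigma * N1 / v)) - lambda) / (sigma * lambda * nu).
  by rewrite VE0 UE a0E a1E.
have hV := linearize_lambda nu0 l0 s0 v0 w0 hq hD (erefl _) VE1.
apply: le_trans hV _.
(* This is where the squared logarithm enters: [w D^2] is of order [(1 + l)^2 / w], as [m] in [D]
   grows like [l]. *)
have wD : w * D ^+ 2 <= K2 ^+ 2 * eta.
  apply: (@le_trans _ _ (K2 ^+ 2 * ((1 + l) ^+ 2 / w))); last by rewrite ler_wpM2l ?sqr_ge0.
  have -> : K2 ^+ 2 * ((1 + l) ^+ 2 / w) = w * (K2 * ((1 + l) / w)) ^+ 2 by field; rewrite gt_eqF.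
  rewrite ler_wpM2l ?(ltW w0)// -(real_normK (num_real D)).
  by rewrite lerXn2r ?nnegrE// (le_trans _ Dle).
have sn0 : 0 < sigma * nu by rewrite mulr_gt0.
have h5 : 2 * w * D ^+ 2 / (sigma * nu) <= 2 * K2 ^+ 2 / (sigma * nu) * eta.
  rewrite [leRHS]mulrAC ler_wpM2r ?invr_ge0 ?(ltW sn0)//.
  by rewrite -[leLHS]mulrA -[leRHS]mulrA; apply: ler_wpM2l wD.
have [_ k6] : (2 * B * K1 + 2 * K2 ^+ 2 / (sigma * nu)) * eta <= 1 /\
    (2 * B * K1 + 2 * K2 ^+ 2 / (sigma * nu)) * eta <= eps.
  by apply: Keta; [rewrite addr_ge0|rewrite /K; lra].
apply: le_trans _ k6; rewrite [leRHS]mulrDl; exact: lerD (h2q _ hN2) h5.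
Unshelve. all: by end_near. Qed.

End linearization.

(** * Asymptotic normality *)

Section slutsky.
Context {R : realType}.
Local Notation gm2 := (@std_normal R \x @std_normal R)%E.

Lemma norm_sin_le (x : R) : `|sin x| <= `|x|.
Proof.
have h : 1 - cos x <= x ^+ 2 / 2.
  have [x0|x0] := leP 0 x; first exact: onem_cos_le.
  by rewrite -cosN -(sqrrN x) onem_cos_le// oppr_ge0 ltW.
rewrite -ler_sqr ?nnegrE// !real_normK ?num_real// sin2cos2.
have := cos_le1 x; have := cos_geN1 x; move: (cos x) h => y; nra.
Qed.

Lemma norm_cosB_le (x y : R) : `|cos x - cos y| <= `|x - y|.
Proof.
pose m := (x + y) / 2; pose h := (x - y) / 2.
have -> : x = m + h by rewrite /m /h; field.
have -> : y = m - h by rewrite /m /h; field.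
rewrite cosB cosD; have -> : m + h - (m - h) = 2 * h by ring.
have -> : cos m * cos h - sin m * sin h - (cos m * cos h + sin m * sin h) = - (2 * (sin m * sin h)) by ring.
rewrite normrN !normrM ler_wpM2l// -(normrM (x - y)) -/h -[leRHS]mul1r.
by rewrite ler_pM// ?norm_sin_le// ler_norml sin_geN1 sin_le1.
Qed.

Lemma norm_le_onep_sum_sqr (x y : R) : `|x| <= 1 + (x ^+ 2 + y ^+ 2).
Proof.
have := sqr_ge0 (`|x| - 1); have := sqr_ge0 y; rewrite -(real_normK (num_real x)).
by have := normr_ge0 x; move: (`|x|) (y ^+ 2) => a b; nra.
Qed.

Context d (T : measurableType d) (P : probability T R).

(* The coefficients may depend on [n] as long as [a n ^+ 2 + b n ^+ 2] is fixed,
   so the notion is invariant under rotations that depend on [n]. *)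
Definition asymptotically_std_normal (U V : nat -> T -> R) :=
  forall (a b : nat -> R) (c th : R), (forall n, a n ^+ 2 + b n ^+ 2 = c) ->
    \int[P]_w cos (a n * U n w + b n * V n w + th) @[n --> \oo] -->
      expR (- (c / 2)) * cos th.

(** The closeness is assumed only where [N1] and [N2] are bounded. The cosine is 1-Lipschitz there
    and bounded elsewhere, and the exceptional mass is controlled by the continuity theorem applied
    to a cutoff of [(N1, N2)]. *)
Lemma asymptotically_std_normal_perturb (N1 N2 U V : nat -> T -> R) :
  (forall n, measurable_fun setT (N1 n)) -> (forall n, measurable_fun setT (N2 n)) ->
  (forall n, measurable_fun setT (U n)) -> (forall n, measurable_fun setT (V n)) ->
  (forall B eps, 0 <= B -> 0 < eps -> \forall n \near \oo, forall w,
    `|N1 n w| <= B -> `|N2 n w| <= B -> `|U n w - N1 n w| <= eps /\ `|V n w - N2 n w| <= eps) ->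
  asymptotically_std_normal N1 N2 -> asymptotically_std_normal U V.
Proof.
move=> mN1 mN2 mU mV close CN a b c th abc.
have c0 : 0 <= c by rewrite -(abc 0%N) addr_ge0 ?sqr_ge0.
have na n : `|a n| <= 1 + c by rewrite -(abc n) norm_le_onep_sum_sqr.
have nb n : `|b n| <= 1 + c by rewrite -(abc n) [_ ^+ 2 + _]addrC norm_le_onep_sum_sqr.
apply/cvgrPdist_le => e e0.
(* The budget is [eps] for the limit of [N1], [N2], [2 (1 + c) eps] for the perturbation and [4 eps]
   for the cutoff. *)
pose eps := e / (2 * c + 8); have D0 : 0 < 2 * c + 8 by lra.
have eps0 : 0 < eps by rewrite divr_gt0.
have eE : e = eps * (2 * c + 8) by rewrite divfK// gt_eqF.
have [k hk] : exists k : nat, `|1 - \int[gm2]_z (cutoff k%:R z.1 * cutoff k%:R z.2)| <= eps.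
  move/cvgrPdist_le : (@cvg_mean_cutoff2 R) => /(_ _ eps0) [N _ hN]; exists N.
  by apply: hN => /=.
pose chi (z : R * R) := cutoff k%:R z.1 * cutoff k%:R z.2.
have Cchi : \int[P]_w chi (N1 n w, N2 n w) @[n --> \oo] --> \int[gm2]_z chi z.
  apply: (levy_continuity2 (@continuous_cutoff2 R k%:R) (norm_cutoff2_le1 k%:R)) => //.
  by move=> a' b' th'; exact: CN.
have Ccos := CN a b c th abc.
have bchi n : bounded_mfun (fun w => chi (N1 n w, N2 n w)).
  split; last by exists 1 => w; exact: norm_cutoff2_le1.
  apply: (measurableT_comp (f := chi : measurableTypeR R * measurableTypeR R -> R)).
    exact: continuous_measurable2 (@continuous_cutoff2 R k%:R).
  by apply: measurable_fun_pair => _ S mS; [exact: mN1|exact: mN2].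
have bcos (X Y : T -> R) (p q : R) : measurable_fun setT X -> measurable_fun setT Y ->
    bounded_mfun (fun w => cos (p * X w + q * Y w + th)).
  move=> mX mY; apply: bounded_mfun_cos_comp.
  by apply: measurable_funD => //; apply: measurable_funD; exact: measurable_funM.
have pw n w : (forall w, `|N1 n w| <= k%:R + 1 -> `|N2 n w| <= k%:R + 1 ->
      `|U n w - N1 n w| <= eps /\ `|V n w - N2 n w| <= eps) ->
    `|cos (a n * U n w + b n * V n w + th) - cos (a n * N1 n w + b n * N2 n w + th)| <=
    2 * (1 + c) * eps + 2 * (1 - chi (N1 n w, N2 n w)).
  move=> hn; have chi1 := cutoff2_le1 k%:R (N1 n w, N2 n w); rewrite -/(chi _) in chi1.
  have p0 : 0 <= 2 * (1 + c) * eps.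
    by apply: mulr_ge0; [rewrite mulr_ge0// addr_ge0|exact: ltW].
  have far : chi (N1 n w, N2 n w) = 0 ->
      `|cos (a n * U n w + b n * V n w + th) - cos (a n * N1 n w + b n * N2 n w + th)| <=
      2 * (1 + c) * eps + 2 * (1 - chi (N1 n w, N2 n w)).
    move=> ->; apply: le_trans (ler_normB _ _) _.
    have nc x : `|cos x| <= 1 :> R by rewrite ler_norml cos_geN1 cos_le1.
    by apply: le_trans (lerD (nc _) (nc _)) _; lra.
  have [h1|h1] := leP `|N1 n w| (k%:R + 1); last first.
    by apply: far; rewrite /chi/= (cutoff_eq0 h1) mul0r.
  have [h2|h2] := leP `|N2 n w| (k%:R + 1); last first.
    by apply: far; rewrite /chi/= (cutoff_eq0 h2) mulr0.
  have [d1 d2] := hn w h1 h2.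
  apply: le_trans (norm_cosB_le _ _) _.
  have -> : a n * U n w + b n * V n w + th - (a n * N1 n w + b n * N2 n w + th) =
    a n * (U n w - N1 n w) + b n * (V n w - N2 n w) by ring.
  apply: le_trans (ler_normD _ _) _; rewrite !normrM.
  apply: le_trans (lerD (ler_pM _ _ (na n) d1) (ler_pM _ _ (nb n) d2)) _ => //.
  by rewrite (_ : 2 * (1 + c) * eps = (1 + c) * eps + (1 + c) * eps); [lra|ring].
have mean_le n : (forall w, `|N1 n w| <= k%:R + 1 -> `|N2 n w| <= k%:R + 1 ->
      `|U n w - N1 n w| <= eps /\ `|V n w - N2 n w| <= eps) ->
    `|\int[P]_w cos (a n * U n w + b n * V n w + th) -
      \int[P]_w cos (a n * N1 n w + b n * N2 n w + th)| <=
    2 * (1 + c) * eps + 2 * (1 - \int[P]_w chi (N1 n w, N2 n w)).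
  move=> hn; rewrite -(mean_bB P (bcos _ _ _ _ (mU n) (mV n)) (bcos _ _ _ _ (mN1 n) (mN2 n))).
  have b2 : bounded_mfun (fun w => 1 - chi (N1 n w, N2 n w)).
    by apply: bounded_mfunB => //; exact: bounded_mfun_cst.
  have b3 : bounded_mfun (fun w => 2 * (1 - chi (N1 n w, N2 n w))).
    exact: (bounded_mfunM (bounded_mfun_cst 2) b2).
  have -> : 1 - \int[P]_w chi (N1 n w, N2 n w) = \int[P]_w (1 - chi (N1 n w, N2 n w)).
    by rewrite (mean_bB P (bounded_mfun_cst 1) (bchi n)) (Rintegral_prob_cst P 1).
  rewrite -(mean_bZ P 2 b2).
  have -> : 2 * (1 + c) * eps + \int[P]_w (2 * (1 - chi (N1 n w, N2 n w))) =
      \int[P]_w (2 * (1 + c) * eps + 2 * (1 - chi (N1 n w, N2 n w))).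
    by rewrite (mean_bD P (bounded_mfun_cst _) b3) (Rintegral_prob_cst P _).
  apply: norm_mean_le_mean.
  - by apply: integrable_bounded_mfun; apply: bounded_mfunB; exact: bcos.
  - by apply: integrable_bounded_mfun; apply: bounded_mfunD => //; exact: bounded_mfun_cst.
  - by move=> w; exact: pw.
have k1 : 0 <= k%:R + 1 :> R by rewrite addr_ge0.
have [N0 _ hN0] := close _ _ k1 eps0.
move/cvgrPdist_le : Cchi => /(_ _ eps0) [N3 _ hN3].
move/cvgrPdist_le : Ccos => /(_ _ eps0) [N4 _ hN4].
exists (maxn N0 (maxn N3 N4)) => // n /=; rewrite !geq_max => /and3P[n0 n3 n4].
have := mean_le n (hN0 n n0); have := hN3 n n3; have := hN4 n n4; move: hk.
rewrite /= -/chi.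
move: (\int[P]_w cos _) (\int[P]_w cos _) (\int[P]_w chi _) (\int[gm2]_w _) (expR _ * _) => A B X Y Z.
move=> q1 q2 q3 q4.
have -> : Z - A = (Z - B) - (A - B) by ring.
apply: le_trans (ler_normB _ _) _; apply: le_trans (lerD q2 q4) _.
have l1 := le_trans (ler_norm _) q1; have l2 := le_trans (ler_norm _) q3.
rewrite eE (_ : 2 * (1 + c) * eps = 2 * eps + 2 * c * eps); last by ring.
rewrite (_ : eps * (2 * c + 8) = 8 * eps + 2 * c * eps); last by ring.
move: (c * eps) => ce; lra.
Qed.

End slutsky.

Section least_squares_noise.
Context {R : realType}.
Implicit Types (sigma : R) (e : nat -> R).

Definition slope_noise sigma n e : R :=
  (\sum_(1 <= j < n.+1) (ln j%:R - mean_ln n) * e j) / (sigma * Num.sqrt (ss_ln n)).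

Definition level_noise sigma n e : R :=
  (\sum_(1 <= j < n.+1) e j) / (sigma * Num.sqrt n%:R).

Lemma ss_ln_gt0 n : (2 <= n)%N -> 0 < ss_ln n :> R.
Proof.
move=> n2; apply: lt_le_trans (ss_ln_ge n2).
by rewrite mulr_gt0 ?ltr0n ?(ltn_trans _ n2)// divr_gt0// exprn_gt0// ln_gt0// ltr1n.
Qed.

(** The centred logarithms annihilate the intercept [al] and pair with [ln j] to [ss_ln n], leaving
    slope and noise. *)
Lemma hat_a1_noise (al nu sigma : R) n (y e : nat -> R) : nu != 0 -> sigma != 0 -> (2 <= n)%N ->
  (forall j, (0 < j)%N -> y j = al - ln j%:R / nu + e j) ->
  hat_a1 n y = - (1 / nu) + sigma * slope_noise sigma n e / Num.sqrt (ss_ln n).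
Proof.
move=> nn s0 n2 yE; have s_gt0 := ss_ln_gt0 n2; have n0 : (0 < n)%N by exact: ltn_trans n2.
rewrite /hat_a1 (@eq_big_nat _ _ _ _ _ _ (fun j => al * (ln j%:R - mean_ln n) +
  - nu^-1 * (ln j%:R * (ln j%:R - mean_ln n)) + (ln j%:R - mean_ln n) * e j)); last first.
  by move=> j /andP[j0 _]; rewrite yE//; ring.
rewrite !big_split -!mulr_sumr/= sum_ln_centered// sum_ln_mul_centered// /slope_noise.
have alg (v S : R) : v != 0 -> (al * 0 + - nu^-1 * v ^+ 2 + S) / v ^+ 2 =
    - (1 / nu) + sigma * (S / (sigma * v)) / v by move=> v0; field; rewrite v0 s0 nn.
have sE : ss_ln n = Num.sqrt (ss_ln n) ^+ 2 :> R by rewrite sqr_sqrtr// ltW.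
by rewrite {1 2}sE alg// sqrtr_eq0 -ltNge.
Qed.

Lemma hat_a0_noise (al nu sigma : R) n (y e : nat -> R) : nu != 0 -> sigma != 0 -> (2 <= n)%N ->
  (forall j, (0 < j)%N -> y j = al - ln j%:R / nu + e j) ->
  hat_a0 n y = al + sigma * level_noise sigma n e / Num.sqrt n%:R -
    mean_ln n * (sigma * slope_noise sigma n e / Num.sqrt (ss_ln n)).
Proof.
move=> nn s0 n2 yE; have n0 : (0 < n)%N by exact: ltn_trans n2.
rewrite /hat_a0 (hat_a1_noise nn s0 n2 yE) /level_noise.
rewrite (@eq_big_nat _ _ _ _ _ _ (fun j => al + - nu^-1 * ln j%:R + e j)); last first.
  by move=> j /andP[j0 _]; rewrite yE//; ring.
rewrite !big_split -!mulr_sumr/= sumr_const_nat subSS subn0.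
have -> : \sum_(1 <= j < n.+1) ln j%:R = n%:R * mean_ln n :> R.
  by rewrite /mean_ln mulVKf// pnatr_eq0 -lt0n.
have alg (w E m S : R) : w != 0 -> (w ^+ 2)^-1 * (al * w ^+ 2 + - nu^-1 * (w ^+ 2 * m) + S) -
    (- (1 / nu) + E) * m = al + sigma * (S / (sigma * w)) / w - m * E.
  by move=> w0; field; rewrite w0 s0 nn.
have nE : n%:R = Num.sqrt n%:R ^+ 2 :> R by rewrite sqr_sqrtr.
by rewrite -[al *+ n]mulr_natr {1 2 3}nE alg// sqrtr_eq0 -ltNge ltr0n.
Qed.

End least_squares_noise.

Section least_squares_clt.
Context d (T : measurableType d) (R : realType) (P : probability T R).
Variable e : nat -> T -> R.
Hypothesis me : forall i, (0 < i)%N -> measurable_fun setT (e i).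
Hypothesis indep : forall (J : seq nat) (B : nat -> set R),
  uniq J -> (forall i, i \in J -> (0 < i)%N) -> (forall i, measurable (B i)) ->
  P (\bigcap_(i in [set` J]) (e i @^-1` B i)) = (\prod_(i <- J) P (e i @^-1` B i))%E.
Variables (sigma K : R).
Hypothesis sigma_gt0 : 0 < sigma.
Hypothesis ie : forall i, (0 < i)%N -> P.-integrable setT (EFin \o e i).
Hypothesis ie2 : forall i, (0 < i)%N -> P.-integrable setT (fun w => (e i w ^+ 2)%:E).
Hypothesis e_mean : forall i, (0 < i)%N -> \int[P]_w e i w = 0.
Hypothesis e_var : forall i, (0 < i)%N -> \int[P]_w (e i w ^+ 2) = sigma ^+ 2.
Hypothesis e_abs3 : forall i, (0 < i)%N -> (\int[P]_w (`|e i w| ^+ 3)%:E <= K%:E)%E.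

Lemma measurable_slope_noise n :
  measurable_fun setT (fun w => slope_noise sigma n (e^~ w)).
Proof.
apply: measurable_funM => //; under eq_fun do rewrite big_add1 /=.
by apply: measurable_sum => j; apply: measurable_funM => //; exact: me.
Qed.

Lemma measurable_level_noise n :
  measurable_fun setT (fun w => level_noise sigma n (e^~ w)).
Proof.
apply: measurable_funM => //; under eq_fun do rewrite big_add1 /=.
by apply: measurable_sum => j; exact: me.
Qed.

(** The value 0 outside [1..n] makes the bounds on coefficients hold for every [j], as
    [mean_cos_clt] requires. *)
Let cf (a b : R) n j : R := if (0 < j <= n)%N then
  a * (ln j%:R - mean_ln n) / (sigma * Num.sqrt (ss_ln n)) + b / (sigma * Num.sqrt n%:R) else 0.

Let cfE a b n w : a * slope_noise sigma n (e^~ w) + b * level_noise sigma n (e^~ w) =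
  \sum_(1 <= j < n.+1) cf a b n j * e j w.
Proof.
rewrite /slope_noise /level_noise !mulrA ![_ * \sum_(_ <= _ < _) _]mulr_sumr !mulr_suml -big_split/=.
apply: eq_big_nat => j jn; rewrite /cf ltnS in jn *; rewrite jn.
by rewrite [RHS]mulrDl; congr (_ + _); ring.
Qed.

(** The two noises are orthogonal since the centred logarithms sum to 0; the variance therefore
    depends on [(a, b)] only through its norm. *)
Let sum_cf_sqr a b n : (2 <= n)%N ->
  \sum_(1 <= j < n.+1) cf a b n j ^+ 2 = (a ^+ 2 + b ^+ 2) / sigma ^+ 2.
Proof.
move=> n2; have s_gt0 : 0 < ss_ln n :> R := ss_ln_gt0 n2.
have n0 : (0 < n)%N by exact: ltn_trans n2.
pose p := a / (sigma * Num.sqrt (ss_ln n)); pose q := b / (sigma * Num.sqrt n%:R).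
have [q2 q2E] : exists q2, q2 = q ^+ 2 by eexists.
rewrite (@eq_big_nat _ _ _ _ _ _ (fun j => p ^+ 2 * (ln j%:R - mean_ln n) ^+ 2 +
  2 * p * q * (ln j%:R - mean_ln n) + q2)); last first.
  by move=> j; rewrite /cf ltnS => ->; rewrite q2E /p /q; ring.
rewrite !big_split -!mulr_sumr/= sum_ln_centered// mulr0 addr0 -/(ss_ln n).
rewrite sumr_const_nat subSS subn0 -[q2 *+ n]mulr_natr q2E.
have -> : p ^+ 2 = a ^+ 2 / (sigma ^+ 2 * ss_ln n).
  by rewrite /p !exprMn exprVn exprMn sqr_sqrtr// ltW.
have -> : q ^+ 2 = b ^+ 2 / (sigma ^+ 2 * n%:R).
  by rewrite /q !exprMn exprVn exprMn sqr_sqrtr.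
have : ss_ln n != 0 :> R by rewrite gt_eqF.
have : n%:R != 0 :> R by rewrite gt_eqF// ltr0n.
move: (ss_ln n) (n%:R) => x y y0 x0.
by field; rewrite x0 y0 gt_eqF.
Qed.

(** Uniform negligibility of the summands: [|ln j - m| <= ln n], while [sqrt s] is at least a
    constant times [sqrt n]. *)
Let cf_bound a b A n j : (2 <= n)%N -> `|a| <= A -> `|b| <= A ->
  `|cf a b n j| <= A / sigma * ((Num.sqrt (ln 2 ^+ 2 / 8))^-1 + 1) * ((1 + ln n%:R) ^+ 2 / Num.sqrt n%:R).
Proof.
move=> n2 aA bA; have n0 : 0 < n%:R :> R by rewrite ltr0n (ltn_trans _ n2).
have A0 : 0 <= A := le_trans (normr_ge0 a) aA.
have l0 : 0 <= ln n%:R :> R by apply: ln_ge0; rewrite ler1n (ltn_trans _ n2).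
have c0 : 0 < Num.sqrt (ln 2 ^+ 2 / 8) :> R.
  by rewrite sqrtr_gt0 divr_gt0// exprn_gt0// ln_gt0// ltr1n.
have vw : Num.sqrt (ln 2 ^+ 2 / 8) * Num.sqrt n%:R <= Num.sqrt (ss_ln n) :> R.
  by rewrite -sqrtrM ?divr_ge0 ?sqr_ge0// ler_wsqrtr// mulrC ss_ln_ge.
have w0 : 0 < Num.sqrt n%:R :> R by rewrite sqrtr_gt0.
have v0 : 0 < Num.sqrt (ss_ln n) :> R by rewrite (lt_le_trans _ vw)// mulr_gt0.
rewrite /cf; case: ifP => [/andP[j0 jn]|_]; last first.
  rewrite normr0; apply: mulr_ge0; last by rewrite divr_ge0 ?sqr_ge0 ?(ltW w0).
  by rewrite mulr_ge0 ?addr_ge0 ?invr_ge0 ?(ltW c0)// divr_ge0// ltW.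
have hl := @norm_ln_centered R _ _ j0 jn.
move: c0 vw w0 v0 l0 hl.
move: (Num.sqrt (ln 2 ^+ 2 / 8)) (Num.sqrt n%:R) (Num.sqrt (ss_ln n)) (ln n%:R) (ln j%:R - mean_ln n).
move=> c w v l x c0 vw w0 v0 l0 hl.
have iv : v^-1 <= c^-1 * w^-1 by rewrite -invfM lef_pV2 ?posrE ?mulr_gt0.
have L1 : 1 <= 1 + l by rewrite lerDl.
have Ll : l <= (1 + l) ^+ 2 by have := sqr_ge0 l; nra.
have L2 : 1 <= (1 + l) ^+ 2 by rewrite exprn_ege1.
have iw0 : 0 <= w^-1 by rewrite invr_ge0 ltW.
have is0 : 0 <= sigma^-1 by rewrite invr_ge0 ltW.
have iv0 : 0 <= v^-1 by rewrite invr_ge0 ltW.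
apply: le_trans (ler_normD _ _) _.
rewrite !normrM !normfV !normrM (gtr0_norm sigma_gt0) (gtr0_norm v0) (gtr0_norm w0) !invfM.
have -> : A / sigma * (c^-1 + 1) * ((1 + l) ^+ 2 / w) =
   A * (1 + l) ^+ 2 * (sigma^-1 * (c^-1 * w^-1)) + A * (sigma^-1 * ((1 + l) ^+ 2 * w^-1)) by ring.
apply: lerD.
  apply: ler_pM; rewrite ?mulr_ge0//; last by rewrite ler_wpM2l.
  have hx := le_trans hl Ll.
  by apply: ler_pM => //.
apply: ler_pM => //; first by rewrite mulr_ge0.
by rewrite ler_wpM2l// ler_peMl.
Qed.

(** The cubic error is at most the largest coefficient times the sum of squares, which is the
    constant [c / sigma^2]; all bounds on [(a n, b n)] go through [c], so they are uniform over the
    circle. *)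
Lemma least_squares_clt : asymptotically_std_normal P
  (fun n w => slope_noise sigma n (e^~ w)) (fun n w => level_noise sigma n (e^~ w)).
Proof.
move=> a b c th abc.
have c0 : 0 <= c by rewrite -(abc 0%N) addr_ge0 ?sqr_ge0.
have na n : `|a n| <= 1 + c by rewrite -(abc n) norm_le_onep_sum_sqr.
have nb n : `|b n| <= 1 + c by rewrite -(abc n) [_ ^+ 2 + _]addrC norm_le_onep_sum_sqr.
pose H := (1 + c) / sigma * ((Num.sqrt (ln 2 ^+ 2 / 8))^-1 + 1).
have H0 : 0 <= H.
  apply: mulr_ge0; first by rewrite divr_ge0 ?addr_ge0// ltW.
  by rewrite addr_ge0// invr_ge0 sqrtr_ge0.
pose K' := `|K / 3 + (sigma ^+ 2) ^+ 2 / 8| * (c / sigma ^+ 2).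
have K0 : 0 <= K' by rewrite mulr_ge0// divr_ge0// sqr_ge0.
apply/cvgrPdist_le => eps eps0.
pose eta := Num.min 1 (eps / (K' + 1)).
have eta0 : 0 < eta by rewrite lt_min ltr01 divr_gt0// ltr_wpDl.
have etaH : 0 < eta / (H + 1) by rewrite divr_gt0// ltr_wpDl.
near=> n.
have n2 : (2 <= n)%N by near: n; exact: nbhs_infty_ge.
have hL : (1 + ln n%:R) ^+ 2 / Num.sqrt n%:R <= eta / (H + 1).
  by near: n; exact: near_sqr_ln_small.
have cf_eta j : `|cf (a n) (b n) n j| <= eta.
  apply: le_trans (cf_bound j n2 (na n) (nb n)) _.
  apply: le_trans (ler_wpM2l H0 hL) _.
  by rewrite mulrA ler_pdivrMr ?ltr_wpDl// mulrC ler_wpM2l ?(ltW eta0)// lerDl.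
have cf1 j : `|cf (a n) (b n) n j| <= 1.
  by apply: le_trans (cf_eta j) _; rewrite ge_min lexx.
have := mean_cos_clt me indep (sqr_ge0 sigma) ie ie2 e_mean e_var e_abs3 n th cf1.
rewrite sum_cf_sqr// abc.
have -> : sigma ^+ 2 / 2 * (c / sigma ^+ 2) = c / 2 by field; rewrite gt_eqF.
under eq_Rintegral do rewrite -cfE.
rewrite distrC => h; apply: le_trans h _.
have cube : \sum_(1 <= j < n.+1) `|cf (a n) (b n) n j| ^+ 3 <= eta * (c / sigma ^+ 2).
  rewrite -(abc n) -(sum_cf_sqr _ _ n2) mulr_sumr; apply: ler_sum => j _.
  by rewrite exprS real_normK ?num_real// ler_wpM2r ?sqr_ge0.
have sum0 : 0 <= \sum_(1 <= j < n.+1) `|cf (a n) (b n) n j| ^+ 3.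
  by apply: sumr_ge0 => j _; exact: exprn_ge0.
apply: le_trans (ler_wpM2r sum0 (ler_norm _)) _.
apply: le_trans (ler_wpM2l (normr_ge0 _) cube) _.
rewrite mulrCA -/K' mulrC; apply: (@le_trans _ _ (K' * (eps / (K' + 1)))).
  by rewrite ler_wpM2l// ge_min lexx orbT.
by rewrite mulrA ler_pdivrMr ?ltr_wpDl// mulrC ler_wpM2l ?(ltW eps0)// lerDl.
Unshelve. all: by end_near. Qed.

End least_squares_clt.

(** * From the fractional Yule process to the estimators *)

Section interbirth_times.
Context d (T : measurableType d) (R : realType) (P : probability T R).
Variables (nu lambda : R) (X : nat -> {RV P >-> R}).
Hypothesis nu0 : 0 < nu.
Hypothesis lambda0 : 0 < lambda.
Hypothesis X_yule : fractional_yule_interbirth nu lambda X.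

Let e i w := log_residual (X i) nu (lambda * i%:R) w.

Let rate_gt0 i : (0 < i)%N -> 0 < lambda * i%:R.
Proof. by move=> i0; rewrite mulr_gt0// ltr0n. Qed.

Let interbirth_law i : (0 < i)%N -> forall B : set R, measurable B ->
  distribution P (X i) B =
  (\int[lebesgue_measure]_(t in B) (ml_density nu (lambda * i%:R) t)%:E)%E.
Proof.
move=> i0 B mB; rewrite (X_yule.2 i i0 B mB) integral_mkcondr.
apply: eq_integral => t _; rewrite /patch; case: ifPn => [|tn].
  by rewrite inE/= in_itv/= andbT => t0; rewrite /ml_density pospowE.
rewrite /ml_density le0_pospow ?mulr0 ?mul0r//.
by rewrite leNgt; apply: contra tn => t0; rewrite inE/= in_itv/= t0.
Qed.

Lemma interbirth_le0 i : (0 < i)%N -> P [set w | X i w <= 0] = 0%E.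
Proof.
move=> i0; have := X_yule.2 i i0 `]-oo, 0]%classic (measurable_itv _).
rewrite (_ : _ `&` _ = set0) ?integral_set0; last first.
  by apply/seteqP; split => // t /=; rewrite !in_itv/= andbT => -[]; case: ltgtP.
rewrite /distribution /pushforward => <-; congr (P _).
Qed.

Lemma interbirth_laplace i z : (0 < i)%N -> 0 < z ->
  (\int[P]_w (expR (- (z * X i w)))%:E =
   (lambda * i%:R / (lambda * i%:R + z `^ nu))%:E)%E.
Proof. by move=> i0; apply: laplace_ml_law => //; [exact: rate_gt0|exact: interbirth_law]. Qed.

Lemma residual_independent (J : seq nat) (B : nat -> set R) :
  uniq J -> (forall i, i \in J -> (0 < i)%N) -> (forall i, measurable (B i)) ->
  P (\bigcap_(i in [set` J]) (e i @^-1` B i)) = (\prod_(i <- J) P (e i @^-1` B i))%E.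
Proof.
move=> uJ J0 mB.
pose f i (x : R) := ln x + (euler_gamma + ln (lambda * i%:R) / nu).
have mf i : measurable_fun setT (f i) by apply: measurable_funD => //; exact: measurable_ln.
apply: (X_yule.1 J (fun i => f i @^-1` B i)) => // i.
by rewrite -[X in measurable X]setTI; exact: mf.
Qed.

End interbirth_times.

(** [nu <= 1] gives [1 / (3 nu^2) >= 1 / 3 > 1 / 6]. *)
Lemma sigma2_eps_gt0 (R : realType) (nu : R) : 0 < nu -> nu <= 1 -> 0 < sigma2_eps nu.
Proof.
move=> nu0 nu1; rewrite /sigma2_eps; apply: mulr_gt0; first by rewrite exprn_gt0// pi_gt0.
rewrite subr_gt0 ltr_pdivlMr ?mulr_gt0 ?exprn_gt0//.
by have := exprn_ile1 2 (ltW nu0) nu1; lra.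
Qed.

(** Inversion is discontinuous at 0, but [x^-1 = x (x^2)^-1] holds there too, both sides being 0,
    and a power of a nonnegative real is measurable. *)
Lemma measurable_funV d (T : measurableType d) (R : realType) (f : T -> R) :
  measurable_fun setT f -> measurable_fun setT (fun x => (f x)^-1).
Proof.
move=> mf; rewrite (_ : (fun x => _) = (fun x => f x * (f x ^+ 2) `^ (-1))); last first.
  apply/funext => x; rewrite powR_inv1 ?sqr_ge0//.
  by have [->|fx] := eqVneq (f x) 0; rewrite ?invr0 ?mul0r// expr2 invfM mulVKf.
apply: measurable_funM => //; apply: (measurableT_comp (@measurable_powR R (-1))).
exact: measurable_funX.
Qed.

Lemma scale_mx22 (R : realType) (k a b c d : R) :
  k *: mx22 a b c d = mx22 (k * a) (k * b) (k * c) (k * d).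
Proof.
by apply/matrixP => i j; rewrite !mxE; case: (i == 0); case: (j == 0).
Qed.

(** A lower triangular factorisation. The negative [b22] reflects that a higher level of the
    logarithms lowers the estimate of [lambda]. *)
Lemma covC_factor (R : realType) (nu lambda sigma : R) n : sigma ^+ 2 = sigma2_eps nu ->
  (2 <= n)%N ->
  let b11 := Num.sqrt n%:R * sigma * nu ^+ 2 / Num.sqrt (ss_ln n) in
  let b21 := Num.sqrt n%:R * sigma * lambda * nu * (mean_ln n + ln lambda) / Num.sqrt (ss_ln n) in
  let b22 := - (sigma * lambda * nu) in
  n%:R * sigma2_eps nu *: covC nu lambda n =
  mx22 (b11 ^+ 2) (b11 * b21) (b11 * b21) (b21 ^+ 2 + b22 ^+ 2).
Proof.
move=> sE n2 b11 b21 b22; rewrite /covC -sE /b11 /b21 /b22.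
have s_gt0 : 0 < ss_ln n :> R := ss_ln_gt0 n2.
have n0 : 0 < n%:R :> R by rewrite ltr0n (ltn_trans _ n2).
have wE : n%:R = Num.sqrt n%:R ^+ 2 :> R by rewrite sqr_sqrtr// ltW.
have vE : ss_ln n = Num.sqrt (ss_ln n) ^+ 2 :> R by rewrite sqr_sqrtr// ltW.
have w0 : Num.sqrt n%:R != 0 :> R by rewrite sqrtr_eq0 -ltNge.
have v0 : Num.sqrt (ss_ln n) != 0 :> R by rewrite sqrtr_eq0 -ltNge.
rewrite scale_mx22; move: w0 v0 wE vE; clear b11 b21 b22 s_gt0 n0.
move: (mean_ln n) (ln lambda) (n%:R) (ss_ln n) (Num.sqrt n%:R) (Num.sqrt (ss_ln n)).
move=> m l x y w v w0 v0 -> ->.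
by congr mx22; field; rewrite ?w0 ?v0.
Qed.

Theorem theorem3p1 (R : realType) (d : measure_display) (Omega : measurableType d)
    (P : probability Omega R) (nu lambda : R) (T : nat -> {RV P >-> R})
    (nu_gt0 : 0 < nu) (nu_le1 : nu <= 1) (lambda_gt0 : 0 < lambda)
    (T_yule : fractional_yule_interbirth nu lambda T) :
  let Y := fun (w : Omega) (j : nat) => ln (T j w) in
  cvg_in_distribution2 P
    (fun n w =>
       invsqrtmx (n%:R * sigma2_eps nu *: covC nu lambda n) *m
       (Num.sqrt n%:R *:
          col2 (hat_nu n (Y w) - nu) (hat_lambda n (Y w) - lambda)))
    (std_normal2 R).
Proof.
move=> Y h ch [M hM].
have s2_gt0 := sigma2_eps_gt0 nu_gt0 nu_le1.
pose sigma := Num.sqrt (sigma2_eps nu).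
have sigma_gt0 : 0 < sigma by rewrite sqrtr_gt0.
have sigmaE : sigma ^+ 2 = sigma2_eps nu by rewrite sqr_sqrtr// ltW.
pose e i w := log_residual (T i) nu (lambda * i%:R) w.
have rate_gt0 i : (0 < i)%N -> 0 < lambda * i%:R by move=> i0; rewrite mulr_gt0// ltr0n.
have me i : (0 < i)%N -> measurable_fun setT (e i).
  by move=> i0; apply: measurable_log_residual.
have T_le0 := interbirth_le0 T_yule.
have lapT i (i0 : (0 < i)%N) z := @interbirth_laplace _ _ _ _ _ _ _ nu_gt0 lambda_gt0 T_yule i z i0.
pose N1 n w := slope_noise sigma n (e^~ w).
pose N2 n w := level_noise sigma n (e^~ w).
have CN : asymptotically_std_normal P N1 N2.
  apply: (@least_squares_clt _ _ _ _ e me (residual_independent T_yule) sigma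
    (32 / nu ^+ 3 * log_abs3 + 4 * log_abs3) sigma_gt0).
  - move=> i i0; exact: (integrable_log_residual nu_gt0 (rate_gt0 i i0) _ (T_le0 i i0) (lapT i i0)).
  - move=> i i0; exact: (integrable_log_residual_sqr nu_gt0 (rate_gt0 i i0) _ (T_le0 i i0) (lapT i i0)).
  - move=> i i0; exact: (log_residual_mean nu_gt0 (rate_gt0 i i0) _ (T_le0 i i0) (lapT i i0)).
  - move=> i i0; rewrite sigmaE.
    exact: (log_residual_variance nu_gt0 (rate_gt0 i i0) _ (T_le0 i i0) (lapT i i0)).
  - move=> i i0; exact: (log_residual_abs3 nu_gt0 (rate_gt0 i i0) _ (T_le0 i i0) (lapT i i0)).
pose al := - (ln lambda / nu) - euler_gamma.
have YE w j : (0 < j)%N -> Y w j = al - ln j%:R / nu + e j w.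
  move=> j0; rewrite /Y /e /log_residual /al lnM ?posrE ?ltr0n//.
  by field; rewrite gt_eqF.
have nn : nu != 0 by rewrite gt_eqF.
have sn : sigma != 0 by rewrite gt_eqF.
have mY j : measurable_fun setT (Y^~ j) by apply: measurableT_comp => //; exact: measurable_ln.
have m_a1 n : measurable_fun setT (fun w => hat_a1 n (Y w)).
  by apply: measurable_funM => //; apply: measurable_sum => j; exact: measurable_funM.
have m_nu n : measurable_fun setT (fun w => hat_nu n (Y w)).
  by apply: measurableT_comp => //; apply: measurable_funM => //; exact: measurable_funV.
have m_la n : measurable_fun setT (fun w => hat_lambda n (Y w)).
  apply: measurableT_comp; first exact: measurable_expR.
  apply: measurable_funM; last exact: measurable_funV.
  apply: measurable_funD => //; apply: measurable_funB; last exact: measurable_funM.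
  by apply: measurable_funM => //; exact: measurable_sum.
(* [(U, V)] is the error vector, scaled by [sqrt n], after inverting the triangular factor of
   [covC_factor]. *)
pose U n w := Num.sqrt (ss_ln n) * (hat_nu n (Y w) - nu) / (sigma * nu ^+ 2).
pose V n w := (mean_ln n + ln lambda) * Num.sqrt n%:R / Num.sqrt (ss_ln n) * U n w -
  Num.sqrt n%:R * (hat_lambda n (Y w) - lambda) / (sigma * lambda * nu).
have mU n : measurable_fun setT (U n).
  by apply: measurable_funM => //; apply: measurable_funM => //; exact: measurable_funB.
have mV n : measurable_fun setT (V n).
  apply: measurable_funB; first exact: measurable_funM.
  by apply: measurable_funM => //; apply: measurable_funM => //; exact: measurable_funB.
have CUV : asymptotically_std_normal P U V.
  apply: (asymptotically_std_normal_perturb _ _ mU mV _ CN).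
  - by move=> n; exact: measurable_slope_noise.
  - by move=> n; exact: measurable_level_noise.
  move=> B eps B0 eps0.
  have [N _ hN] := near_linearize nu_gt0 lambda_gt0 sigma_gt0 B0 eps0.
  exists (maxn N 2) => // n /=; rewrite geq_max => /andP[Nn n2] w h1 h2.
  apply: (hN n Nn _ _ _ _ _ (hat_a1 n (Y w)) (hat_a0 n (Y w)) _ _ h1 h2
    (erefl _) (erefl _) (erefl _) _ _ (erefl _) (erefl _)).
  - exact: hat_a1_noise nn sn n2 (YE w).
  - exact: hat_a0_noise nn sn n2 (YE w).
pose Z n w := invsqrtmx (n%:R * sigma2_eps nu *: covC nu lambda n) *m
  (Num.sqrt n%:R *: col2 (hat_nu n (Y w) - nu) (hat_lambda n (Y w) - lambda)).
have scale_col2 (k x y : R) : k *: col2 x y = col2 (k * x) (k * y).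
  by apply/matrixP => i j; rewrite !mxE; case: (i == 0).
have ZE n w i : Z n w i 0 =
    invsqrtmx (n%:R * sigma2_eps nu *: covC nu lambda n) i 0 *
      (Num.sqrt n%:R * (hat_nu n (Y w) - nu)) +
    invsqrtmx (n%:R * sigma2_eps nu *: covC nu lambda n) i 1 *
      (Num.sqrt n%:R * (hat_lambda n (Y w) - lambda)).
  rewrite /Z scale_col2 mxE big_ord_recl big_ord1 !mxE/=.
  by have -> : lift ord0 ord0 = 1 :> 'I_2 by exact/val_inj.
have mZ n i : measurable_fun setT (fun w => Z n w i 0).
  under eq_fun do rewrite ZE; apply: measurable_funD; apply: measurable_funM => //;
    apply: measurable_funM => //; exact: measurable_funB.
have rot n : exists Q : 'M[R]_2,
    [/\ Q 0 0 ^+ 2 + Q 0 1 ^+ 2 = 1, Q 1 0 ^+ 2 + Q 1 1 ^+ 2 = 1,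
     Q 0 0 * Q 1 0 + Q 0 1 * Q 1 1 = 0 & (2 <= n)%N -> forall w,
     Z n w = col2 (Q 0 0 * U n w + Q 0 1 * V n w) (Q 1 0 * U n w + Q 1 1 * V n w)].
  (* For [n < 2] the logarithms have no spread and [ss_ln n = 0]; the identity is a placeholder that
     makes the choice of [Q] total. *)
  have [n2|_] := leqP 2 n; last first.
    by exists 1; split=> //; rewrite !mxE/= ?expr1n ?expr0n/= ?addr0 ?add0r ?mulr0 ?mul0r ?addr0.
  have s0 : 0 < ss_ln n :> R := ss_ln_gt0 n2.
  have w0 : Num.sqrt n%:R != 0 :> R by rewrite sqrtr_eq0 -ltNge ltr0n (ltn_trans _ n2).
  have v0 : Num.sqrt (ss_ln n) != 0 :> R by rewrite sqrtr_eq0 -ltNge.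
  have ln0 : lambda != 0 by rewrite gt_eqF.
  pose b11 := Num.sqrt n%:R * sigma * nu ^+ 2 / Num.sqrt (ss_ln n).
  pose b21 := Num.sqrt n%:R * sigma * lambda * nu * (mean_ln n + ln lambda) / Num.sqrt (ss_ln n).
  pose b22 := - (sigma * lambda * nu).
  have b11n : b11 != 0 by rewrite !mulf_neq0 ?invr_eq0 ?expf_neq0.
  have b22n : b22 != 0 by rewrite oppr_eq0 !mulf_neq0.
  have [Q [q1 q2 q3 q4]] := invsqrtmx_factor b21 b11n b22n.
  exists Q; split=> // _ w; rewrite -q4 /Z (covC_factor lambda sigmaE n2); congr (_ *m _).
  rewrite scale_col2 /V /U /b11 /b21 /b22.
  move: (Num.sqrt n%:R) (Num.sqrt (ss_ln n)) (mean_ln n) (ln lambda) (hat_nu _ _) (hat_lambda _ _) w0 v0.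
  clear - nn sn ln0 => x v m l p q w0 v0; congr col2; field; rewrite ?nn ?sn ?ln0 ?w0 ?v0//.
(* Transposition moves the rotation from [(U, V)] to [(a, b)]: the new coefficients depend on [n]
   but keep their norm, as [asymptotically_std_normal] demands. *)
have CZ a b th : \int[P]_w cos (a * Z n w 0 0 + b * Z n w 1 0 + th) @[n --> \oo] -->
    expR (- ((a ^+ 2 + b ^+ 2) / 2)) * cos th.
  have [Q hQ] := choice rot.
  pose a' n := a * Q n 0 0 + b * Q n 1 0; pose b' n := a * Q n 0 1 + b * Q n 1 1.
  have ab n : a' n ^+ 2 + b' n ^+ 2 = a ^+ 2 + b ^+ 2.
    have [q1 q2 q3 _] := hQ n; rewrite /a' /b'.
    have -> : (a * Q n 0 0 + b * Q n 1 0) ^+ 2 + (a * Q n 0 1 + b * Q n 1 1) ^+ 2 =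
      a ^+ 2 * (Q n 0 0 ^+ 2 + Q n 0 1 ^+ 2) + b ^+ 2 * (Q n 1 0 ^+ 2 + Q n 1 1 ^+ 2) +
      2 * a * b * (Q n 0 0 * Q n 1 0 + Q n 0 1 * Q n 1 1) by ring.
    by rewrite q1 q2 q3 !mulr1 mulr0 addr0.
  apply: cvg_trans (CUV a' b' _ th ab); apply: near_eq_cvg.
  exists 2%N => // n /= n2; apply: eq_Rintegral => w _.
  have [_ _ _ hZ] := hQ n; rewrite hZ// !mxE/= /a' /b'; congr (cos (_ + _)); ring.
have := levy_continuity2 ch hM (mZ^~ 0) (mZ^~ 1) CZ.
have bh : bounded_mfun (h : measurableTypeR R * measurableTypeR R -> R).
  by split; [exact: continuous_measurable2|exists M].
have bhZ n : bounded_mfun (fun w => h (Z n w 0 0, Z n w 1 0)).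
  split; last by exists M.
  apply: (measurableT_comp bh.1).
  by apply: measurable_fun_pair => _ S mS; exact: mZ.
move=> C.
have -> : (\int[std_normal2 R]_z (h z)%:E = (\int[(std_normal \x std_normal)%E]_z h z)%:E)%E.
  exact: (EFin_mean (@std_normal R \x @std_normal R)%E bh).
pose hZ n w : R := h (Z n w 0 0, Z n w 1 0).
have E : (fun n => 'E_P[hZ n]%E) = EFin \o (fun n => \int[P]_w hZ n w).
  by apply/funext => n; rewrite unlock; exact: EFin_mean (bhZ n).
have : 'E_P[hZ n]%E @[n --> \oo] --> (\int[(std_normal \x std_normal)%E]_z h z)%:E.
  by rewrite E; apply: cvg_EFin => //; exact: nearW.
by [].
Qed.
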